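(* Let $k\in\{0,\dots,d-1\}$. There is a constant $C$ depending only on $d$ (in particular independent of the polynomial degree $p$) such that for every $u\in X^k(\hat T)$, writing $u=u_\Gamma+u_{\mathcal I}$ with $u_{\mathcal I}\in X^k_{\mathcal I}(\hat T)$ and $u_\Gamma\in X^k_\Gamma(\hat T)$, $$\tfrac12\|u\|_{\hat T}^2\le\|u_\Gamma\|_{\hat T}^2+\|u_{\mathcal I}\|_{\hat T}^2\le C\big(\|u\|_{\hat T}^2+\|\mathrm d^ku\|_{\hat T}^2\big)\quad\text{and}\quad\|\mathrm d^ku\|_{\hat T}^2=\|\mathrm d^ku_\Gamma\|_{\hat T}^2+\|\mathrm d^ku_{\mathcal I}\|_{\hat T}^2.$$
   Context: Let $d\in\{2,3\}$, $\hat T\subset\mathbb R^d$ an equilateral reference simplex, $\Delta_l(\hat T)$ its $l$-dimensional subsimplices, $(\cdot,\cdot)_S$ and $\|\cdot\|_S$ the $L^2(S)$ inner product and norm, $\mathrm d^0=\nabla,\mathrm d^1=\nabla\times,\mathrm d^2=\nabla\cdot,\mathrm d^3=0$ (3D; analogous in 2D). Fix an exact polynomial complex $X^0(\hat T)\to\cdots\to X^d(\hat T)\to0$ of degree $p$ given by one of the standard first-kind, second-kind or hybrid finite element subcomplexes of the $L^2$ de Rham complex. Traces $\mathrm{tr}^k_S$ (restriction, tangential projection, normal component, identity on $\hat T$) and surface derivatives $\mathrm d^k_S$ with $\mathrm d^k_S\mathrm{tr}^k_Sv=\mathrm{tr}^{k+1}_S\mathrm d^kv$. For $\dim S\ge m+1$: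 $\mathring X^m(S)=\{\mathrm{tr}^m_Sv:v\in X^m(\hat T),\mathrm{tr}^m_{\partial S}v=0\}$, $\mathring X^{m,\mathrm I}(S)$ the $L^2(S)$-orthogonal complement of $\ker\mathrm d^m_S$ in it, $N^m_S=\dim\mathring X^{m,\mathrm I}(S)$; $N^m_S=1$ if $\dim S=m$; $N^{-1}_S=0$. Bases $\{\psi^m_{S,j}\}$ of $\mathring X^{m,\mathrm I}(S)$ with $(\mathrm d^m_S\psi^m_{S,j},\mathrm d^m_S\psi^m_{S,i})_S=\delta_{ij}$, $(\psi^m_{S,j},\psi^m_{S,i})_S=\lambda_{S,j}\delta_{ij}$. Degrees of freedom on $X^k(\hat T)$: $\ell^{k,\mathrm I}_{S,1}(v)=(1,\mathrm{tr}^k_Sv)_S$ ($\dim S=k$); $\ell^{k,\mathrm I}_{S,j}(v)=(\mathrm d^k_S\psi^k_{S,j},\mathrm d^k_S\mathrm{tr}^k_Sv)_S$ ($\dim S\ge k+1$); $\ell^{k,\mathrm{II}}_{S,j}(v)=(\mathrm d^{k-1}_S\psi^{k-1}_{S,j},\mathrm{tr}^k_Sv)_S$ ($\dim S\ge k$), with dual basis $\{\phi^{k,\mathrm I}_{S,j},\phi^{k,\mathrm{II}}_{S,n}\}$. $X^k_{\mathcal I}(\hat T)$ is the span of the interior basis functions (those with $S=\hat T$) and $X^k_\Gamma(\hat T)$ the span of all other basis functions. *)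

(* Defs.v *)
From HB Require Import structures.
From mathcomp Require Import all_boot all_order all_algebra.
From mathcomp Require Import mpoly.
From mathcomp Require Import reals.
Set Implicit Arguments. Unset Strict Implicit. Unset Printing Implicit Defensive.
Import Order.TTheory GRing.Theory Num.Theory.
Local Open Scope ring_scope.

(* Polynomial differential forms are represented in coordinates
   (standard FEEC language; vector proxies grad/curl/div correspond to the
   exterior derivative under the standard isometric identifications).
   A dform on R^n is a finite function I |-> coefficient of dx_I, for
   I : {set 'I_n} (dx_I = dx_{i_1} /\ ... /\ dx_{i_k}, i_1 < ... < i_k).
   A k-dform is a dform whose components vanish off the sets of size k. *)

Section FEEC.
Variable R : realType.

Definition dform (n : nat) := {ffun {set 'I_n} -> {mpoly R[n]}}.

Definition pure n k (w : dform n) : Prop :=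
  forall I : {set 'I_n}, #|I| != k -> w I = 0.

Definition sgn n (I : {set 'I_n}) (i : 'I_n) : R :=
  (-1) ^+ #|[set j in I | (j < i)%N]|.

Definition extd n (w : dform n) : dform n :=
  [ffun I : {set 'I_n} => \sum_(i : 'I_n | i \in I) sgn (I :\ i) i *: mderiv i (w (I :\ i))].

(* Koszul operator (contraction with the position vector x) *)
Definition koszul n (w : dform n) : dform n :=
  [ffun I : {set 'I_n} => \sum_(i : 'I_n | i \notin I) sgn I i *: ('X_i * w (i |: I))].

Definition Pdeg n (s : nat) (w : dform n) : Prop :=
  forall I, (msize (w I) <= s)%N.

(* P_r Lambda^k  = Pfull (r+1) k   (Pfull 0 k = {0} = P_{-1} Lambda^k) *)
Definition Pfull n (s k : nat) (w : dform n) : Prop := pure k w /\ Pdeg s w.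

(* P_r^- Lambda^k = P_{r-1} Lambda^k + kappa P_{r-1} Lambda^{k+1} = Pminus r k *)
Definition Pminus n (r k : nat) (w : dform n) : Prop :=
  exists a b : dform n, [/\ Pfull r k a, Pfull r k.+1 b & w = a + koszul b].

(* The standard (first-kind / second-kind / hybrid) polynomial de Rham
   complexes of degree p on R^d: X^0 = P_p Lambda^0, and for k >= 1,
   X^k = P_{r_k} Lambda^k if c k (a "full"/second-kind step) and
   X^k = P^-_{r_k} Lambda^k otherwise, where r_k = p - #{1 <= j <= k | c j}.
   c = false everywhere: first kind; c = true everywhere: second kind. *)
Definition nfull (c : nat -> bool) (k : nat) : nat := \sum_(1 <= j < k.+1) c j.

Definition Xcx n (c : nat -> bool) (p k : nat) (w : dform n) : Prop :=
  if k == 0%N then Pfull p.+1 0 w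
  else if c k then Pfull (p.+1 - nfull c k) k w
  else Pminus (p - nfull c k) k w.

Variable d : nat.
Variable vt : 'I_d.+1 -> 'rV[R]_d.

Definition equilateral : Prop :=
  exists h : R, 0 < h /\
    forall i j : 'I_d.+1, i != j -> \sum_(l < d) ((vt i - vt j) 0 l) ^+ 2 = h.

(* subsimplex S (a nonempty set of vertices), of dimension #|S| - 1 *)
Definition dimS (S : {set 'I_d.+1}) : nat := (#|S|).-1.

Definition svert (S : {set 'I_d.+1}) : seq 'rV[R]_d := [seq vt j | j <- enum S].

(* affine parametrization t |-> s_0 + sum_b t_b (s_{b+1} - s_0) of S
   by the unit simplex of R^m, m = dim S *)
Definition parA (S : {set 'I_d.+1}) (m : nat) : 'M[R]_(d, m) :=
  \matrix_(i < d, b < m) ((nth 0 (svert S) b.+1) 0 i - (nth 0 (svert S) 0) 0 i).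

Definition paraff (S : {set 'I_d.+1}) (m : nat) : d.-tuple {mpoly R[m]} :=
  [tuple ((nth 0 (svert S) 0) 0 i)%:MP + \sum_(b < m) parA S m i b *: 'X_b | i < d].

End FEEC.

Definition minor (R : ringType) a b (A : 'M[R]_(a, b)) (J : {set 'I_a}) (I : {set 'I_b}) : R :=
  \det (\matrix_(x < #|J|, y < #|J|)
          nth 0 (nth [::] [seq [seq A j i | i <- enum I] | j <- enum J] x) y).

Section FEEC2.
Local Unset Implicit Arguments.
Variable R : realType.

(* integral over the unit simplex {t >= 0, sum t <= 1} of R^m:
   int t^alpha = alpha! / (|alpha| + m)! *)
Definition intD m (q : {mpoly R[m]}) : R :=
  \sum_(mm <- msupp q)
     q@_mm * ((\prod_(i < m) (mm i)`!)%:R / ((mdeg mm + m)`!)%:R).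

(* L^2 inner product of k-forms on a simplex parametrized over the unit
   simplex of R^m by an affine map with (constant) Gram matrix G:
   (a,b) = int sqrt(det G) sum_{I,J} det(G^{-1}[I,J]) a_I b_J *)
Definition ipG m (G : 'M[R]_m) (k : nat) (a b : dform R m) : R :=
  Num.sqrt (\det G) *
  intD m (\sum_(I : {set 'I_m} | #|I| == k) \sum_(J : {set 'I_m} | #|J| == k)
          minor (invmx G) I J *: (a I * b J)).

Variable d : nat.
Variable vt : 'I_d.+1 -> 'rV[R]_d.

Definition Gram (S : {set 'I_d.+1}) : 'M[R]_(dimS S) :=
  (parA vt S (dimS S))^T *m parA vt S (dimS S).

(* (S-)trace of a dform on R^d, i.e. pullback by the parametrization of S *)
Definition trace (S : {set 'I_d.+1}) (w : dform R d) : dform R (dimS S) :=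
  [ffun I : {set 'I_(dimS S)} =>
     \sum_(J : {set 'I_d} | #|J| == #|I|)
        minor (parA vt S (dimS S)) J I *: comp_mpoly (paraff vt S (dimS S)) (w J)].

Definition ipS (S : {set 'I_d.+1}) (k : nat) (a b : dform R (dimS S)) : R :=
  ipG (dimS S) (Gram S) k a b.

Definition bdry_trace0 (S : {set 'I_d.+1}) (w : dform R d) : Prop :=
  forall F : {set 'I_d.+1}, F \subset S -> #|F| = (#|S|).-1 -> (0 < #|F|)%N ->
    trace F w = 0.

Variable X : nat -> dform R d -> Prop.

Definition Xring (m : nat) (S : {set 'I_d.+1}) (a : dform R (dimS S)) : Prop :=
  exists w, [/\ X m w, bdry_trace0 S w & a = trace S w].

Definition XringI (m : nat) (S : {set 'I_d.+1}) (a : dform R (dimS S)) : Prop :=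
  Xring m S a /\
  forall z, Xring m S z -> extd z = 0 -> ipS S m a z = 0.

Definition one_top m : dform R m := [ffun I : {set 'I_m} => if I == setT then 1 else 0].

(* all degrees of freedom of X^k associated with the subsimplex S vanish at v:
   l^{k,I}_{S,1}(v) = (1, tr v)_S                        (dim S = k)
   l^{k,I}_{S,j}(v) = (d_S psi, d_S tr v)_S, psi in \mathring X^{k,I}(S)   (dim S >= k+1)
   l^{k,II}_{S,j}(v) = (d_S psi, tr v)_S, psi in \mathring X^{k-1,I}(S)   (dim S >= k)
   (d_S tr = tr d is the exterior derivative of the pulled-back dform). *)
Definition dofs0 (k : nat) (S : {set 'I_d.+1}) (v : dform R d) : Prop :=
  [/\ dimS S = k -> ipS S k (one_top (dimS S)) (trace S v) = 0,
      (k < dimS S)%N -> forall psi, XringI k S psi ->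
         ipS S k.+1 (extd psi) (extd (trace S v)) = 0 &
      (0 < k <= dimS S)%N -> forall psi, XringI k.-1 S psi ->
         ipS S k (extd psi) (trace S v) = 0].

(* X^k_I : span of the interior basis functions = elements of X^k at which all
   the degrees of freedom attached to subsimplices S <> T vanish;
   X^k_Gamma : span of the other basis functions = elements of X^k at which
   all the degrees of freedom attached to T itself vanish. *)
Definition XI (k : nat) (v : dform R d) : Prop :=
  X k v /\ forall S : {set 'I_d.+1}, (0 < #|S|)%N -> S != setT -> dofs0 k S v.

Definition XG (k : nat) (v : dform R d) : Prop :=
  X k v /\ dofs0 k setT v.

Definition nrm2 (k : nat) (w : dform R d) : R := ipS setT k (trace setT w) (trace setT w).

End FEEC2.
Arguments intD {R m} q.
Arguments ipG {R m} G k a b.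
Arguments Gram {R d} vt S.
Arguments trace {R d} vt S w.
Arguments ipS {R d} vt S k a b.
Arguments bdry_trace0 {R d} vt S w.
Arguments Xring {R d} vt X m S a.
Arguments XringI {R d} vt X m S a.
Arguments one_top {R} m.
Arguments dofs0 {R d} vt X k S v.
Arguments XI {R d} vt X k v.
Arguments XG {R d} vt X k v.
Arguments nrm2 {R d} vt k w.

(* Main.v *)
(** All subsimplices are pulled back to unit simplices, where the inner products become equivalent to Euclidean ones and a form has zero trace on the face [l = 0] iff [dl /\ w] is divisible by the barycentric coordinate [l].

By induction over subsimplices the degrees of freedom on the boundary determine the traces, so [uI] has zero boundary trace. Split its trace as [f + z] with [z] closed and [f] orthogonal to closed forms. The type-I functionals make [d uG] orthogonal to [d f = d uI], which is the third claim. As [z = d q] with [q] in the complex with zero trace, the type-II functionals make [z] orthogonal to [uG], whence [|z| <= |u|]; and [|f| <= C |d f|] by minimality of [f] among the potentials of [d f].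

Uniformity in the degree rests on zero-trace polynomial potentials with degree-independent bounds, in dimension [n <= 3]. Potentials of 1-forms come from the Koszul homotopy and are bounded by Friedrichs' inequality. For top-degree forms the operator [div (B grad)], [B = diag x - x x^T], is triangular in the degree with eigenvalues [- r (r + n)], and [B grad] is tangent to the faces. For 2-forms in dimension three one solves [curl (Bh curl a) = W] variationally, [Bh] being the cofactor matrix of [B]; a gauge for [a] based at the centroid and a Hardy inequality on the four cones over the faces give the energy bound. *)
Require Import Defs.
From HB Require Import structures.
From mathcomp Require Import all_boot all_order all_algebra.
From mathcomp Require Import mpoly ssrcomplements.
From mathcomp Require Import reals boolp.
From mathcomp Require Import polyrcf.
From mathcomp Require Import ring lra zify.
Set Implicit Arguments. Unset Strict Implicit. Unset Printing Implicit Defensive.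
Import Order.TTheory GRing.Theory Num.Theory.
Local Open Scope ring_scope.

(** * Exterior algebra in coordinates *)

(** A potential must at once be a polynomial of the right degree, have exactly zero trace, and obey
    a bound free of the degree. Weights that vanish on the faces reconcile these demands: [jfield f]
    and [Bh v] have zero trace by divisibility for every polynomial argument, so the solves run over
    full polynomial spaces with no boundary condition. The price is that the energy degenerates at
    the faces; for 2-forms a Hardy inequality recovers the norm bound. In both cases the part of
    highest degree is a Koszul image, so a datum in [Pfull r k.+1] has its potential in
    [Pminus r k]. Closed forms of the next space lie in such a [Pfull] whichever kind the step is,
    so one solver serves all the complexes. No dual basis is built: [XI] and [XG] are cut out by
    vanishing functionals, and only orthogonality relations are used. The final constant combines
    norm equivalences, which depend on the simplex alone, with the solver constants. *)

Section Exterior.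
Variables (R : realType) (n : nat).
Implicit Types (I : {set 'I_n}) (i j : 'I_n).

Lemma sgnU I i j : j \notin I -> sgn R (j |: I) i = (-1) ^+ (j < i)%N * sgn R I i.
Proof.
move=> jI; rewrite /sgn -exprD; congr (_ ^+ _).
case: ltnP => ji.
  rewrite (_ : [set _ in _ | _] = j |: [set k in I | (k < i)%N]).
    by rewrite cardsU1 inE (negPf jI).
  by apply/setP => k; rewrite !inE; case: eqP => // ->; rewrite ji.
congr (#|pred_of_set _|); apply/setP => k; rewrite !inE; case: eqP => // ->.
by rewrite ltnNge ji !andbF.
Qed.

Lemma sgn_sq I i : sgn R I i * sgn R I i = 1.
Proof. by rewrite /sgn -signr_odd -expr2 sqrr_sign. Qed.

Variable V : lmodType R.
Local Notation gform := {ffun {set 'I_n} -> V}.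
Implicit Types w : gform.

(** Left multiplication by [dx_i]; [io i] is contraction with the [i]-th coordinate vector. The
    coefficient module stays arbitrary because a pullback first composes the coefficients, giving
    components indexed by the source but polynomial in the target variables, and only then mixes the
    components. *)
Definition ew i w : gform :=
  [ffun I : {set 'I_n} => if i \in I then sgn R (I :\ i) i *: w (I :\ i) else 0].
Definition io i w : gform :=
  [ffun I : {set 'I_n} => if i \in I then 0 else sgn R I i *: w (i |: I)].

Lemma ew_is_linear i : linear (ew i).
Proof.
move=> a u v; apply/ffunP => I; rewrite !ffunE; case: ifP => _.
  by rewrite scalerDr !scalerA mulrC.
by rewrite scaler0 addr0.
Qed.
Lemma io_is_linear i : linear (io i).
Proof.
move=> a u v; apply/ffunP => I; rewrite !ffunE; case: ifP => _.
  by rewrite scaler0 addr0.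
by rewrite scalerDr !scalerA mulrC.
Qed.
HB.instance Definition _ i := GRing.isLinear.Build R gform gform _ (ew i) (ew_is_linear i).
HB.instance Definition _ i := GRing.isLinear.Build R gform gform _ (io i) (io_is_linear i).

Lemma ewC i j w : ew i (ew j w) = - ew j (ew i w).
Proof.
apply/ffunP => I; rewrite !ffunE.
case iI: (i \in I); case jI: (j \in I); rewrite ?inE ?iI ?jI ?andbF ?andbT ?scaler0 ?oppr0 //.
case: (eqVneq j i) => [->|ji].
  by rewrite /= !scaler0 oppr0.
have ij : i != j by rewrite eq_sym.
set K := I :\ i :\ j.
have -> : I :\ i = j |: K by rewrite setD1K // !inE ji jI.
have -> : I :\ j = i |: K.
  by apply/setP => k; rewrite !inE; case: (eqVneq k i) => [->|_] //=; rewrite ij iI.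
have jK : j \notin K by rewrite !inE eqxx.
have iK : i \notin K by rewrite !inE eqxx andbF.
rewrite !setU1K // !sgnU // /= !scalerA -scaleNr; congr (_ *: _).
case: ltngtP => [||/val_inj e]; last by rewrite e eqxx in ji.
all: by move=> _; ring.
Qed.

Lemma ew2 i w : ew i (ew i w) = 0.
Proof.
by apply/ffunP => I; rewrite !ffunE !inE eqxx /= scaler0 if_same.
Qed.

Lemma ioC i j w : io i (io j w) = - io j (io i w).
Proof.
apply/ffunP => I; rewrite !ffunE !inE.
case iI: (i \in I); case jI: (j \in I); rewrite ?orbT ?scaler0 ?oppr0 //.
rewrite !orbF; case: (eqVneq j i) => [->|ji]; first by rewrite scaler0 oppr0.
rewrite !sgnU ?iI ?jI // !scalerA -scaleNr setUCA; congr (_ *: _).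
case: ltngtP => [||/val_inj e]; last by rewrite e eqxx in ji.
all: by move=> _; ring.
Qed.

(** The anticommutation relation of contraction and multiplication. With [ewC] and [ioC] it lets
    most later identities avoid explicit signs. *)
Lemma io_ew i j w : io i (ew j w) = (if i == j then w else 0) - ew j (io i w).
Proof.
apply/ffunP => I; rewrite !ffunE !inE.
case: (eqVneq i j) => [->|ij]; rewrite ?ffunE /=.
  case jI: (j \in I); rewrite ?eqxx /=.
    by rewrite scalerA setD1K // sgn_sq scale1r subrr.
  by rewrite setU1K ?jI // scalerA sgn_sq scale1r subr0.
have ji : (j == i) = false by rewrite eq_sym (negPf ij).
rewrite add0r.
case iI: (i \in I); case jI: (j \in I); rewrite ?scaler0 ?oppr0 //.
set K := I :\ j.
have -> : I = j |: K by rewrite setD1K.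
have jK : j \notin K by rewrite !inE eqxx.
have iK : i \notin K by rewrite !inE iI andbF.
have -> : (i |: (j |: K)) :\ j = i |: K.
  by rewrite setUCA setU1K // in_setU1 ji.
rewrite !sgnU // !scalerA -scaleNr; congr (_ *: _).
case: ltngtP => [||/val_inj e]; last by rewrite e eqxx in ij.
all: by move=> _; ring.
Qed.

Definition fdelta I (v : V) : gform := [ffun J => if J == I then v else 0].

(** Basis forms are products of [dx_i], so a property stable under linear combinations need only be
    checked on 0-forms and under [ew]. Identities between linear operators on forms are proved in
    this way. *)
Lemma gform_ind (P : gform -> Prop) :
  (forall v, P (fdelta set0 v)) -> (forall i w, P w -> P (ew i w)) ->
  (forall u w, P u -> P w -> P (u + w)) -> (forall a w, P w -> P (a *: w)) ->
  forall w, P w.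
Proof.
move=> P0 Pe PD PZ.
have Pd I : forall v, P (fdelta I v).
  elim: {I}_.+1 {-2}I (ltnSn #|I|) => // k IH I; rewrite ltnS => cI v.
  case: (set_0Vmem I) => [->//|[i iI]].
  have -> : fdelta I v = sgn R (I :\ i) i *: ew i (fdelta (I :\ i) v).
    apply/ffunP => J; rewrite !ffunE; case iJ: (i \in J); last first.
      rewrite scaler0; case: eqP => // e; by rewrite e iI in iJ.
    case: (eqVneq J I) => [->|JI].
      by rewrite eqxx scalerA sgn_sq scale1r.
    case: eqP => [e|_]; last by rewrite !scaler0.
    by rewrite -(setD1K iJ) e setD1K // eqxx in JI.
  apply: PZ; apply: Pe; apply: IH.
  by rewrite (cardsD1 i) iI in cI.
move=> w; have -> : w = \sum_I fdelta I (w I).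
  apply/ffunP => J; rewrite sum_ffunE (bigD1 J) //= ffunE eqxx big1 ?addr0 //.
  by move=> I IJ; rewrite ffunE eq_sym (negPf IJ).
apply: (big_ind P) => //.
by have := PZ 0 _ (P0 0); rewrite scale0r.
Qed.

Lemma io_fdelta0 i v : io i (fdelta set0 v) = 0.
Proof.
apply/ffunP => I; rewrite !ffunE; case: ifP => // _.
rewrite (_ : _ == _ = false) ?scaler0 //.
by apply/negbTE/set0Pn; exists i; rewrite setU11.
Qed.

End Exterior.

(** * Pullback by linear maps *)

Section DelNth.
Variable T : eqType.
Definition delnth p (s : seq T) := take p s ++ drop p.+1 s.

Lemma nth_delnth x0 s p z : (p < size s)%N -> nth x0 (delnth p s) z = nth x0 s (bump p z).
Proof.
move=> ps; rewrite nth_cat size_takel ?(ltnW ps) // /bump.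
case: ltnP => zp; first by rewrite nth_take // add0n.
by rewrite nth_drop; congr nth; lia.
Qed.
End DelNth.

Section Enum.
Variable n : nat.
Implicit Types (I : {set 'I_n}) (i : 'I_n).

Lemma index_sorted (s : seq 'I_n) i : sorted ltn [seq val j | j <- s] -> i \in s ->
  index i s = count (fun j : 'I_n => (j < i)%N) s.
Proof.
elim: s => //= x s IH xs; rewrite inE.
have le_x : all (fun j : 'I_n => (x < j)%N) s.
  by move: xs => /(order_path_min ltn_trans); rewrite all_map.
case: (eqVneq x i) => [<- _|xi /= ix].
  rewrite ltnn add0n; apply/esym/eqP; rewrite eqn0Ngt -has_count -all_predC.
  by apply: sub_all le_x => j /= h; rewrite -leqNgt ltnW.
by rewrite (IH (path_sorted xs)) // (allP le_x).
Qed.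

(** Links two sign conventions: [sgn] counts smaller elements, cofactor expansion uses the position
    in the increasing enumeration. *)
Lemma index_enum I i : i \in I -> index i (enum I) = #|[set j in I :\ i | (j < i)%N]|.
Proof.
move=> iI; rewrite index_sorted ?mem_enum //; last first.
  rewrite {1}/enum_mem -enumT; apply: (subseq_sorted ltn_trans (s2 := [seq val j | j <- enum 'I_n])).
    by apply: map_subseq; apply: filter_subseq.
  by rewrite val_enum_ord iota_ltn_sorted.
rewrite cardE -size_filter; congr size.
rewrite /enum_mem -filter_predI; apply: eq_filter => j /=; rewrite !inE.
by case: (eqVneq j i) => [->|]; rewrite ?ltnn ?andbF // andbC.
Qed.

Lemma enum_setD1 I i : i \in I -> enum (I :\ i) = delnth (index i (enum I)) (enum I).
Proof.
move=> iI; rewrite /delnth -remE rem_filter ?enum_uniq //.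
by rewrite /enum_mem -filter_predI; apply: eq_filter => j /=; rewrite !inE.
Qed.
End Enum.

Section Laplace.
Variables (R : realType) (a b : nat) (A : 'M[R]_(a, b)).

Let mx j0 i0 (s : seq 'I_a) (t : seq 'I_b) k : 'M[R]_k :=
  \matrix_(x < k, y < k) A (nth j0 s x) (nth i0 t y).

Lemma minor_nth j0 i0 (J : {set 'I_a}) (I : {set 'I_b}) k : #|J| = k -> #|I| = k ->
  minor A J I = \det (mx j0 i0 (enum J) (enum I) k).
Proof.
move=> Jk Ik; subst k; congr (\det _); apply/matrixP => x y; rewrite !mxE.
rewrite (nth_map j0) -?cardE // (nth_map i0) // -cardE Ik //.
Qed.

Lemma det_delnth j0 i0 s t k (p : 'I_k.+1) : size s = k.+1 -> size t = k.+1 ->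
  \det (mx j0 i0 s t k.+1) = \sum_(y < k.+1) A (nth j0 s p) (nth i0 t y) *
     ((-1) ^+ (p + y) * \det (mx j0 i0 (delnth p s) (delnth y t) k)).
Proof.
move=> sk tk; rewrite (expand_det_row _ p); apply: eq_bigr => y _.
rewrite /cofactor !mxE; congr (_ * (_ * \det _)).
by apply/matrixP => x z; rewrite !mxE !nth_delnth ?sk ?tk.
Qed.

(** Cofactor expansion of the minor with rows [l] and [J]: two rows coincide if [l] is in [J], and
    otherwise sorting [l] into place costs [sgn R J l]. *)
Lemma minor_laplace l (J : {set 'I_a}) (I : {set 'I_b}) : #|I| = #|J|.+1 ->
  \sum_(i in I) A l i * (sgn R (I :\ i) i * minor A J (I :\ i)) =
  if l \in J then 0 else sgn R J l * minor A (l |: J) I.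
Proof.
move=> cI; have [i0 i0I] : exists i, i \in I by apply/card_gt0P; rewrite cI.
set k := #|J| in cI.
have kJ : #|J| = k by [].
have sI : size (enum I) = k.+1 by rewrite -cardE.
(* The expansion along the row [l] at position [p]; it serves both for [l] put first, as a repeated
   row, and for [l] in its sorted place. *)
have red s (p : 'I_k.+1) : size s = k.+1 -> nth l s p = l -> delnth p s = enum J ->
   \det (mx l i0 s (enum I) k.+1) =
   (-1) ^+ p * \sum_(i in I) A l i * (sgn R (I :\ i) i * minor A J (I :\ i)).
  move=> sk sp dp; rewrite (det_delnth _ _ p) // sp dp.
  rewrite -[X in _ = _ * X]big_enum /= (big_nth i0) sI big_mkord mulr_sumr.
  apply: eq_bigr => y _; set i := nth i0 (enum I) y.
  have iI : i \in I by rewrite -mem_enum mem_nth // sI.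
  have iy : index i (enum I) = y by rewrite index_uniq ?enum_uniq // sI.
  rewrite exprD -[X in _ * X = _]mulrA [LHS]mulrCA; congr (_ * (_ * _)).
  rewrite /sgn -index_enum // iy; congr (_ * _).
  rewrite (@minor_nth l i0 _ _ k) ?enum_setD1 ?iy //.
  by move: cI; rewrite (cardsD1 i) iI => -[].
case: ifP => lJ.
  have := red (l :: enum J) ord0; rewrite /= -cardE => /(_ erefl erefl).
  rewrite /delnth /= drop0 mul1r => <- //.
  have pl : (index l (enum J) < #|J|)%N by rewrite cardE index_mem mem_enum.
  apply: (@determinant_alternate _ _ _ ord0 (lift ord0 (Ordinal pl))) => // y.
  by rewrite !mxE /= nth_index ?mem_enum.
have lU : l \in l |: J by rewrite setU11.
have cU : #|l |: J| = k.+1 by rewrite cardsU1 lJ.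
have pl : (index l (enum (l |: J)) < k.+1)%N by rewrite -cU cardE index_mem mem_enum.
have := red (enum (l |: J)) (Ordinal pl).
rewrite -cardE cU nth_index ?mem_enum // -enum_setD1 // setU1K ?lJ // => /(_ erefl erefl erefl).
rewrite -minor_nth // => ->; rewrite mulrA /sgn /= index_enum // setU1K ?lJ //.
by rewrite -signr_odd -expr2 sqrr_sign mul1r.
Qed.

Variable V : lmodType R.

(** Pullback by the linear map with matrix [A], written with minors to agree with [trace]. *)
Definition Lam (w : {ffun {set 'I_a} -> V}) : {ffun {set 'I_b} -> V} :=
  [ffun I : {set 'I_b} => \sum_(J : {set 'I_a} | #|J| == #|I|) minor A J I *: w J].

Lemma Lam_is_linear : linear Lam.
Proof.
move=> c u v; apply/ffunP => I; rewrite !ffunE scaler_sumr -big_split /=.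
by apply: eq_bigr => J _; rewrite !ffunE scalerDr !scalerA mulrC.
Qed.
HB.instance Definition _ := GRing.isLinear.Build R _ _ _ Lam Lam_is_linear.

Lemma Lam_fdelta0 v : Lam (fdelta set0 v) = fdelta set0 v.
Proof.
apply/ffunP => I; rewrite !ffunE; case: eqP => [->|/eqP I0].
  rewrite (big_pred1 set0) => [|J]; last by rewrite cards0 cards_eq0.
  rewrite ffunE eqxx /minor; set M := (\matrix_(_,_) _).
  by move: M; rewrite cards0 => M; rewrite det_mx00 scale1r.
rewrite big1 // => J /eqP cJ; rewrite ffunE; case: eqP => [J0|]; rewrite ?scaler0 //.
by move: I0; rewrite -cards_eq0 -cJ J0 cards0.
Qed.

Lemma Lam_ew l w : Lam (ew l w) = \sum_(i < b) A l i *: ew i (Lam w).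
Proof.
apply/ffunP => I; rewrite sum_ffunE ffunE.
under [RHS]eq_bigr do rewrite !ffunE.
rewrite (bigID (mem I)) /= [X in _ = _ + X]big1 ?addr0; last first.
  by move=> i /negPf ->; rewrite scaler0.
transitivity (\sum_(J : {set 'I_a} | #|J|.+1 == #|I|)
   (\sum_(i in I) A l i * (sgn R (I :\ i) i * minor A J (I :\ i))) *: w J); last first.
  under [LHS]eq_bigr do rewrite scaler_suml.
  rewrite exchange_big /=; apply: eq_bigr => i iI.
  rewrite iI !scaler_sumr; apply: eq_big => J.
    by rewrite (cardsD1 i I) iI.
  by move=> _; rewrite !scalerA !mulrA.
transitivity (\sum_(J : {set 'I_a} | (#|J|.+1 == #|I|) && (l \notin J))
   (sgn R J l * minor A (l |: J) I) *: w J); last first.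
  rewrite [RHS](bigID (fun J : {set 'I_a} => l \notin J)) /= [X in _ = _ + X]big1 ?addr0.
    by apply: eq_bigr => J /andP [/eqP cI lJ]; rewrite minor_laplace // (negPf lJ).
  by move=> J /andP [/eqP cI /negPn lJ]; rewrite minor_laplace // lJ scale0r.
rewrite (bigID (fun J : {set 'I_a} => l \in J)) /= [X in _ + X = _]big1 ?addr0; last first.
  by move=> J /andP [_ /negPf lJ]; rewrite ffunE lJ scaler0.
rewrite (reindex_onto (fun J : {set 'I_a} => l |: J) (fun J => J :\ l)) /=; last first.
  by move=> J /andP [_ lJ]; rewrite setD1K.
apply: eq_big => J.
  rewrite setU11 andbT; case lJ: (l \in J).
    rewrite andbF; apply/negbTE/negP => /andP [_ /eqP e].
    by move: lJ; rewrite -e !inE eqxx.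
  by rewrite setU1K ?lJ // eqxx andbT cardsU1 lJ andbT.
move=> /andP [_ /eqP e].
have lJ : l \notin J by rewrite -e !inE eqxx.
by rewrite ffunE setU11 setU1K // scalerA mulrC.
Qed.

Lemma Lam_io i w : io i (Lam w) = Lam (\sum_(l < a) A l i *: io l w).
Proof.
elim/gform_ind: w => [v|l w IH|u w IHu IHw|c w IHw].
- rewrite Lam_fdelta0 io_fdelta0 big1 ?linear0 // => l _.
  by rewrite io_fdelta0 scaler0.
- rewrite Lam_ew linear_sum /=.
  under eq_bigr do rewrite linearZ /= io_ew scalerBr.
  rewrite sumrB (bigD1 i) //= eqxx [X in _ + X - _]big1 ?addr0; last first.
    by move=> j ji; rewrite eq_sym (negPf ji) scaler0.
  under [in RHS]eq_bigr do rewrite io_ew scalerBr.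
  rewrite [in RHS]sumrB (bigD1 l) //= eqxx [X in Lam (_ + X - _)]big1 ?addr0; last first.
    by move=> j jl; rewrite (negPf jl) scaler0.
  rewrite linearB linearZ /=; congr (_ - _).
  transitivity (Lam (ew l (\sum_(j < a) A j i *: io j w))).
    by rewrite Lam_ew; apply: eq_bigr => j _; rewrite IH.
  by rewrite linear_sum /=; congr Lam; apply: eq_bigr => j _; rewrite linearZ.
- rewrite !linearD /= IHu IHw -linearD /= -big_split /=; congr Lam.
  by apply: eq_bigr => l _; rewrite linearD scalerDr.
- rewrite !linearZ /= IHw -linearZ /= scaler_sumr; congr Lam.
  by apply: eq_bigr => l _; rewrite !linearZ /= !scalerA mulrC.
Qed.

End Laplace.

Section LamMul.
Variables (R : realType) (V : lmodType R).

(** Functoriality, by induction on generators. Read on components it is the Cauchy-Binet formula,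
    which [cauchy_binet] extracts from it. *)
Lemma LamM a b c (A : 'M[R]_(a, b)) (B : 'M[R]_(b, c)) (w : {ffun {set 'I_a} -> V}) :
  Lam B (Lam A w) = Lam (A *m B) w.
Proof.
elim/gform_ind: w => [v|l w IH|u w IHu IHw|e w IHw].
- by rewrite !Lam_fdelta0.
- rewrite !Lam_ew linear_sum /=.
  under eq_bigr do rewrite linearZ /= Lam_ew IH scaler_sumr.
  rewrite exchange_big /=; apply: eq_bigr => i _.
  rewrite mxE scaler_suml; apply: eq_bigr => j _; by rewrite scalerA.
- by rewrite !linearD /= IHu IHw.
- by rewrite !linearZ /= IHw.
Qed.

Lemma Lam1 a (w : {ffun {set 'I_a} -> V}) : Lam 1%:M w = w.
Proof.
elim/gform_ind: w => [v|l w IH|u w IHu IHw|e w IHw].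
- by rewrite !Lam_fdelta0.
- rewrite Lam_ew IH (bigD1 l) //= mxE eqxx scale1r big1 ?addr0 // => i il.
  by rewrite mxE eq_sym (negPf il) scale0r.
- by rewrite !linearD /= IHu IHw.
- by rewrite !linearZ /= IHw.
Qed.

Lemma Lam_comp a b (A : 'M[R]_(a, b)) (W : lmodType R) (f : {linear V -> W})
  (w : {ffun {set 'I_a} -> V}) :
  Lam A [ffun J : {set 'I_a} => f (w J)] = [ffun I : {set 'I_b} => f (Lam A w I)].
Proof.
apply/ffunP => I; rewrite !ffunE linear_sum; apply: eq_bigr => J _.
by rewrite ffunE linearZ.
Qed.

End LamMul.

(** * Polynomial differential forms *)

Section Size.
Variables (R : realType) (n : nat).
Implicit Types (f g : {mpoly R[n]}) (i j : 'I_n) (c : R).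

Lemma msize_leP k f : (msize f <= k)%N <-> forall m, (k <= mdeg m)%N -> f@_m = 0.
Proof.
split=> [fk m km|h].
  by apply/eqP; rewrite mcoeff_eq0; apply: msize_mdeg_ge; apply: leq_trans km.
rewrite msizeE; apply/bigmax_leqP_seq => m mf _; rewrite leqNgt; apply/negP => km.
by move: mf; rewrite mcoeff_msupp h ?eqxx.
Qed.

Lemma msize_le0 f : (msize f <= 0)%N -> f = 0.
Proof. by rewrite leqn0 mmeasure_poly_eq0 => /eqP. Qed.

Lemma msizeD k f g : (msize f <= k)%N -> (msize g <= k)%N -> (msize (f + g) <= k)%N.
Proof. by move=> fk gk; apply: leq_trans (mmeasureD_le _ _ _) _; rewrite geq_max fk. Qed.

Lemma msizeZk k c f : (msize f <= k)%N -> (msize (c *: f) <= k)%N.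
Proof. exact: leq_trans (msizeZ_le _ _). Qed.

Lemma msizeB k f g : (msize f <= k)%N -> (msize g <= k)%N -> (msize (f - g) <= k)%N.
Proof. by move=> fk gk; apply: msizeD; rewrite ?mmeasureN. Qed.

Lemma msize_sumk (T : Type) k (s : seq T) (P : pred T) (F : T -> {mpoly R[n]}) :
  (forall t, P t -> (msize (F t) <= k)%N) -> (msize (\sum_(t <- s | P t) F t) <= k)%N.
Proof. by move=> h; apply: (big_ind (fun f => (msize f <= k)%N)) => //; [rewrite mmeasure0|exact: msizeD]. Qed.

Lemma msizeMk k l f g : (msize f <= k)%N -> (msize g <= l)%N ->
  (msize (f * g) <= (k + l).-1)%N.
Proof.
move=> fk gl; have [->|f0] := eqVneq f 0; first by rewrite mul0r mmeasure0.
have [->|g0] := eqVneq g 0; first by rewrite mulr0 mmeasure0.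
by rewrite msizeM // -!subn1 leq_sub2r // leq_add.
Qed.

Lemma msizeXi i : msize ('X_i : {mpoly R[n]}) = 2%N.
Proof. by rewrite msizeX mdeg1. Qed.

Lemma msize_XM k i f : (msize f <= k)%N -> (msize ('X_i * f)%R <= k.+1)%N.
Proof. by move=> fk; rewrite -[k.+1]/(2 + k).-1; apply: msizeMk; rewrite ?msizeXi. Qed.

Lemma msize_deriv k i f : (msize f <= k)%N -> (msize (mderiv i f) <= k.-1)%N.
Proof.
move=> /msize_leP fk; apply/msize_leP => m km.
rewrite mcoeff_deriv fk ?mul0rn // mdegD mdeg1; lia.
Qed.

Definition euler f : {mpoly R[n]} := \sum_(i < n) 'X_i * mderiv i f.

Lemma eulerX m : euler 'X_[m] = (mdeg m)%:R *: 'X_[m].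
Proof.
rewrite mdegE natr_sum scaler_suml; apply: eq_bigr => i _.
rewrite mderivX -scalerAr -mpolyXD; have [->|mi] := eqVneq (m i) 0%N; first by rewrite !scale0r.
congr (_ *: 'X_[_]); apply/mnmP => j; rewrite mnmDE mnmBE mnm1E.
by case: eqP => [<-|] /=; move: mi; lia.
Qed.

Lemma euler_is_linear : linear euler.
Proof.
move=> c f g; rewrite /euler scaler_sumr -big_split; apply: eq_bigr => i _ /=.
by rewrite linearP mulrDr -scalerAr.
Qed.
HB.instance Definition _ := GRing.isLinear.Build R _ _ _ euler euler_is_linear.

Lemma mcoeff_euler f m : (euler f)@_m = (mdeg m)%:R * f@_m.
Proof.
rewrite {1}(mpolyE f) [euler _]linear_sum [LHS]raddf_sum /=.
under eq_bigr do rewrite [euler _]linearZ /= eulerX mcoeffZ mcoeffZ mcoeffX.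
rewrite [in RHS](mpolyE f) [_@_m]raddf_sum mulr_sumr; apply: eq_bigr => k _ /=.
rewrite mcoeffZ mcoeffX; by case: eqP => [->|_]; rewrite ?mulr0 ?mulr1 // mulrC.
Qed.

(** The integral of [t^(k-1) f(t x)] over [0 <= t <= 1], which inverts [euler + k] for positive
    [k]. *)
Definition einv k f : {mpoly R[n]} := \sum_(m <- msupp f) (f@_m / (mdeg m + k)%:R) *: 'X_[m].

Lemma mcoeff_einv k f m : (einv k f)@_m = f@_m / (mdeg m + k)%:R.
Proof.
rewrite raddf_sum /=; under eq_bigr do rewrite mcoeffZ mcoeffX.
case mf: (m \in msupp f).
  rewrite (bigD1_seq m) ?msupp_uniq //= eqxx mulr1 big1 ?addr0 // => j /negPf ->.
  by rewrite mulr0.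
rewrite big_seq big1 => [|j jf]; first by rewrite memN_msupp_eq0 ?mf // mul0r.
by case: eqP => [e|]; rewrite ?mulr0 //; rewrite e mf in jf.
Qed.

Lemma einvK k f : (0 < k)%N -> euler (einv k f) + k%:R *: einv k f = f.
Proof.
move=> k0; apply/mpolyP => m.
rewrite mcoeffD mcoeffZ mcoeff_euler mcoeff_einv -mulrDl -natrD mulrC divfK //.
by rewrite pnatr_eq0; lia.
Qed.

Lemma euler_inj k f : (0 < k)%N -> euler f + k%:R *: f = 0 -> f = 0.
Proof.
move=> k0 h; apply/mpolyP => m; have := congr1 (mcoeff m) h.
rewrite mcoeffD mcoeffZ mcoeff_euler -mulrDl -natrD mcoeff0 => /eqP.
by rewrite mulf_eq0 pnatr_eq0 => /orP [|/eqP //]; lia.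
Qed.

Lemma msize_euler_inv k s f : (0 < k)%N ->
  (msize (euler f + k%:R *: f) <= s)%N -> (msize f <= s)%N.
Proof.
move=> k0 /msize_leP h; apply/msize_leP => m /h.
rewrite mcoeffD mcoeffZ mcoeff_euler -mulrDl -natrD => /eqP.
by rewrite mulf_eq0 pnatr_eq0 => /orP [|/eqP //]; lia.
Qed.

Lemma msize_einv k s f : (msize f <= s)%N -> (msize (einv k f) <= s)%N.
Proof.
move=> /msize_leP h; apply/msize_leP => m /h; rewrite mcoeff_einv => ->; exact: mul0r.
Qed.

End Size.

Section PolyForms.
Variables (R : realType) (n : nat).
Local Notation form := {ffun {set 'I_n} -> {mpoly R[n]}}.
Implicit Types (w u : form) (f g : {mpoly R[n]}) (i j : 'I_n) (I : {set 'I_n}).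

Definition pd i w : form := [ffun I : {set 'I_n} => mderiv i (w I)].
Definition mf f w : form := [ffun I : {set 'I_n} => f * w I].

Lemma pd_is_linear i : linear (pd i).
Proof. by move=> c u v; apply/ffunP => I; rewrite !ffunE linearP. Qed.
Lemma mf_is_linear f : linear (mf f).
Proof. by move=> c u v; apply/ffunP => I; rewrite !ffunE mulrDr scalerAr. Qed.
HB.instance Definition _ i := GRing.isLinear.Build R form form _ (pd i) (pd_is_linear i).
HB.instance Definition _ f := GRing.isLinear.Build R form form _ (mf f) (mf_is_linear f).

Lemma extdE w : extd w = \sum_i ew i (pd i w).
Proof.
apply/ffunP => I; rewrite sum_ffunE ffunE [LHS]big_mkcond /=; apply: eq_bigr => i _.
by rewrite !ffunE.
Qed.

Lemma koszulE w : koszul w = \sum_i mf 'X_i (io i w).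
Proof.
apply/ffunP => I; rewrite sum_ffunE ffunE [LHS]big_mkcond /=; apply: eq_bigr => i _.
by rewrite !ffunE; case: (i \in I); rewrite /= ?mulr0 // scalerAr.
Qed.

Lemma pd_ew i j w : pd i (ew j w) = ew j (pd i w).
Proof. by apply/ffunP => I; rewrite !ffunE; case: ifP => _; rewrite ?linear0 ?linearZ. Qed.
Lemma pd_io i j w : pd i (io j w) = io j (pd i w).
Proof. by apply/ffunP => I; rewrite !ffunE; case: ifP => _; rewrite ?linear0 ?linearZ. Qed.
Lemma mf_ew f j w : mf f (ew j w) = ew j (mf f w).
Proof. by apply/ffunP => I; rewrite !ffunE; case: ifP => _; rewrite ?mulr0 // scalerAr. Qed.
Lemma mf_io f j w : mf f (io j w) = io j (mf f w).
Proof. by apply/ffunP => I; rewrite !ffunE; case: ifP => _; rewrite ?mulr0 // scalerAr. Qed.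
Lemma pdC i j w : pd i (pd j w) = pd j (pd i w).
Proof. by apply/ffunP => I; rewrite !ffunE mderiv_comm. Qed.
Lemma pd_mf i f w : pd i (mf f w) = mf (mderiv i f) w + mf f (pd i w).
Proof. by apply/ffunP => I; rewrite !ffunE mderivM. Qed.
Lemma mfM f g w : mf f (mf g w) = mf (f * g) w.
Proof. by apply/ffunP => I; rewrite !ffunE mulrA. Qed.
Lemma mfDl f g w : mf (f + g) w = mf f w + mf g w.
Proof. by apply/ffunP => I; rewrite !ffunE mulrDl. Qed.
Lemma mfNl f w : mf (- f) w = - mf f w.
Proof. by apply/ffunP => I; rewrite !ffunE mulNr. Qed.
Lemma mfZl c f w : mf (c *: f) w = c *: mf f w.
Proof. by apply/ffunP => I; rewrite !ffunE scalerAl. Qed.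
Lemma mfC c w : mf c%:MP w = c *: w.
Proof. by apply/ffunP => I; rewrite !ffunE mul_mpolyC. Qed.
Lemma mf0l w : mf 0 w = 0.
Proof. by apply/ffunP => I; rewrite !ffunE mul0r. Qed.
Lemma mf_suml (T : Type) (s : seq T) (P : pred T) (F : T -> {mpoly R[n]}) w :
  mf (\sum_(t <- s | P t) F t) w = \sum_(t <- s | P t) mf (F t) w.
Proof.
by apply: (big_morph (fun f => mf f w)) => [f g|]; rewrite ?mfDl ?mf0l.
Qed.

Lemma extd_is_linear : linear (@extd R n).
Proof.
move=> c u v; rewrite !extdE scaler_sumr -big_split; apply: eq_bigr => i _ /=.
by rewrite !linearP.
Qed.
Lemma koszul_is_linear : linear (@koszul R n).
Proof.
move=> c u v; rewrite !koszulE scaler_sumr -big_split; apply: eq_bigr => i _ /=.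
by rewrite !linearP.
Qed.
HB.instance Definition _ := GRing.isLinear.Build R form form _ (@extd R n) extd_is_linear.
HB.instance Definition _ := GRing.isLinear.Build R form form _ (@koszul R n) koszul_is_linear.

Lemma anti_sum0 (F : 'I_n -> 'I_n -> form) : (forall i j, F i j = - F j i) ->
  \sum_i \sum_j F i j = 0.
Proof.
move=> h; apply: (@scalerI _ _ (2%:R : R)); first by rewrite pnatr_eq0.
rewrite scaler0 scaler_nat mulr2n {1}exchange_big -big_split big1 // => i _ /=.
by rewrite -big_split big1 // => j _ /=; rewrite h addNr.
Qed.

Lemma extd2 w : extd (extd w) = 0.
Proof.
rewrite extdE -[RHS](@anti_sum0 (fun i j => ew i (ew j (pd i (pd j w))))) => [|i j].
  apply: eq_bigr => i _; rewrite extdE linear_sum [ew i _]linear_sum /=.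
  by apply: eq_bigr => j _; rewrite pd_ew.
by rewrite ewC pdC.
Qed.

Lemma koszul2 w : koszul (koszul w) = 0.
Proof.
rewrite koszulE -[RHS](@anti_sum0 (fun i j => mf ('X_i * 'X_j) (io i (io j w)))) => [|i j].
  apply: eq_bigr => i _; rewrite koszulE linear_sum [mf _ _]linear_sum /=.
  by apply: eq_bigr => j _; rewrite -mf_io mfM.
by rewrite ioC linearN mulrC.
Qed.

Lemma ew_io_sum k w : pure k w -> \sum_i ew i (io i w) = k%:R *: w.
Proof.
move=> wk; apply/ffunP => I; rewrite sum_ffunE !ffunE.
rewrite (eq_bigr (fun i => if i \in I then w I else 0)) => [|i _]; last first.
  rewrite !ffunE; case: ifP => iI //.
  by rewrite !inE eqxx /= scalerA sgn_sq scale1r setD1K.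
rewrite -big_mkcond /= sumr_const; have [<-|kI] := eqVneq #|I| k.
  by rewrite scaler_nat.
by rewrite wk // mul0rn scaler0.
Qed.

(** Cartan's formula for the Lie derivative along the position field. The mixed terms ['X_j] times
    [ew i (io j (pd i w))] occur in both halves with opposite signs; the derivatives of ['X_i]
    produce the form degree [k]. *)
Lemma cartan k w : pure k w ->
  extd (koszul w) + koszul (extd w) = [ffun I : {set 'I_n} => euler (w I) + k%:R *: w I].
Proof.
move=> wk.
have -> : extd (koszul w) = \sum_i ew i (io i w) + \sum_i \sum_j mf 'X_j (ew i (io j (pd i w))).
  rewrite extdE koszulE -big_split; apply: eq_bigr => i _ /=.
  rewrite linear_sum [ew i _]linear_sum /=.
  under eq_bigr do rewrite pd_mf linearD /= pd_io -!mf_ew.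
  rewrite big_split /= (bigD1 i) //= mderivX mnm1E eqxx scale1r.
  have -> : (U_(i) - U_(i))%MM = 0%MM :> 'X_{1..n} by apply/mnmP => j; rewrite mnmBE subnn mnm0E.
  rewrite mpolyX0 -mpolyC1 mfC scale1r [X in _ + X + _]big1 ?addr0 // => j ji.
  by rewrite mderivX mnm1E (negPf ji) scale0r mf0l.
have -> : koszul (extd w) = \sum_i mf 'X_i (pd i w) - \sum_i \sum_j mf 'X_j (ew i (io j (pd i w))).
  rewrite koszulE [X in _ - X]exchange_big -sumrB; apply: eq_bigr => i _ /=.
  rewrite extdE linear_sum [mf _ _]linear_sum /=.
  under eq_bigr do rewrite io_ew linearB /=.
  rewrite sumrB (bigD1 i) //= eqxx [X in _ + X - _]big1 ?addr0 // => j ji.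
  by rewrite eq_sym (negPf ji) linear0.
rewrite -addrA [X in _ + X]addrC subrK (ew_io_sum wk); apply/ffunP => I; rewrite !ffunE sum_ffunE addrC; congr (_ + _).
by apply: eq_bigr => i _; rewrite !ffunE.
Qed.

Lemma pureD k u w : pure k u -> pure k w -> pure k (u + w).
Proof. by move=> hu hw I kI; rewrite ffunE hu // hw // addr0. Qed.
Lemma pureZ k c w : pure k w -> pure k (c *: w).
Proof. by move=> hw I kI; rewrite ffunE hw // scaler0. Qed.
Lemma pure_sum k (F : 'I_n -> form) : (forall i, pure k (F i)) -> pure k (\sum_i F i).
Proof. by move=> h I kI; rewrite sum_ffunE big1 // => i _; rewrite h. Qed.
Lemma pure_pd k i w : pure k w -> pure k (pd i w).
Proof. by move=> hw I kI; rewrite ffunE hw // linear0. Qed.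
Lemma pure_mf k f w : pure k w -> pure k (mf f w).
Proof. by move=> hw I kI; rewrite ffunE hw // mulr0. Qed.
Lemma pure_ew k i w : pure k w -> pure k.+1 (ew i w).
Proof.
move=> hw I kI; rewrite ffunE; case: ifP => // iI; rewrite hw ?scaler0 //.
by move: kI; rewrite (cardsD1 i) iI.
Qed.
Lemma pure_io k i w : pure k.+1 w -> pure k (io i w).
Proof.
move=> hw I kI; rewrite ffunE; case: ifP => // iI; rewrite hw ?scaler0 //.
by rewrite cardsU1 iI.
Qed.
Lemma pure_extd k w : pure k w -> pure k.+1 (extd w).
Proof. by move=> hw; rewrite extdE; apply: pure_sum => i; apply/pure_ew/pure_pd. Qed.
Lemma pure_koszul k w : pure k.+1 w -> pure k (koszul w).
Proof. by move=> hw; rewrite koszulE; apply: pure_sum => i; apply/pure_mf/pure_io. Qed.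

Lemma PdegD s u w : Pdeg s u -> Pdeg s w -> Pdeg s (u + w).
Proof. by move=> hu hw I; rewrite ffunE msizeD. Qed.
Lemma PdegZ s c w : Pdeg s w -> Pdeg s (c *: w).
Proof. by move=> hw I; rewrite ffunE msizeZk. Qed.
Lemma Pdeg_sum s (T : finType) (P : pred T) (F : T -> form) :
  (forall t, P t -> Pdeg s (F t)) -> Pdeg s (\sum_(t | P t) F t).
Proof. by move=> h I; rewrite sum_ffunE; apply: msize_sumk => i /h; apply. Qed.
Lemma Pdeg_le s t w : (s <= t)%N -> Pdeg s w -> Pdeg t w.
Proof. by move=> st hw I; apply: leq_trans st. Qed.
Lemma Pdeg_ew s i w : Pdeg s w -> Pdeg s (ew i w).
Proof. by move=> hw I; rewrite ffunE; case: ifP => _; rewrite ?mmeasure0 ?msizeZk. Qed.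
Lemma Pdeg_io s i w : Pdeg s w -> Pdeg s (io i w).
Proof. by move=> hw I; rewrite ffunE; case: ifP => _; rewrite ?mmeasure0 ?msizeZk. Qed.
Lemma Pdeg_extd s w : Pdeg s w -> Pdeg s.-1 (extd w).
Proof.
move=> hw; rewrite extdE; apply: Pdeg_sum => i _; apply: Pdeg_ew => I.
by rewrite ffunE msize_deriv.
Qed.
Lemma Pdeg_koszul s w : Pdeg s w -> Pdeg s.+1 (koszul w).
Proof.
move=> hw; rewrite koszulE; apply: Pdeg_sum => i _ I.
by rewrite ffunE msize_XM //; apply: Pdeg_io.
Qed.

Lemma Pdeg0 w : Pdeg 0 w -> w = 0.
Proof. by move=> h; apply/ffunP => I; rewrite ffunE; apply/msize_le0/h. Qed.

(** The Lie derivative acts on components as [euler + k.+1], which [einv] inverts. The result [G] is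
    again closed because [euler + k.+2] is injective on [extd G], and Cartan's formula then exhibits
    the potential. *)
Lemma poincare k s w : Pfull s k.+1 w -> extd w = 0 ->
  exists2 G, Pfull s k.+1 G & w = extd (koszul G).
Proof.
move=> [wk ws] dw; pose G : form := [ffun I : {set 'I_n} => einv k.+1 (w I)].
have Gk : pure k.+1 G.
  move=> I kI; rewrite ffunE wk //; apply/mpolyP => m; by rewrite mcoeff_einv mcoeff0 mul0r.
have LG : extd (koszul G) + koszul (extd G) = w.
  by rewrite (cartan Gk); apply/ffunP => I; rewrite !ffunE einvK.
have dG : extd G = 0.
  have := cartan (pure_extd Gk); rewrite extd2 linear0 addr0.
  have -> : extd (koszul (extd G)) = 0.
    by have := congr1 (@extd R n) LG; rewrite linearD /= extd2 add0r dw.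
  move=> h; apply/ffunP => I; have /ffunP /(_ I) := h; rewrite !ffunE => e.
  by apply: (@euler_inj _ _ k.+2) => //; rewrite -e ffunE.
exists G; first by split=> // I; rewrite ffunE msize_einv.
by rewrite -{1}LG dG linear0 addr0.
Qed.

Lemma PminusE r k w : Pminus r k w -> Pfull r.+1 k w.
Proof.
move=> [a [b [[ak as_] [bk bs] ->]]]; split.
  by apply: pureD => //; apply: pure_koszul.
by apply: PdegD; [apply: Pdeg_le as_|apply: Pdeg_koszul].
Qed.

(** For the Koszul part [h] one has [d h = - d a], so Cartan's formula reads
    [(euler + k) h = - koszul (d a)]. The right side has no higher degree than [a], and inverting
    [euler + k] does not raise it: closedness removes the extra degree of a first-kind space. *)
Lemma Pminus_closed r k w : (0 < k)%N -> Pminus r k w -> extd w = 0 -> Pfull r k w.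
Proof.
case: k => // k _ [a [b [[ak as_] [bk bs] ->]]] dw.
have hk : pure k.+1 (koszul b) := pure_koszul bk.
suff hs : Pdeg r (koszul b) by split; [exact: pureD|exact: PdegD].
have dh : extd (koszul b) = - extd a.
  by apply/eqP; rewrite -addr_eq0 addrC; apply/eqP; rewrite -[RHS]dw [in RHS]linearD.
have kda : Pdeg r (koszul (extd a)).
  (* The predecessor in [Pdeg_extd] is truncated at zero, so [r = 0] is separate. *)
  case: r as_ {bs} => [/Pdeg0 ->|r as_]; last exact: Pdeg_koszul (Pdeg_extd as_).
  by rewrite !linear0 => I; rewrite ffunE mmeasure0.
have := cartan hk; rewrite koszul2 linear0 add0r dh linearN => /ffunP h I.
apply: (@msize_euler_inv _ _ k.+1) => //; have := h I; rewrite !ffunE => <-.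
by rewrite mmeasureN; have := kda I; rewrite ffunE.
Qed.

Lemma Pfull0 s k : Pfull s k (0 : form).
Proof. by split=> I *; rewrite ffunE // mmeasure0. Qed.
Lemma PfullD s k u w : Pfull s k u -> Pfull s k w -> Pfull s k (u + w).
Proof. by move=> [? ?] [? ?]; split; [apply: pureD|apply: PdegD]. Qed.
Lemma PfullZ s k c w : Pfull s k w -> Pfull s k (c *: w).
Proof. by move=> [? ?]; split; [apply: pureZ|apply: PdegZ]. Qed.
Lemma PminusD s k u w : Pminus s k u -> Pminus s k w -> Pminus s k (u + w).
Proof.
move=> [a [b [? ? ->]]] [a' [b' [? ? ->]]]; exists (a + a'), (b + b').
split; [exact: PfullD|exact: PfullD|by rewrite linearD addrACA].
Qed.
Lemma PminusZ s k c w : Pminus s k w -> Pminus s k (c *: w).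
Proof.
move=> [a [b [? ? ->]]]; exists (c *: a), (c *: b).
split; [exact: PfullZ|exact: PfullZ|by rewrite linearZ scalerDr].
Qed.
Lemma Pfull_minus r k w : Pfull r k w -> Pminus r k w.
Proof. by move=> h; exists w, 0; rewrite linear0 addr0; split=> //; apply: Pfull0. Qed.

End PolyForms.

(** * Pullback by affine maps *)

Section Affine.
Variable R : realType.

Definition affp a m (b : 'cV[R]_a) (A : 'M[R]_(a, m)) : a.-tuple {mpoly R[m]} :=
  [tuple (b i 0)%:MP + \sum_(j < m) A i j *: 'X_j | i < a].

Lemma tnth_affp a m (b : 'cV[R]_a) (A : 'M[R]_(a, m)) i :
  tnth (affp b A) i = (b i 0)%:MP + \sum_(j < m) A i j *: 'X_j.
Proof. by rewrite tnth_mktuple. Qed.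

Lemma comp_mpolyA a b c (p : {mpoly R[a]}) (t : a.-tuple {mpoly R[b]}) (u : b.-tuple {mpoly R[c]}) :
  (p \mPo t) \mPo u = p \mPo [tuple tnth t i \mPo u | i < a].
Proof.
elim/mpolyind: p => [|e m p _ _ IH]; first by rewrite !linear0.
rewrite !linearD /= !linearZ /= IH; congr (_ *: _ + _).
rewrite !comp_mpolyX rmorph_prod; apply: eq_bigr => i _.
by rewrite rmorphXn tnth_mktuple.
Qed.

Lemma affp_comp a b c (p : {mpoly R[a]}) v (A : 'M[R]_(a, b)) v' (A' : 'M[R]_(b, c)) :
  (p \mPo affp v A) \mPo affp v' A' = p \mPo affp (v + A *m v') (A *m A').
Proof.
rewrite comp_mpolyA; congr (_ \mPo _); apply: eq_from_tnth => i.
rewrite tnth_mktuple !tnth_affp linearD /= comp_mpolyC mxE mpolyCD -addrA; congr (_ + _).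
rewrite linear_sum /= mxE [X in X%:MP + _](eq_bigr (fun j => A i j * v' j 0)) //.
under eq_bigr do rewrite linearZ /= comp_mpolyXU -tnth_nth tnth_affp scalerDr.
rewrite big_split /= rmorph_sum /=; congr (_ + _).
  by apply: eq_bigr => j _; rewrite -mul_mpolyC -mpolyCM.
under eq_bigr do rewrite scaler_sumr.
rewrite exchange_big /=; apply: eq_bigr => j _; rewrite mxE scaler_suml.
by apply: eq_bigr => l _; rewrite scalerA.
Qed.

Lemma affp_id a (p : {mpoly R[a]}) : p \mPo affp 0 1%:M = p.
Proof.
rewrite -[RHS]comp_mpoly_id; congr (_ \mPo _); apply: eq_from_tnth => i.
rewrite tnth_affp tnth_mktuple mxE mpolyC0 add0r (bigD1 i) //= mxE eqxx scale1r.
by rewrite big1 ?addr0 // => j ji; rewrite mxE eq_sym (negPf ji) scale0r.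
Qed.

Lemma mderiv_affp a m (p : {mpoly R[a]}) b (A : 'M[R]_(a, m)) i :
  mderiv i (p \mPo affp b A) = \sum_(l < a) A l i *: (mderiv l p \mPo affp b A).
Proof.
have dl l : mderiv i (tnth (affp b A) l) = (A l i)%:MP.
  rewrite tnth_affp linearD /= mderivC add0r linear_sum (bigD1 i) //=.
  rewrite linearZ /= mderivX mnm1E eqxx scale1r big1 ?addr0.
    by rewrite -[RHS]mulr1 mul_mpolyC (_ : (_ - _)%MM = 0%MM) ?mpolyX0 //;
      apply/mnmP => j; rewrite mnmBE subnn mnm0E.
  by move=> j ji; rewrite linearZ /= mderivX mnm1E (negPf ji) scale0r scaler0.
elim/mpolyind: p => [|e m' p _ _ IH].
  by rewrite !linear0 big1 // => l _; rewrite !linear0.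
rewrite linearD /= linearD /= linearZ /= linearZ /= IH.
under [RHS]eq_bigr do rewrite linearD linearZ /= linearD linearZ /= scalerDr.
rewrite big_split /=; congr (_ + _).
under [RHS]eq_bigr do rewrite scalerA mulrC -scalerA.
rewrite -scaler_sumr; congr (_ *: _).
elim: {m'}(mdeg m') {-2}m' (erefl (mdeg m')) => [|k IHk] m' mk.
  have -> : m' = 0%MM by apply/eqP; rewrite -mdeg_eq0 mk.
  rewrite mpolyX0 rmorph1 -mpolyC1 mderivC big1 // => l _.
  by rewrite mderivC linear0 scaler0.
have [j mj] : exists j, m' j != 0%N.
  apply/existsP; rewrite -negb_forall; apply/negP => /forallP h.
  by move: mk; rewrite mdegE big1 // => j _; apply/eqP.
have em : m' = (U_(j) + (m' - U_(j)))%MM.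
  by apply/mnmP => l; rewrite mnmDE mnmBE mnm1E; case: eqP => [<-|] /=; move: mj; lia.
have dk : mdeg (m' - U_(j))%MM = k.
  by have := congr1 mdeg em; rewrite mk mdegD mdeg1 add1n => -[].
rewrite em mpolyXD rmorphM /= mderivM (IHk _ dk) comp_mpolyXU -tnth_nth dl.
under [RHS]eq_bigr do rewrite mderivM linearD /= !rmorphM /= scalerDr comp_mpolyXU -tnth_nth.
rewrite big_split /=; congr (_ + _); last first.
  by rewrite mulr_sumr; apply: eq_bigr => l _; rewrite scalerAr.
rewrite (bigD1 j) //= mderivX mnm1E eqxx scale1r big1 ?addr0.
  rewrite (_ : (U_(j) - U_(j))%MM = 0%MM) ?mpolyX0 ?rmorph1 ?mul1r ?mul_mpolyC //.
  by apply/mnmP => l; rewrite mnmBE subnn mnm0E.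
by move=> l lj; rewrite mderivX mnm1E eq_sym (negPf lj) scale0r linear0 mul0r scaler0.
Qed.

Lemma msize_affp_tnth a m b (A : 'M[R]_(a, m)) i : (msize (tnth (affp b A) i) <= 2)%N.
Proof.
rewrite tnth_affp; apply: msizeD; first by rewrite msizeC; case: eqP.
by apply: msize_sumk => j _; apply: msizeZk; rewrite msizeXi.
Qed.

Lemma msize_exp k (n : nat) (f : {mpoly R[n]}) : (msize f <= 2)%N -> (msize (f ^+ k) <= k.+1)%N.
Proof.
move=> f2; elim: k => [|k IH]; first by rewrite expr0 msize1.
by rewrite exprS -[k.+2]/(2 + k.+1).-1; apply: msizeMk.
Qed.

Lemma msize_affp a m s (p : {mpoly R[a]}) b (A : 'M[R]_(a, m)) :
  (msize p <= s)%N -> (msize (p \mPo affp b A) <= s)%N.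
Proof.
move=> ps; rewrite comp_mpolyE big_seq; apply: msize_sumk => k kp; apply: msizeZk.
apply: leq_trans (leq_trans (msize_mdeg_lt kp) ps); rewrite mdegE.
elim/big_rec2: _ => [|i x y _ xy]; first by rewrite msize1.
have := msizeMk (msize_exp (k i) (msize_affp_tnth b A i)) xy.
by rewrite addSn addnS.
Qed.

Definition pull a m (b : 'cV[R]_a) (A : 'M[R]_(a, m)) (w : dform R a) : dform R m :=
  Lam A [ffun J : {set 'I_a} => w J \mPo affp b A].

Lemma pull_is_linear a m b (A : 'M[R]_(a, m)) : linear (pull b A).
Proof.
move=> c u v; rewrite /pull -linearP; congr Lam; apply/ffunP => J.
by rewrite !ffunE linearP.
Qed.
HB.instance Definition _ a m b (A : 'M[R]_(a, m)) :=
  GRing.isLinear.Build R _ _ _ (pull b A) (pull_is_linear b A).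

Section Pull.
Variables (a m : nat) (b : 'cV[R]_a) (A : 'M[R]_(a, m)).
Local Notation P := (pull b A).
Implicit Types w u : dform R a.

Lemma pull_ew l w : P (ew l w) = \sum_(i < m) A l i *: ew i (P w).
Proof.
rewrite /pull -Lam_ew; congr Lam; apply/ffunP => J; rewrite !ffunE.
by case: ifP => _; rewrite ?linear0 ?linearZ.
Qed.

Lemma pull_io i w : io i (P w) = \sum_(l < a) A l i *: P (io l w).
Proof.
rewrite /pull Lam_io linear_sum; apply: eq_bigr => l _; rewrite linearZ; congr (_ *: Lam _ _).
by apply/ffunP => J; rewrite !ffunE; case: ifP => _; rewrite ?linear0 ?linearZ.
Qed.

Lemma pull_mf f w : P (mf f w) = mf (f \mPo affp b A) (P w).
Proof.
apply/ffunP => I; rewrite !ffunE mulr_sumr; apply: eq_bigr => J _.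
by rewrite !ffunE rmorphM scalerAr.
Qed.

Lemma pull_pd i w : pd i (P w) = \sum_(l < a) A l i *: P (pd l w).
Proof.
apply/ffunP => I; rewrite sum_ffunE !ffunE linear_sum.
under [RHS]eq_bigr do rewrite !ffunE scaler_sumr.
rewrite exchange_big /=; apply: eq_bigr => J _; rewrite linearZ /= ffunE mderiv_affp scaler_sumr.
by apply: eq_bigr => l _; rewrite !ffunE !scalerA mulrC.
Qed.

Lemma pull_extd w : P (extd w) = extd (P w).
Proof.
rewrite !extdE linear_sum /=; under eq_bigr do rewrite pull_ew.
rewrite exchange_big /=; apply: eq_bigr => i _; rewrite pull_pd linear_sum /=.
by apply: eq_bigr => l _; rewrite linearZ.
Qed.

Lemma pull_koszul w : P (koszul w) = koszul (P w) + \sum_(l < a) b l 0 *: P (io l w).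
Proof.
rewrite !koszulE linear_sum /=.
under eq_bigr do rewrite pull_mf comp_mpolyXU -tnth_nth tnth_affp mfDl mfC mf_suml.
rewrite big_split /= addrC; congr (_ + _); rewrite exchange_big /=; apply: eq_bigr => i _.
rewrite pull_io linear_sum /=; apply: eq_bigr => l _.
by rewrite mfZl linearZ.
Qed.

Lemma pull_pure k w : pure k w -> pure k (P w).
Proof.
move=> wk I kI; rewrite ffunE big1 // => J /eqP JI.
by rewrite ffunE wk ?JI // linear0 scaler0.
Qed.

Lemma pull_Pdeg s w : Pdeg s w -> Pdeg s (P w).
Proof.
move=> ws I; rewrite ffunE; apply: msize_sumk => J _; apply: msizeZk.
by rewrite ffunE msize_affp.
Qed.

Lemma pull_Pfull s k w : Pfull s k w -> Pfull s k (P w).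
Proof. by move=> [? ?]; split; [apply: pull_pure|apply: pull_Pdeg]. Qed.

(** An affine map moves the origin of the Koszul operator, which adds contractions with the constant
    vector [b]. These do not raise the degree and are absorbed by the full summand. *)
Lemma pull_Pminus s k w : Pminus s k w -> Pminus s k (P w).
Proof.
move=> [u [v [hu hv ->]]].
exists (P u + \sum_(l < a) b l 0 *: P (io l v)), (P v); split.
- apply: PfullD; first exact: pull_Pfull.
  case: hv => vk vs; apply: (big_ind (@Pfull R m s k)) => [||l _].
  + exact: Pfull0.
  + by move=> ? ?; apply: PfullD.
  by apply/PfullZ/pull_Pfull; split; [apply: pure_io|apply: Pdeg_io].
- exact: pull_Pfull.
- by rewrite [LHS]linearD /= pull_koszul [X in _ + X]addrC addrA.
Qed.

Lemma pull_Xcx c p k w : Xcx c p k w -> Xcx c p k (P w).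
Proof.
rewrite /Xcx; case: ifP => _; first exact: pull_Pfull.
by case: ifP => _; [apply: pull_Pfull|apply: pull_Pminus].
Qed.

Lemma pullM c b' (A' : 'M[R]_(m, c)) w :
  pull b' A' (P w) = pull (b + A *m b') (A *m A') w.
Proof.
rewrite /pull -LamM; congr Lam.
rewrite -(Lam_comp A (comp_mpoly (affp b' A'))); congr Lam.
by apply/ffunP => J; rewrite !ffunE /= affp_comp.
Qed.

End Pull.

Lemma pull1 a (w : dform R a) : pull 0 1%:M w = w.
Proof. by rewrite /pull Lam1; apply/ffunP => I; rewrite ffunE affp_id. Qed.

End Affine.

(** * Integration over the unit simplex *)

Section Int01.
Variable R : realType.
Implicit Types p q : {poly R}.

Definition int01 p : R := \sum_(i < size p) p`_i / i.+1%:R.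

Lemma int01E k p : (size p <= k)%N -> int01 p = \sum_(i < k) p`_i / i.+1%:R.
Proof.
move=> pk; rewrite /int01 (big_ord_widen _ (fun i => p`_i / i.+1%:R) pk) [RHS](bigID (fun i : 'I_k => (i < size p)%N)) /=.
rewrite [X in _ = _ + X]big1 ?addr0 // => i; rewrite -leqNgt => pi.
by rewrite nth_default // mul0r.
Qed.

Lemma int01_is_linear : scalar int01.
Proof.
move=> c p q; set k := maxn (size p) (size q).
rewrite (@int01E k (c *: p + q)) ?(@int01E k p) ?(@int01E k q) ?leq_maxl ?leq_maxr //.
  rewrite mulr_sumr -big_split; apply: eq_bigr => i _ /=.
  by rewrite coefD coefZ mulrDl mulrA.
rewrite (leq_trans (size_polyD _ _)) // geq_max leq_maxr andbT.
by rewrite (leq_trans (size_scale_leq _ _)) // leq_maxl.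
Qed.
HB.instance Definition _ := GRing.isLinear.Build R {poly R} R _ int01 int01_is_linear.

Lemma int01_Xn a : int01 'X^a = a.+1%:R^-1.
Proof.
rewrite (@int01E a.+1) ?size_polyXn // big_ord_recr /= big1 ?add0r => [|i _].
  by rewrite coefXn eqxx mul1r.
by rewrite coefXn ltn_eqF ?mul0r.
Qed.

Lemma int01_deriv p : int01 p^`() = p.[1] - p.[0].
Proof.
have XnE k : int01 ('X^k)^`() = ('X^k : {poly R}).[1] - ('X^k).[0].
  rewrite derivXn linearMn /= !hornerXn expr1n; case: k => [|k]; first by rewrite mulr0n expr0 subrr.
  by rewrite /= int01_Xn -[_ *+ _]mulr_natr mulVf ?pnatr_eq0 // expr0n subr0.
rewrite -(coefK p) poly_def.
rewrite linear_sum /= linear_sum /= !horner_sum -sumrB; apply: eq_bigr => i _.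
by rewrite !linearZ /= XnE !hornerZ mulrBr.
Qed.

Lemma int01_beta a b : int01 ('X^a * (1 - 'X) ^+ b) = (a`! * b`!)%:R / (a + b).+1`!%:R.
Proof.
elim: b a => [|b IH] a.
  rewrite expr0 mulr1 int01_Xn fact0 muln1 addn0 factS natrM invfM mulrC mulfVK //.
  by rewrite pnatr_eq0 -lt0n fact_gt0.
have der : ('X^(a.+1) * (1 - 'X) ^+ b.+1 : {poly R})^`() =
    a.+1%:R *: ('X^a * (1 - 'X) ^+ b.+1) - b.+1%:R *: ('X^(a.+1) * (1 - 'X) ^+ b).
  rewrite derivM derivXn deriv_exp derivB derivX -polyC1 derivC sub0r mulN1r /=.
  by rewrite mulNrn mulrN mulrnAl mulrnAr !scaler_nat.
have := int01_deriv ('X^(a.+1) * (1 - 'X) ^+ b.+1).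
rewrite !hornerM !hornerXn !horner_exp !hornerE subrr !expr0n mulr0 mul0r subrr.
rewrite der linearB linearZ linearZ /= IH => /eqP; rewrite subr_eq0 => /eqP e.
apply: (mulfI (x := a.+1%:R)); first by rewrite pnatr_eq0.
rewrite e addSn addnS !factS !natrM; ring.
Qed.

Lemma poly01_ge0_mono p q a b : p = q^`() -> (forall t, 0 <= t <= 1 -> 0 <= p.[t]) ->
  0 <= a -> a <= b -> b <= 1 -> q.[a] <= q.[b].
Proof.
move=> -> pos a0; rewrite le_eqVlt => /predU1P [-> //|ab] b1.
have [c /andP [ac cb] e] := poly_mvt q ab.
rewrite -subr_ge0 e mulr_ge0 ?subr_ge0 ?(ltW ab) //; apply: pos.
move: ac cb; rewrite !bnd_simp => ac cb.
by rewrite (le_trans a0 (ltW ac)) (le_trans (ltW cb) b1).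
Qed.

Definition prim p : {poly R} := \poly_(i < (size p).+1) (p`_i.-1 / i%:R *+ (i != 0%N)).

Lemma deriv_prim p : (prim p)^`() = p.
Proof.
apply/polyP => i; rewrite coef_deriv coef_poly ltnS mulr1n /=.
case: ltnP => ip; last by rewrite mul0rn nth_default.
by rewrite -[_ *+ _]mulr_natr divfK // pnatr_eq0.
Qed.

Lemma int01_ge0 p : (forall t, 0 <= t <= 1 -> 0 <= p.[t]) -> 0 <= int01 p.
Proof.
move=> pos; rewrite -(deriv_prim p) int01_deriv subr_ge0.
by apply: (poly01_ge0_mono (esym (deriv_prim p))); rewrite ?lexx ?ler01.
Qed.

Lemma poly_inf_roots p : (forall t, 0 < t < 1 -> p.[t] = 0) -> p = 0.
Proof.
move=> h; apply/eqP; apply: contraT => p0.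
pose rs := [seq (k.+2%:R : R)^-1 | k <- iota 0 (size p)].
have : (size rs < size p)%N.
  apply: max_poly_roots => //.
    apply/allP => x /mapP [k _ ->]; apply/rootP/h.
    by rewrite invr_gt0 ltr0Sn invf_lt1 ?ltr1n ?ltr0n.
  rewrite map_inj_uniq ?iota_uniq // => x y /invr_inj /eqP.
  by rewrite eqr_nat => /eqP [].
by rewrite size_map size_iota ltnn.
Qed.

Lemma int01_eq0 p : (forall t, 0 <= t <= 1 -> 0 <= p.[t]) -> int01 p = 0 -> p = 0.
Proof.
move=> pos; rewrite -{1}(deriv_prim p) int01_deriv => /eqP; rewrite subr_eq0 => /eqP e.
have mono := poly01_ge0_mono (esym (deriv_prim p)) pos.
suff : prim p - (prim p).[0]%:P = 0.
  by move/(congr1 deriv); rewrite derivB derivC deriv_prim subr0 deriv0.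
apply: poly_inf_roots => t /andP [t0 t1]; rewrite !hornerE; apply/eqP.
rewrite subr_eq0 eq_le; apply/andP; split; first by rewrite -e; apply: mono; rewrite ?lexx // ltW.
by apply: mono; rewrite ?lexx // ltW.
Qed.
End Int01.

Section IntD.
Variable R : realType.

Lemma intDE n k (q : {mpoly R[n]}) : (msize q <= k)%N ->
  intD q = \sum_(m : 'X_{1..n < k}) q@_m * ((\prod_(i < n) (m i)`!)%:R / ((mdeg m + n)`!)%:R).
Proof.
move=> qk; pose P (m : 'X_{1..n < k}) := (val m) \in msupp q.
rewrite (bigID P) {}/P /= addrC big1 ?add0r; last first.
  by move=> m /memN_msupp_eq0=> ->; rewrite mul0r.
rewrite /intD (big_mksub 'X_{1..n < k}) //=; first exact/msupp_uniq.
by move=> m /msize_mdeg_lt /leq_trans; apply.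
Qed.

Lemma intD_is_linear n : scalar (@intD R n).
Proof.
move=> c p q; set k := maxn (msize p) (msize q).
have pk : (msize p <= k)%N by rewrite leq_maxl.
have qk : (msize q <= k)%N by rewrite leq_maxr.
rewrite (intDE pk) (intDE qk) (@intDE _ k); last by apply: msizeD => //; apply: msizeZk.
rewrite mulr_sumr -big_split; apply: eq_bigr => m _ /=.
by rewrite mcoeffD mcoeffZ mulrDl -mulrA.
Qed.
HB.instance Definition _ n := GRing.isLinear.Build R {mpoly R[n]} R _ (@intD R n) (@intD_is_linear n).

Lemma intD_add n (f g : {mpoly R[n]}) : intD (f + g) = intD f + intD g.
Proof. exact: linearD. Qed.
Lemma intD_sub n (f g : {mpoly R[n]}) : intD (f - g) = intD f - intD g.
Proof. exact: linearB. Qed.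
Lemma intD_scale n c (f : {mpoly R[n]}) : intD (c *: f) = c * intD f.
Proof. exact: linearZ. Qed.
Lemma intD_sum n (T : Type) (s : seq T) (P : pred T) (F : T -> {mpoly R[n]}) :
  intD (\sum_(t <- s | P t) F t) = \sum_(t <- s | P t) intD (F t).
Proof. exact: linear_sum. Qed.

Lemma intDX n (m : 'X_{1..n}) :
  intD ('X_[m] : {mpoly R[n]}) = (\prod_(i < n) (m i)`!)%:R / ((mdeg m + n)`!)%:R.
Proof. by rewrite /intD msuppX big_seq1 mcoeffX eqxx mul1r. Qed.

Definition mtl n (m : 'X_{1..n.+1}) : 'X_{1..n} := [multinom m (lift ord0 j) | j < n].

Lemma mdeg_mtl n (m : 'X_{1..n.+1}) : mdeg m = (m ord0 + mdeg (mtl m))%N.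
Proof.
rewrite !mdegE big_ord_recl; congr addn; apply: eq_bigr => i _; by rewrite mnmE.
Qed.

(** Fubini on monomials, with value at [t] the integral over the section where the first coordinate
    is [t]. The section is a simplex scaled by [1 - t], whence the exponent [mdeg + n]. *)
Definition slice_poly n (q : {mpoly R[n.+1]}) : {poly R} :=
  \sum_(m <- msupp q) q@_m *: (intD ('X_[mtl m] : {mpoly R[n]}) *:
     ('X^(m ord0) * (1 - 'X) ^+ (mdeg (mtl m) + n))).

Definition slice n (t : R) (q : {mpoly R[n.+1]}) : {mpoly R[n]} :=
  q \mPo [tuple oapp (fun j => (1 - t) *: 'X_j) t%:MP (unlift ord0 i) | i < n.+1].

Lemma slice_is_linear n t : linear (@slice n t).
Proof. by move=> c p q; rewrite /slice linearP. Qed.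
HB.instance Definition _ n t := GRing.isLinear.Build R _ _ _ (@slice n t) (@slice_is_linear n t).

Lemma sliceX n t (m : 'X_{1..n.+1}) :
  slice t 'X_[m] = (t ^+ m ord0 * (1 - t) ^+ mdeg (mtl m)) *: 'X_[mtl m].
Proof.
rewrite /slice comp_mpolyX big_ord_recl tnth_mktuple unlift_none /= -rmorphXn mul_mpolyC.
rewrite -scalerA; congr (_ *: _).
rewrite [X in _ *: X]mpolyXE_id mdegE -prodrXr -scaler_prod; apply: eq_bigr => i _.
by rewrite tnth_mktuple liftK /= mnmE exprZn.
Qed.

Lemma intD_slice_poly n (q : {mpoly R[n.+1]}) : intD q = int01 (slice_poly q).
Proof.
rewrite linear_sum /=; apply: eq_bigr => m _; rewrite !linearZ /=; congr (_ * _).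
rewrite int01_beta !intDX big_ord_recl addnA -mdeg_mtl addnS.
have -> : (\prod_(i < n) (mtl m i)`! = \prod_(i < n) (m (lift ord0 i))`!)%N.
  by apply: eq_bigr => i _; rewrite mnmE.
rewrite !natrM mulrA; congr (_ / _); rewrite mulrACA mulVf ?mulr1 1?mulrC //.
by rewrite pnatr_eq0 -lt0n fact_gt0.
Qed.

Lemma horner_slice_poly n t (q : {mpoly R[n.+1]}) :
  (slice_poly q).[t] = (1 - t) ^+ n * intD (slice t q).
Proof.
rewrite {2}(mpolyE q) /slice_poly horner_sum [slice _ _]linear_sum /= [intD _]linear_sum mulr_sumr.
apply: eq_bigr => m _; rewrite [slice _ _]linearZ /= sliceX !linearZ /= !hornerZ hornerM hornerXn horner_exp.
have -> : (1 - 'X : {poly R}).[t] = 1 - t by rewrite !hornerE.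
rewrite exprD; move: (intD _) (_ ^+ n) (_ ^+ _) (_ ^+ _) => a b c d; ring.
Qed.

Lemma meval_slice n t (q : {mpoly R[n.+1]}) (y : 'I_n -> R) :
  (slice t q).@[y] = q.@[fun i => oapp (fun j => (1 - t) * y j) t (unlift ord0 i)].
Proof.
rewrite /slice comp_mpoly_meval; apply: meval_eq => i; rewrite tnth_mktuple.
by case: (unlift _ _) => [j|] /=; rewrite ?mevalC // mevalZ mevalXU.
Qed.

Definition simplex n (x : 'I_n -> R) : Prop := (forall i, 0 <= x i) /\ \sum_i x i <= 1.

Lemma simplex_slice n t (y : 'I_n -> R) : 0 <= t <= 1 -> simplex y ->
  simplex (fun i : 'I_n.+1 => oapp (fun j => (1 - t) * y j) t (unlift ord0 i)).
Proof.
move=> /andP [t0 t1] [y0 y1]; split=> [i|].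
  by case: (unlift _ _) => [j|] //=; rewrite mulr_ge0 ?subr_ge0.
rewrite big_ord_recl unlift_none /=; under eq_bigr do rewrite liftK /=.
rewrite -mulr_sumr; have : (1 - t) * \sum_i y i <= (1 - t) * 1 by rewrite ler_wpM2l ?subr_ge0.
by rewrite mulr1; lra.
Qed.

Lemma mpoly0E (q : {mpoly R[0]}) : q = (q@_0%MM)%:MP.
Proof. by rewrite -[LHS]mpolyKC. Qed.

Lemma intDC n (c : R) : intD (c%:MP : {mpoly R[n]}) = c / (n`!)%:R.
Proof.
rewrite -[c%:MP]mulr1 mul_mpolyC -mpolyX0 linearZ /= intDX mdeg0; congr (_ * _).
by rewrite big1 ?mul1r // => i _; rewrite mnm0E fact0.
Qed.

Lemma slice_poly_ge0 n (q : {mpoly R[n.+1]}) :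
  (forall q' : {mpoly R[n]}, (forall x, simplex x -> 0 <= q'.@[x]) -> 0 <= intD q') ->
  (forall x, simplex x -> 0 <= q.@[x]) ->
  forall t, 0 <= t <= 1 -> 0 <= (slice_poly q).[t].
Proof.
move=> IH pos t t01; rewrite horner_slice_poly mulr_ge0 //.
  by case/andP: t01 => _ t1; rewrite exprn_ge0 // subr_ge0.
by apply: IH => x xs; rewrite meval_slice; apply: pos; apply: simplex_slice.
Qed.

Lemma intD_ge0 n (q : {mpoly R[n]}) :
  (forall x, simplex x -> 0 <= q.@[x]) -> 0 <= intD q.
Proof.
elim: n q => [|n IH] q pos; last first.
  by rewrite intD_slice_poly; apply: int01_ge0; apply: slice_poly_ge0.
have : simplex (fun _ : 'I_0 => 0 : R) by split=> [[]|] //; rewrite big_ord0 ler01.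
by move=> /pos; rewrite (mpoly0E q) mevalC intDC fact0 divr1.
Qed.

Lemma slice_eq0 n (q : {mpoly R[n.+1]}) :
  (forall t, 0 < t < 1 -> slice t q = 0) -> q = 0.
Proof.
move=> h; apply/mpolyP => m0; rewrite mcoeff0.
pose u : {poly R} := \sum_(m <- msupp q) (q@_m *+ (mtl m == mtl m0)) *: 'X^(m ord0).
have u0 : u = 0.
  apply: poly_inf_roots => t t01; have /mpolyP /(_ (mtl m0)) := h t t01.
  rewrite {1}(mpolyE q) [slice _ _]linear_sum raddf_sum mcoeff0 /=.
  have nz : (1 - t) ^+ mdeg (mtl m0) != 0.
    by case/andP: t01 => _ t1; rewrite expf_neq0 // subr_eq0 eq_sym lt_eqF.
  move=> e; apply: (mulfI nz); rewrite mulr0 -[RHS]e horner_sum mulr_sumr.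
  apply: eq_bigr => m _; rewrite [slice _ _]linearZ /= sliceX !mcoeffZ mcoeffX hornerZ hornerXn.
  by case: eqP => [->|_]; rewrite ?mulr0 ?mul0r ?mulr0 //; ring.
have := congr1 (fun p : {poly R} => p`_(m0 ord0)) u0; rewrite coef0 coef_sum.
case mq: (m0 \in msupp q); last by rewrite memN_msupp_eq0 ?mq.
rewrite (bigD1_seq m0) ?msupp_uniq //= eqxx coefZ coefXn eqxx mulr1 big1 ?addr0 // => m mm0.
rewrite coefZ coefXn; case: eqP => [tm|_]; last by rewrite mulr0n mul0r.
case: eqP => [em|_]; last by rewrite mulr0.
case/eqP: mm0; apply/mnmP => i; case: (unliftP ord0 i) => [j ->|-> //].
by have /mnmP /(_ j) := tm; rewrite !mnmE.
Qed.

(** Induction on the dimension: the section integrals form a nonnegative polynomial of zero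
    integral, so each section vanishes, and infinitely many sections determine the polynomial. *)
Lemma intD_eq0 n (q : {mpoly R[n]}) :
  (forall x, simplex x -> 0 <= q.@[x]) -> intD q = 0 -> q = 0.
Proof.
elim: n q => [|n IH] q pos.
  by rewrite (mpoly0E q) intDC fact0 divr1 => ->; rewrite mpolyC0.
rewrite intD_slice_poly => q0; apply: slice_eq0 => t /andP [t0 t1].
have t01 : 0 <= t <= 1 by rewrite !ltW.
apply: IH => [x xs|]; first by rewrite meval_slice; apply/pos/simplex_slice.
have := int01_eq0 (slice_poly_ge0 (@intD_ge0 n) pos) q0.
move=> /(congr1 (fun p => p.[t])); rewrite horner_slice_poly horner0 => /eqP.
by rewrite mulf_eq0 expf_eq0 subr_eq0 eq_sym (lt_eqF t1) andbF => /eqP.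
Qed.

Lemma intD_le n (p q : {mpoly R[n]}) :
  (forall x, simplex x -> p.@[x] <= q.@[x]) -> intD p <= intD q.
Proof.
by move=> h; rewrite -subr_ge0 -linearB intD_ge0 // => x /h; rewrite mevalB subr_ge0.
Qed.

Lemma intD_sq_ge0 n (f : {mpoly R[n]}) : 0 <= intD (f * f).
Proof. by apply: intD_ge0 => x _; rewrite mevalM -expr2 sqr_ge0. Qed.

Lemma intD_sq_eq0 n (f : {mpoly R[n]}) : intD (f * f) = 0 -> f = 0.
Proof.
move=> h; have /eqP : f * f = 0.
  by apply: intD_eq0 h => x _; rewrite mevalM -expr2 sqr_ge0.
by rewrite mulf_eq0 orbb => /eqP.
Qed.

End IntD.

(** * Cone decomposition and the Hardy inequality *)

Section Calculus.
Variables (R : realType) (n : nat).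
Local Notation poly := {mpoly R[n]}.
Implicit Types (f g F q : poly) (i : 'I_n) (m : 'X_{1..n}).

Definition x0 : poly := 1 - \sum_(i < n) 'X_i.
(** The flux of the radial field [x F]. This field is tangent to the coordinate faces, so the flux
    is the integral of [F] over the slanted face [x0 = 0]. *)
Definition bd F : R := intD (euler F + n%:R *: F).

Lemma bd_is_linear : scalar bd.
Proof.
move=> c f g; rewrite /bd linearP scalerDr !scalerA mulrC -scalerA addrACA -scalerDr linearP //.
Qed.
HB.instance Definition _ := GRing.isLinear.Build R poly R _ bd bd_is_linear.

Lemma bdXE m : bd 'X_[m] = (mdeg m + n)%:R * intD ('X_[m] : poly).
Proof. by rewrite /bd eulerX -scalerDl -natrD linearZ. Qed.

Lemma prod_factU i m : (\prod_(j < n) ((U_(i) + m)%MM j)`! = (m i).+1 * \prod_(j < n) (m j)`!)%N.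
Proof.
rewrite (bigD1 i) //= [in RHS](bigD1 i) //= mulnA mnmDE mnm1E eqxx add1n factS.
by congr muln; apply: eq_bigr => j ji; rewrite mnmDE mnm1E eq_sym (negPf ji).
Qed.

Lemma mdegU i m : mdeg (U_(i) + m)%MM = (mdeg m).+1.
Proof. by rewrite mdegD mdeg1 add1n. Qed.

Lemma factnz k : ((k`!)%:R != 0 :> R).
Proof. by rewrite pnatr_eq0 -lt0n fact_gt0. Qed.

Lemma bd_XM i m : bd ('X_i * 'X_[m]) = (m i).+1%:R * intD ('X_[m] : poly).
Proof.
rewrite -mpolyXD bdXE !intDX prod_factU mdegU addSn factS !natrM.
rewrite invfM mulrCA mulrA -!mulrA; congr (_ * (_ * _)).
by rewrite mulrA divff ?mul1r // pnatr_eq0.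
Qed.

Lemma deriv_XM i m : mderiv i ('X_i * 'X_[m]) = (m i).+1%:R *: ('X_[m] : poly).
Proof.
rewrite -mpolyXD mderivX mnmDE mnm1E eqxx add1n; congr (_ *: 'X_[_]).
by apply/mnmP => j; rewrite mnmBE mnmDE addKn.
Qed.

Lemma intD_deriv_XM i F : intD (mderiv i ('X_i * F)) = bd ('X_i * F).
Proof.
elim/mpolyind: F => [|c m p _ _ IH]; first by rewrite mulr0 !linear0.
rewrite mulrDr -scalerAr !linearD !linearZ /= IH; congr (_ * _ + _).
by rewrite deriv_XM linearZ /= bd_XM.
Qed.

Lemma bd_x0 F : bd (x0 * F) = 0.
Proof.
elim/mpolyind: F => [|c m p _ _ IH]; first by rewrite mulr0 linear0.
rewrite mulrDr -scalerAr linearD linearZ /= IH addr0.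
rewrite /x0 mulrBl mul1r mulr_suml linearB /= linear_sum /= bdXE.
under eq_bigr do rewrite bd_XM.
rewrite -mulr_suml -mulrBl -natr_sum.
have -> : (\sum_(i < n) (m i).+1 = mdeg m + n)%N.
  rewrite (eq_bigr (fun i => (m i + 1)%N)) => [|i _]; last by rewrite addn1.
  by rewrite big_split /= sum1_card card_ord mdegE.
by rewrite subrr mul0r mulr0.
Qed.

(** [face (Some i)] drops the coordinate [i] and so carries the slanted face onto the face
    [x_i = 0]; after this composition [bd] integrates over any face. *)
Definition face (o : option 'I_n) : 'M[R]_n :=
  1%:M - oapp (fun i => delta_mx i i) 0 o.

Lemma comp_face i m : 'X_[m] \mPo affp 0 (face (Some i)) = (m i == 0%N)%:R *: ('X_[m] : poly).
Proof.
have tnthE j : tnth (affp 0 (face (Some i))) j = if j == i then 0 else 'X_j.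
  rewrite tnth_affp mxE mpolyC0 add0r (bigD1 j) //= /face !mxE eqxx big1 ?addr0.
    case: eqP => [_|_]; first by rewrite subrr scale0r.
    by rewrite subr0 scale1r.
  move=> l lj; rewrite !mxE eq_sym (negPf lj) sub0r.
  by case: eqP => [<-|_] /=; rewrite ?(negPf lj) oppr0 scale0r.
rewrite comp_mpolyX; under eq_bigr do rewrite tnthE.
case: eqP => [mi|/eqP mi]; last first.
  by rewrite scale0r (bigD1 i) //= eqxx expr0n (negPf mi) mul0r.
rewrite scale1r [RHS]mpolyXE_id; apply: eq_bigr => j _.
by case: eqP => [->|//]; rewrite mi !expr0.
Qed.

Lemma intD_deriv i F : intD (mderiv i F) = bd F - bd (F \mPo affp 0 (face (Some i))).
Proof.
elim/mpolyind: F => [|c m p _ _ IH]; first by rewrite !linear0 subrr.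
have cP f g : (c *: f + g) \mPo affp 0 (face (Some i)) =
   c *: (f \mPo affp 0 (face (Some i))) + (g \mPo affp 0 (face (Some i))) by rewrite linearP.
rewrite linearP [intD _]intD_is_linear IH cP !bd_is_linear.
rewrite opprD addrACA -mulrBr; congr (_ * _ + _).
rewrite comp_face -[_ *: _]addr0 bd_is_linear linear0 addr0 /=; case: eqP => [mi|/eqP mi].
  by rewrite mul1r subrr mderivX mi scale0r linear0.
rewrite mul0r subr0; pose m' := (m - U_(i))%MM.
have -> : m = (U_(i) + m')%MM.
  by apply/mnmP => l; rewrite mnmDE mnmBE mnm1E; case: eqP => [<-|] /=; move: mi; lia.
by rewrite mpolyXD intD_deriv_XM.
Qed.

Definition ideq (l f g : poly) := exists h, f - g = l * h.

Lemma comp_ideq k (p : {mpoly R[k]}) (t u : k.-tuple poly) l :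
  (forall j, ideq l (tnth t j) (tnth u j)) -> ideq l (p \mPo t) (p \mPo u).
Proof.
have idM a b a' b' : ideq l a b -> ideq l a' b' -> ideq l (a * a') (b * b').
  move=> [h e] [h' e']; exists (h * a' + b * h').
  by rewrite mulrDr mulrA -e mulrCA -e'; ring.
move=> h; elim/mpolyind: p => [|c m p _ _ [r e]].
  by exists 0; rewrite !comp_mpoly0 subrr mulr0.
have [r' e'] : ideq l ('X_[m] \mPo t) ('X_[m] \mPo u).
  rewrite !comp_mpolyX; apply: (big_ind2 (ideq l)) => [|a b a' b'|j _].
  - by exists 0; rewrite subrr mulr0.
  - exact: idM.
  elim: (m j) => [|d IH]; first by exists 0; rewrite !expr0 subrr mulr0.
  by rewrite !exprS; apply: idM.
exists (c *: r' + r); rewrite !comp_mpolyD !comp_mpolyZ mulrDr -e -scalerAr -e' scalerBr.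
by rewrite opprD addrACA.
Qed.

Lemma euler_affp k (p : {mpoly R[k]}) (b : 'cV[R]_k) (A : 'M[R]_(k, n)) :
  euler (p \mPo affp b A) =
  (\sum_(l < k) ('X_l - (b l 0)%:MP) * mderiv l p) \mPo affp b A.
Proof.
rewrite /euler linear_sum /=; under eq_bigr do rewrite mderiv_affp mulr_sumr.
rewrite exchange_big; apply: eq_bigr => l _ /=.
rewrite rmorphM rmorphB /= comp_mpolyC comp_mpolyXU -tnth_nth tnth_affp addrC addKr mulr_suml.
by apply: eq_bigr => j _; rewrite -scalerAl scalerAr.
Qed.

Definition bary (a : 'cV[R]_n) (o : option 'I_n) : R :=
  oapp (fun i => a i 0) (1 - \sum_i a i 0) o.
(** [affp a (cone a o)] sends the origin to [a] and the slanted face onto the face [o]; up to sign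
    its Jacobian is [bary a o]. *)
Definition cone (a : 'cV[R]_n) o : 'M[R]_n := face o - a *m const_mx 1.

Lemma tnth_cone a o i : tnth (affp a (cone a o)) i =
   tnth (affp 0 (face o)) i + (a i 0) *: x0.
Proof.
rewrite !tnth_affp !mxE mpolyC0 add0r /x0 scalerBr scaler_sumr addrCA.
rewrite -[_%:A]mul_mpolyC mulr1; congr (_ + _); rewrite -sumrN -big_split /=.
by apply: eq_bigr => j _; rewrite !mxE big_ord1 !mxE mulr1 scalerBl.
Qed.

(* Integrate [div ((x - a) F)] over the simplex and over the cones with apex [a]: only the faces opposite to [a] contribute. *)
Lemma intD_subdiv (a : 'cV[R]_n) q : (0 < n)%N ->
  intD q = \sum_(o : option 'I_n) bary a o * intD (q \mPo affp a (cone a o)).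
Proof.
(* [F] solves [div ((x - a) F) = q]: [euler + n] is inverted in coordinates centred at [a]. *)
move=> n0; pose F := einv n (q \mPo affp a 1%:M) \mPo affp (- a) 1%:M.
have qE : q = \sum_i ('X_i - (a i 0)%:MP) * mderiv i F + n%:R *: F.
  have -> : q = (q \mPo affp a 1%:M) \mPo affp (- a) 1%:M.
    by rewrite affp_comp mul1mx subrr mulmx1 affp_id.
  rewrite -[in LHS](@einvK _ _ n (q \mPo _)) // linearD linearZ; congr (_ + _).
  rewrite /euler linear_sum; apply: eq_bigr => i _ /=; rewrite rmorphM /= mderiv_affp; congr (_ * _).
    rewrite comp_mpolyXU -tnth_nth tnth_affp mxE mpolyCN addrC; congr (_ - _).
    rewrite (bigD1 i) //= mxE eqxx scale1r big1 ?addr0 // => j ji.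
    by rewrite mxE eq_sym (negPf ji) scale0r.
  rewrite (bigD1 i) //= mxE eqxx scale1r big1 ?addr0 // => j ji.
  by rewrite mxE (negPf ji) scale0r.
have qo o : intD (q \mPo affp a (cone a o)) = bd (F \mPo affp 0 (face o)).
  rewrite {1}qE linearD linearZ /= -euler_affp -/(bd _).
  have [h e] : ideq x0 (F \mPo affp a (cone a o)) (F \mPo affp 0 (face o)).
    apply: comp_ideq => i; exists (a i 0)%:MP.
    by rewrite tnth_cone addrC addKr -mul_mpolyC mulrC.
  by apply/eqP; rewrite -subr_eq0 -linearB /= e bd_x0.
under eq_bigr do rewrite qo.
have optE (G : option 'I_n -> R) : \sum_o G o = G None + \sum_i G (Some i).
  rewrite (bigD1 None) //=; congr (_ + _).
  rewrite (reindex_omap Some id) //=; last by case.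
  by apply: eq_bigl => i; rewrite eqxx.
rewrite optE /=.
have -> : face None = 1%:M by rewrite /face subr0.
rewrite affp_id {1}qE /= mulrBl mul1r mulr_suml -addrA -sumrN -big_split /=.
under [in RHS]eq_bigr do rewrite addrC -mulrBr -opprB mulrN -intD_deriv.
rewrite /bd /euler [in LHS](eq_bigr (fun i => 'X_i * mderiv i F - a i 0 *: mderiv i F)).
  rewrite sumrB addrAC [LHS]linearB /=; congr (_ + _).
  by rewrite linear_sum -sumrN; apply: eq_bigr => i _; rewrite linearZ.
by move=> i _; rewrite mulrBl mul_mpolyC.
Qed.

Lemma div_radial (G : poly) : \sum_i mderiv i ('X_i * G) = n%:R *: G + euler G.
Proof.
rewrite /euler -[X in X%:R]card_ord -sum1_card natr_sum scaler_suml -big_split.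
apply: eq_bigr => i _ /=; rewrite mderivM mderivX mnm1E eqxx.
rewrite (_ : (U_(i) - U_(i))%MM = 0%MM) ?mpolyX0 ?scale1r ?mul1r //.
by apply/mnmP => l; rewrite mnmBE subnn mnm0E.
Qed.

Lemma intD_div_tangent (V : 'I_n -> poly) c :
  (forall i, exists r, V i = 'X_i * r) -> \sum_i V i = x0 * c ->
  intD (\sum_i mderiv i (V i)) = 0.
Proof.
move=> hV e; rewrite linear_sum /= (eq_bigr (fun i => bd (V i))).
  by have := bd_x0 c; rewrite -e [bd _]linear_sum.
by move=> i _; have [r ->] := hV i; rewrite intD_deriv_XM.
Qed.

Lemma eulerM f g : euler (f * g) = euler f * g + f * euler g.
Proof.
rewrite /euler mulr_suml mulr_sumr -big_split; apply: eq_bigr => i _ /=.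
by rewrite mderivM; ring.
Qed.

Lemma euler_x0 : euler x0 = x0 - 1.
Proof.
have e1 : euler (1 : poly) = 0 by rewrite -mpolyX0 eulerX mdeg0 scale0r.
have es : euler (\sum_(i < n) 'X_i : poly) = \sum_(i < n) 'X_i.
  by rewrite [LHS]linear_sum; apply: eq_bigr => i _ /=; rewrite eulerX mdeg1 scale1r.
by rewrite /x0 [LHS]linearB /= e1 es sub0r addrC addKr.
Qed.

(** Integrate the divergence of [x x0 F^2], a field tangent to all faces, and eliminate [euler F]
    through [euler F = f - c F]. *)
Lemma intD_hardy_id (c : R) F f : euler F + c *: F = f ->
  intD (((n%:R + 1 - c *+ 2)%:MP * x0 - 1) * (F * F) + (x0 * (F * f)) *+ 2) = 0.
Proof.
move=> e; pose G := x0 * (F * F).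
have : intD (\sum_i mderiv i ('X_i * G)) = 0.
  apply: (@intD_div_tangent (fun i => 'X_i * G) ((\sum_i 'X_i) * (F * F))).
    by move=> i; exists G.
  by rewrite -mulr_suml /G mulrCA.
rewrite div_radial /G !eulerM euler_x0 => <-; congr intD.
have -> : euler F = f - c *: F by rewrite -e addrK.
rewrite -!mul_mpolyC !rmorphB rmorphD rmorphMn /= mpolyC1; ring.
Qed.

Lemma meval_x0 (x : 'I_n -> R) : x0.@[x] = 1 - \sum_i x i.
Proof.
by rewrite mevalB meval1 [X in _ - X = _]raddf_sum; congr (_ - _); apply: eq_bigr => i _ /=; rewrite mevalXU.
Qed.

(** The weights may sum to less than one; the slack is the missing mass times the squared weighted
    sum. *)
Lemma simplex_var (x p : 'I_n -> R) : simplex x ->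
  \sum_i x i * (p i - \sum_j x j * p j) ^+ 2 <= \sum_i x i * p i ^+ 2 - (\sum_j x j * p j) ^+ 2.
Proof.
move=> [xp x1]; set mu := \sum_j x j * p j.
rewrite (eq_bigr (fun i => x i * p i ^+ 2 - x i * p i * (mu *+ 2) + x i * mu ^+ 2)).
  rewrite big_split sumrB -!mulr_suml -/mu /=; have := sqr_ge0 mu; nra.
by move=> i _; ring.
Qed.

Lemma simplex_jensen (x p : 'I_n -> R) : simplex x ->
  (\sum_j x j * p j) ^+ 2 <= \sum_i x i * p i ^+ 2.
Proof.
move=> xs; rewrite -subr_ge0; apply: le_trans (simplex_var p xs); apply: sumr_ge0 => i _.
by rewrite mulr_ge0 ?sqr_ge0 //; case: xs.
Qed.

Lemma simplex_le1 (x : 'I_n -> R) i : simplex x -> x i <= 1.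
Proof.
move=> [x0 x1]; apply: le_trans x1; rewrite (bigD1 i) //= lerDl; exact: sumr_ge0.
Qed.

End Calculus.

(** * A Riesz representation lemma *)

Section Riesz.
Variables (R : fieldType) (V : lmodType R).
Implicit Types (s : seq V) (u v w : V) (c : R).

Definition inspan s u := exists c : nat -> R, u = \sum_(i < size s) c i *: s`_i.

Lemma inspan_cons e s u : inspan (e :: s) u <-> exists c v, inspan s v /\ u = c *: e + v.
Proof.
split=> [[c ->]|[c [v [[d ->] ->]]]].
  exists (c 0%N), (\sum_(i < size s) c i.+1 *: s`_i); split; first by exists (c \o S).
  by rewrite big_ord_recl.
by exists (fun i => if i is j.+1 then d j else c); rewrite big_ord_recl.
Qed.

Lemma inspanP s c u v : inspan s u -> inspan s v -> inspan s (c *: u + v).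
Proof.
move=> [a ->] [b ->]; exists (fun i => c * a i + b i).
rewrite scaler_sumr -big_split; apply: eq_bigr => i _ /=.
by rewrite scalerDl scalerA.
Qed.

Lemma inspan0 s : inspan s 0.
Proof. by exists (fun=> 0); rewrite big1 // => i _; rewrite scale0r. Qed.

Lemma inspan_mem s u : u \in s -> inspan s u.
Proof.
move=> us; have is_ : (index u s < size s)%N by rewrite index_mem.
exists (fun i => (i == index u s)%:R).
rewrite (bigD1 (Ordinal is_)) //= eqxx scale1r nth_index // big1 ?addr0 // => i.
by rewrite -val_eqE /= => /negPf ->; rewrite scale0r.
Qed.

Lemma inspan_sum s (I : Type) (r : seq I) (P : pred I) (F : I -> V) :
  (forall i, P i -> inspan s (F i)) -> inspan s (\sum_(i <- r | P i) F i).
Proof.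
move=> h; apply: (big_ind (inspan s)) => //; first exact: inspan0.
by move=> u v hu hv; rewrite -[u]scale1r; apply: inspanP.
Qed.

Lemma inspanZ s c u : inspan s u -> inspan s (c *: u).
Proof. by move=> h; rewrite -[_ *: _]addr0; apply: inspanP => //; apply: inspan0. Qed.

Definition subspace (K : V -> Prop) := K 0 /\ forall c u v, K u -> K v -> K (c *: u + v).

Variable b : V -> V -> R.
Hypothesis bl : forall c u v w, b (c *: u + v) w = c * b u w + b v w.
Hypothesis bC : forall u v, b u v = b v u.

(** Gram-Schmidt along a finite spanning list, for a subspace given only as a predicate. The form
    may be degenerate, provided null vectors lie in its radical and in the kernel of [l]; this is
    needed for the curl energy, which does not see gradients. *)
Lemma riesz s (K : V -> Prop) (l : V -> R) :
  subspace K -> (forall k, K k -> inspan s k) ->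
  (forall c u v, l (c *: u + v) = c * l u + l v) ->
  (forall k, K k -> b k k = 0 -> l k = 0 /\ forall k', K k' -> b k k' = 0) ->
  exists2 v, K v & forall k, K k -> b v k = l k.
Proof.
have br c u v w : b w (c *: u + v) = c * b w u + b w v by rewrite bC bl !(bC _ w).
elim: s K l => [|e s IH] K l [K0 KP] Ks ll bK.
  have l0 : l 0 = 0 by have := ll (-1) 0 0; rewrite scaler0 addr0 => ->; rewrite mulN1r addNr.
  exists 0 => // k /Ks [c]; rewrite big_ord0 => ->.
  by have := bl (-1) 0 0 0; rewrite scaler0 addr0 l0 => ->; rewrite mulN1r addNr.
pose K' k := K k /\ inspan s k.
have sK' : subspace K'.
  split=> [|c u v [Ku us] [Kv vs]]; first by split=> //; apply: inspan0.
  by split; [apply: KP|apply: inspanP].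
have bK' (l' : V -> R) : (forall k, K k -> b k k = 0 -> l' k = 0) ->
    forall k, K' k -> b k k = 0 -> l' k = 0 /\ forall k', K' k' -> b k k' = 0.
  move=> h k [Kk _] bk; split; first exact: h.
  by move=> k' [Kk' _]; have [_] := bK _ Kk bk; apply.
have [v' K'v' hv'] := IH K' l sK' (fun k h => h.2) ll (bK' l (fun k Kk bk => (bK k Kk bk).1)).
have Kv' := K'v'.1.
(* Either every element of [K] lies in the span of the tail, or some [k0] has a nonzero coefficient
   on [e]. *)
have [[k0 [Kk0 [c [r [rs [c0 ek0]]]]]]|no] := pselect (exists k0, K k0 /\
   exists c r, inspan s r /\ c != 0 /\ k0 = c *: e + r); last first.
  exists v' => // k Kk; apply: hv'; split=> //.
  have /inspan_cons [c [r [rs ek]]] := Ks _ Kk.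
  have [c0|c0] := eqVneq c 0; first by rewrite ek c0 scale0r add0r.
  by case: no; exists k; split=> //; exists c, r.
have [p [Kp ps] hp] : exists2 p, K' p & forall k, K' k -> b p k = b k0 k.
  apply: (IH K' (b k0) sK') => [k []//|*|]; first exact: br.
  by apply: bK' => k Kk bk; rewrite bC; have [_] := bK _ Kk bk; apply.
(* Since [p] represents [b k0] on [K'], the difference [k1] is orthogonal to [K'], and together they
   span [K]. *)
pose k1 := (-1) *: p + k0.
have Kk1 : K k1 by apply: KP.
have k1K' k : K' k -> b k1 k = 0 by move=> hk; rewrite bl hp // mulN1r addNr.
have dec k : K k -> exists a k', K' k' /\ k = a *: k1 + k'.
  move=> Kk; have /inspan_cons [d [r' [rs' ek]]] := Ks _ Kk.
  exists (d / c), ((- (d / c)) *: k1 + k); split; last by rewrite scaleNr addNKr.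
  split; first exact: KP.
  have -> : (- (d / c)) *: k1 + k = (d / c) *: p + ((- (d / c)) *: r + r'); last first.
    by apply: inspanP => //; apply: inspanP.
  rewrite ek /k1 ek0 !scalerDr !scalerA !mulNr divfK // mulrN1 opprK -addrA; congr (_ + _).
  by rewrite addrACA scaleNr addNr add0r.
clearbody k1; have [bk1|bk1] := eqVneq (b k1 k1) 0.
  have [lk1 bk1'] := bK _ Kk1 bk1.
  exists v' => // k /dec [a [k' [Kk' ->]]].
  by rewrite br bC bk1' // mulr0 add0r ll lk1 mulr0 add0r hv'.
exists ((l k1 / b k1 k1) *: k1 + v'); first exact: KP.
move=> k /dec [a [k' [Kk' ->]]]; rewrite br !bl ll (k1K' _ Kk') mulr0 add0r (hv' _ Kk') divfK //.
have -> : b v' k1 = 0 by rewrite bC k1K'.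
by rewrite addr0.
Qed.

End Riesz.

(** * Finite spanning families of polynomials and forms *)

Section PolySpan.
Variables (R : realType) (n : nat).

Lemma inspan_poly k (f : {mpoly R[n]}) : (msize f <= k)%N ->
  inspan [seq 'X_[m] | m : 'X_{1..n < k}] f.
Proof.
move=> fk; rewrite (mpolywE fk); apply: inspan_sum => m _; apply/inspanZ/inspan_mem.
by apply/mapP; exists m => //; rewrite mem_enum.
Qed.

Lemma inspan_form (T : finType) k (f : {ffun T -> {mpoly R[n]}}) :
  (forall t, msize (f t) <= k)%N ->
  inspan [seq [ffun t => if t == tm.1 then 'X_[tm.2] else 0] | tm : T * 'X_{1..n < k}] f.
Proof.
move=> fk; have -> : f = \sum_(t : T) \sum_(m : 'X_{1..n < k})
    (f t)@_m *: [ffun t' => if t' == t then 'X_[m] else 0].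
  apply/ffunP => t; rewrite sum_ffunE (bigD1 t) //= [X in _ + X]big1 ?addr0.
    by rewrite sum_ffunE {1}(mpolywE (fk t)); apply: eq_bigr => m _; rewrite !ffunE eqxx.
  by move=> i it; rewrite sum_ffunE big1 // => m _; rewrite !ffunE eq_sym (negPf it) scaler0.
apply: inspan_sum => t _; apply: inspan_sum => m _; apply/inspanZ/inspan_mem.
by apply/mapP; exists (t, m) => //; rewrite mem_enum.
Qed.

End PolySpan.

(** * Potentials with zero trace: top-degree forms *)

Section Jacobi.
Variables (R : realType) (n : nat).
Local Notation poly := {mpoly R[n]}.
Implicit Types f g w : poly.

(* The field [B grad f] for [B = diag x - x x^T]; it is tangent to all faces of the simplex. *)
Definition jfield f (i : 'I_n) : poly := 'X_i * (mderiv i f - euler f).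
Definition jacobi f : poly := \sum_i mderiv i (jfield f i).
Definition jform f g : poly := \sum_i 'X_i * mderiv i f * mderiv i g - euler f * euler g.

Lemma jfield_sum f : \sum_i jfield f i = x0 R n * euler f.
Proof.
rewrite /jfield; under eq_bigr do rewrite mulrBr.
by rewrite sumrB -mulr_suml /x0 mulrBl mul1r.
Qed.

Lemma jacobiE f : jacobi f = \sum_i mderiv i ('X_i * mderiv i f) - (n%:R *: euler f + euler (euler f)).
Proof.
rewrite -div_radial -sumrB; apply: eq_bigr => i _.
by rewrite /jfield mulrBr linearB.
Qed.

Lemma jacobi_is_linear : linear jacobi.
Proof.
move=> c f g; rewrite /jacobi scaler_sumr -big_split; apply: eq_bigr => i _ /=.
rewrite -linearP; congr mderiv; rewrite /jfield !linearP /=.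
by rewrite addrACA -scalerDr mulrDr scalerAr.
Qed.
HB.instance Definition _ := GRing.isLinear.Build R poly poly _ jacobi jacobi_is_linear.

(** No boundary term arises because [f] times the field of [g] is tangent to the faces, whatever [f]
    is. *)
Lemma intD_jacobi f g : intD (f * jacobi g) = - intD (jform f g).
Proof.
apply/eqP; rewrite -addr_eq0 -linearD /=; apply/eqP.
rewrite -[RHS](@intD_div_tangent _ _ (fun i => f * jfield g i) (f * euler g)).
- congr intD; rewrite /jacobi /jform mulr_sumr [in RHS](eq_bigr (fun i =>
     f * mderiv i (jfield g i) + mderiv i f * jfield g i)) => [|i _]; last by rewrite mderivM addrC.
  rewrite big_split /=; congr (_ + _).
  rewrite {1}/euler mulr_suml -sumrB; apply: eq_bigr => i _; rewrite /jfield; ring.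
- by move=> i; exists (f * (mderiv i g - euler g)); rewrite /jfield mulrCA.
- by rewrite -mulr_sumr jfield_sum mulrCA.
Qed.

Lemma jformC f g : jform f g = jform g f.
Proof.
rewrite /jform [euler f * _]mulrC; congr (_ - _); apply: eq_bigr => i _; ring.
Qed.

Lemma intD_jacobiC f g : intD (f * jacobi g) = intD (g * jacobi f).
Proof. by rewrite !intD_jacobi jformC. Qed.

(** The terms [mderiv i ('X_i * mderiv i f)] lower the degree; on degree [r] the rest,
    [n euler + euler^2], is multiplication by [r (r + n)]. *)
Lemma mcoeff_jacobi_top r f : (msize f <= r.+1)%N ->
  (msize (jacobi f + (r * (r + n))%:R *: f)%R <= r)%N.
Proof.
move=> fr; rewrite jacobiE -addrA; apply: msizeD.
  by apply: msize_sumk => i _; apply: (@msize_deriv _ _ r.+1); exact: msize_XM (msize_deriv _ fr).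
apply/msize_leP => m rm; rewrite mcoeffD mcoeffN mcoeffD !mcoeffZ !mcoeff_euler.
have [e|ne] := eqVneq (mdeg m) r.
  by rewrite e natrM natrD; ring.
have /msize_leP -> := fr; first by rewrite !mulr0 !addr0 oppr0.
by rewrite ltn_neqAle eq_sym ne.
Qed.

Lemma msize_jacobi r f : (msize f <= r)%N -> (msize (jacobi f) <= r)%N.
Proof.
case: r => [|r] fr; first by rewrite (msize_le0 fr) linear0 mmeasure0.
have := mcoeff_jacobi_top fr; set c := _%:R => h.
rewrite -[jacobi f](addrK (c *: f)); apply: msizeB; last exact: msizeZk.
exact: leq_trans h _.
Qed.

Lemma intD_proj r f : exists2 g, (msize g <= r)%N &
  forall h, (msize h <= r)%N -> intD ((f - g) * h) = 0.
Proof.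
pose b (u v : poly) := intD (u * v).
have bl c u v w : b (c *: u + v) w = c * b u w + b v w.
  by rewrite /b mulrDl -scalerAl linearP.
have bC u v : b u v = b v u by rewrite /b mulrC.
have [|||g gr gh] := @riesz _ _ b bl bC _ (fun h => is_true (msize h <= r)%N) (b f) _ (@inspan_poly R n r).
- by split; [rewrite mmeasure0|move=> c u v ur vr; apply: msizeD => //; apply: msizeZk].
- by move=> c u v; rewrite ![b f _]bC bl.
- move=> k _ /intD_sq_eq0 ->; rewrite /b mulr0 linear0; split=> // k' _.
  by rewrite mul0r linear0.
exists g => // h hr; have := gh h hr; rewrite /b mulrBl linearB /= => ->.
by rewrite subrr.
Qed.

(* On the orthogonal complement of degree [< r] in degree [<= r] the operator is the scalar [- r (r + n)]. *)
Lemma jacobi_solve r w : (msize w <= r)%N -> intD w = 0 ->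
  exists f, [/\ (msize f <= r)%N, jacobi f = w & - intD (f * w) <= intD (w * w)].
Proof.
elim: r w => [|r IH] w wr w0.
  exists 0; rewrite (msize_le0 wr) mmeasure0 !mul0r linear0 /= ?linear0 oppr0; split=> //.
have [w' w'r ort] := intD_proj r w.
set v := w - w' in ort; have ew : w = v + w' by rewrite subrK.
have vr : (msize v <= r.+1)%N by apply: msizeB => //; apply: leqW.
(* In degree zero the eigenvalue is zero; there the zero mean forces [w = 0]. *)
case: r => [|r] in IH wr w'r ort vr *.
  have e : w = (w@_0%MM)%:MP by apply: msize1_polyC.
  move: w0; rewrite e intDC => /eqP; rewrite mulf_eq0 invr_eq0 (negPf (factnz _ _)) orbF => /eqP ->.
  by exists 0; rewrite mpolyC0 mmeasure0 !mul0r linear0 /= ?linear0 oppr0; split=> //.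
have w'0 : intD w' = 0.
  have := ort 1; rewrite msize1 mulr1 => /(_ isT) v0.
  by move: w0; rewrite {1}ew linearD /= v0 add0r.
have [f' [f'r jf' nf']] := IH w' w'r w'0.
pose la : R := (r.+1 * (r.+1 + n))%:R.
have la1 : 1 <= la by rewrite /la ler1n muln_gt0 addn_gt0.
have la0 : la != 0 by rewrite gt_eqF // (lt_le_trans ltr01).
(* The residual has lower degree and, by symmetry of the operator, is orthogonal to all polynomials
   of lower degree, hence to itself. *)
have jv : jacobi v = - (la *: v).
  apply/eqP; rewrite -addr_eq0; apply/eqP; set z := _ + _.
  have zr : (msize z <= r.+1)%N by apply: mcoeff_jacobi_top.
  have zort h : (msize h <= r.+1)%N -> intD (z * h) = 0.
    move=> hr; rewrite /z mulrDl linearD /= mulrC intD_jacobiC ort ?msize_jacobi // add0r.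
    by rewrite -scalerAl linearZ /= ort ?mulr0.
  by apply: intD_sq_eq0; apply: zort.
exists (f' - la^-1 *: v); split.
- by apply: msizeB; [apply: leqW|apply: msizeZk].
- by rewrite linearB linearZ /= jf' jv scalerN scalerA mulVf // scale1r opprK addrC -ew.
have vw' : intD (v * w') = 0 by apply: ort.
have f'v : intD (f' * v) = 0 by rewrite mulrC; apply: ort.
clearbody v; rewrite ew.
have -> : (f' - la^-1 *: v) * (v + w') = f' * v + f' * w' - la^-1 *: (v * v + v * w').
  by rewrite mulrBl -scalerAl !mulrDr.
have -> : (v + w') * (v + w') = v * v + v * w' + (v * w' + w' * w') by ring.
rewrite intD_sub intD_scale !intD_add f'v vw' !(add0r, addr0).
have v2 := intD_sq_ge0 v.
have : la^-1 * intD (v * v) <= intD (v * v).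
  by rewrite ler_piMl // invf_le1 // (lt_le_trans ltr01).
by move=> h; rewrite opprB; apply: lerD h nf'.
Qed.

(** With [p] the gradient and [mu] its sum weighted by [x], the field is [x_i (p_i - mu)];
    [x_i^2 <= x_i] reduces the claim to [simplex_var]. *)
Lemma jform_ge f (x : 'I_n -> R) : simplex x ->
  (\sum_i jfield f i * jfield f i).@[x] <= (jform f f).@[x].
Proof.
move=> xs; pose p i := (mderiv i f).@[x].
have eE : (euler f).@[x] = \sum_i x i * p i.
  by rewrite raddf_sum; apply: eq_bigr => i _ /=; rewrite mevalM mevalXU.
have -> : (jform f f).@[x] = \sum_i x i * p i ^+ 2 - (\sum_j x j * p j) ^+ 2.
  rewrite mevalB mevalM eE -expr2 raddf_sum; congr (_ - _); apply: eq_bigr => i _ /=.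
  by rewrite !mevalM mevalXU expr2 mulrA.
apply: le_trans (simplex_var p xs); rewrite raddf_sum; apply: ler_sum => i _ /=.
rewrite !mevalM mevalXU mevalB eE -/(p i) -expr2 exprMn expr2 -mulrA.
have x0 : 0 <= x i by case: xs.
rewrite ler_wpM2l // ler_piMl ?sqr_ge0 //; exact: simplex_le1.
Qed.

Lemma jacobi_field r w : (msize w <= r)%N -> intD w = 0 ->
  exists f, [/\ (msize f <= r)%N, jacobi f = w &
     \sum_i intD (jfield f i * jfield f i) <= intD (w * w)].
Proof.
move=> wr w0; have [f [fr jf nf]] := jacobi_solve wr w0; exists f; split=> //.
apply: le_trans nf; rewrite -{1}jf intD_jacobi opprK -linear_sum.
by apply: intD_le => x; apply: jform_ge.
Qed.

End Jacobi.

(** * Zero traces, Stokes and Friedrichs *)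

Section Norm.
Variables (R : realType) (n : nat).
Implicit Types (w u : dform R n).

Definition n2 w : R := \sum_(I : {set 'I_n}) intD (w I * w I).

Lemma n2_ge0 w : 0 <= n2 w.
Proof. by apply: sumr_ge0 => I _; apply: intD_sq_ge0. Qed.

Lemma n2_mem w I : intD (w I * w I) <= n2 w.
Proof. by rewrite /n2 (bigD1 I) //= lerDl; apply: sumr_ge0 => J _; apply: intD_sq_ge0. Qed.

Lemma sqr_sum_le (T : finType) (a : T -> R) : (\sum_t a t) ^+ 2 <= #|T|%:R * \sum_t a t ^+ 2.
Proof.
have : 0 <= \sum_s \sum_t (a s - a t) ^+ 2 by do 2!apply: sumr_ge0 => ? _; apply: sqr_ge0.
have -> : \sum_s \sum_t (a s - a t) ^+ 2 =
   (#|T|%:R * \sum_t a t ^+ 2 - (\sum_t a t) ^+ 2) *+ 2.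
  set S := \sum_t a t; set S2 := \sum_t a t ^+ 2.
  have e s : \sum_t (a s - a t) ^+ 2 = #|T|%:R * a s ^+ 2 - a s * (S *+ 2) + S2.
    rewrite (eq_bigr (fun t => a s ^+ 2 - a s *+ 2 * a t + a t ^+ 2)) => [|t _]; last by ring.
    by rewrite big_split sumrB /= sumr_const mulr_natl -mulr_sumr mulrnAl -mulrnAr.
  under eq_bigr do rewrite e.
  rewrite big_split sumrB /= -mulr_sumr -/S2 -mulr_suml sumr_const -/S mulr_natl; ring.
by rewrite pmulrn_lge0 // subr_ge0.
Qed.

Lemma intD_sqr_sum_le (T : finType) (f : T -> {mpoly R[n]}) :
  intD ((\sum_t f t) * (\sum_t f t)) <= #|T|%:R * \sum_t intD (f t * f t).
Proof.
rewrite -intD_sum -intD_scale; apply: intD_le => x _.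
rewrite mevalZ mevalM raddf_sum raddf_sum -expr2 /=.
by under [in leRHS]eq_bigr do rewrite mevalM -expr2; apply: sqr_sum_le.
Qed.

Lemma n2_sum (T : finType) (F : T -> dform R n) :
  n2 (\sum_t F t) <= #|T|%:R * \sum_t n2 (F t).
Proof.
rewrite /n2 exchange_big /= mulr_sumr; apply: ler_sum => I _.
by rewrite sum_ffunE; apply: intD_sqr_sum_le.
Qed.

Lemma n2_io i w : n2 (io i w) <= #|{set 'I_n}|%:R * n2 w.
Proof.
rewrite mulr_natl -sumr_const; apply: ler_sum => I _; rewrite ffunE.
case: ifP => _; first by rewrite mulr0 linear0 n2_ge0.
rewrite -scalerAl -scalerAr scalerA sgn_sq scale1r; exact: n2_mem.
Qed.

Lemma sum_set1_le (F : {set 'I_n} -> R) : (forall I, 0 <= F I) ->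
  \sum_i F [set i] <= \sum_I F I.
Proof.
move=> F0; have inj1 : {in setT &, injective (fun i : 'I_n => [set i])}.
  by move=> i j _ _ /set1_inj.
rewrite [leRHS](bigID (fun I => I \in [set [set i] | i in [set: 'I_n]])) /=.
rewrite (big_imset _ inj1) /= [X in _ <= X + _](_ : _ = \sum_i F [set i]).
  by rewrite lerDl sumr_ge0.
by apply: eq_bigl => i; rewrite inE.
Qed.

End Norm.

Section Boundary.
Variables (R : realType) (n : nat).
Local Notation form := (dform R n).
Local Notation poly := {mpoly R[n]}.
Implicit Types (w u z a : form).

(* A form has zero trace on the hyperplane [l = 0] iff [dl /\ w] is divisible by [l]; here [l] ranges over the barycentric coordinates of the unit simplex. *)
Definition Ztr w : Prop := (forall i, exists z, ew i w = mf 'X_i z) /\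
  (exists z, \sum_i ew i w = mf (x0 R n) z).

Lemma ZtrP c u w : Ztr u -> Ztr w -> Ztr (c *: u + w).
Proof.
move=> [hu [zu eu]] [hw [zw ew_]]; split=> [i|].
  have [z1 e1] := hu i; have [z2 e2] := hw i; exists (c *: z1 + z2).
  by rewrite !linearP /= e1 e2.
exists (c *: zu + zw); rewrite linearP /= -eu -ew_ scaler_sumr -big_split.
by apply: eq_bigr => i _ /=; rewrite linearP.
Qed.

Lemma Ztr0 : Ztr 0.
Proof.
split=> [i|]; first by exists 0; rewrite !linear0.
by exists 0; rewrite linear0 big1 // => i _; rewrite linear0.
Qed.

Definition wedge1 (c : 'I_n -> R) w : form := \sum_j c j *: ew j w.

Lemma wedge1_is_linear c : linear (wedge1 c).
Proof.
move=> a u w; rewrite /wedge1 scaler_sumr -big_split; apply: eq_bigr => j _ /=.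
by rewrite linearP scalerDr !scalerA mulrC.
Qed.
HB.instance Definition _ c := GRing.isLinear.Build R _ _ _ (wedge1 c) (wedge1_is_linear c).

Lemma wedge1_delta i w : wedge1 (fun j => (j == i)%:R) w = ew i w.
Proof.
rewrite /wedge1 (bigD1 i) //= eqxx scale1r big1 ?addr0 // => j /negPf ->.
by rewrite scale0r.
Qed.

Lemma wedge1_N1 w : wedge1 (fun=> -1) w = - \sum_i ew i w.
Proof. by rewrite /wedge1 -sumrN; apply: eq_bigr => i _; rewrite scaleN1r. Qed.

Lemma wedge1_sq c w : wedge1 c (wedge1 c w) = 0.
Proof.
rewrite {1}/wedge1 -[RHS](@anti_sum0 R n (fun i j => (c i * c j) *: ew i (ew j w))) => [|i j].
  apply: eq_bigr => i _; rewrite linear_sum scaler_sumr; apply: eq_bigr => j _ /=.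
  by rewrite linearZ scalerA.
by rewrite ewC scalerN mulrC.
Qed.

Lemma mf_wedge1 f c w : mf f (wedge1 c w) = wedge1 c (mf f w).
Proof. by rewrite linear_sum; apply: eq_bigr => j _; rewrite linearZ /= mf_ew. Qed.

(** Let [theta = dl]. Wedging the hypothesis with [theta] gives [l (theta /\ z) = 0], so
    [theta /\ z = 0]; differentiating [theta /\ w = l z] then leaves only a multiple of [l]. *)
Lemma wedge1_extd c (l : poly) w z : l != 0 -> (forall j, mderiv j l = (c j)%:MP) ->
  wedge1 c w = mf l z -> exists z', wedge1 c (extd w) = mf l z'.
Proof.
move=> l0 dl e.
have cz : wedge1 c z = 0.
  have : mf l (wedge1 c z) = 0.
    by rewrite mf_wedge1 -e wedge1_sq.
  move=> /ffunP h; apply/ffunP => I; have := h I; rewrite !ffunE => /eqP.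
  by rewrite mulf_eq0 (negPf l0) => /eqP.
exists (- extd z); transitivity (- extd (wedge1 c w)).
  rewrite /wedge1 linear_sum -sumrN; apply: eq_bigr => j _ /=.
  rewrite linearZ -scalerN /=; congr (_ *: _); rewrite !extdE linear_sum -sumrN.
  by apply: eq_bigr => i _ /=; rewrite pd_ew ewC.
rewrite e linearN; congr (- _).
rewrite extdE; under eq_bigr do rewrite pd_mf dl mfC linearD linearZ /= -mf_ew.
by rewrite big_split /= -/(wedge1 c z) cz add0r -linear_sum -extdE.
Qed.

Lemma x0_neq0 : x0 R n != 0.
Proof.
apply/eqP => e; have := meval_x0 (fun _ : 'I_n => 0 : R); rewrite e meval0 big1 // subr0 => /eqP.
by rewrite eq_sym oner_eq0.
Qed.

Lemma mderivXi i j : mderiv j ('X_i : poly) = ((j == i)%:R)%:MP.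
Proof.
rewrite mderivX mnm1E eq_sym; case: eqP => [->|_]; last by rewrite scale0r mpolyC0.
rewrite scale1r (_ : (_ - _)%MM = 0%MM) ?mpolyX0 //.
by apply/mnmP => l; rewrite mnmBE subnn mnm0E.
Qed.

Lemma mderiv_x0 j : mderiv j (x0 R n) = (-1 : R)%:MP.
Proof.
have -> : mderiv j (x0 R n) = mderiv j 1 - \sum_i mderiv j 'X_i.
  by rewrite /x0 mderivB [X in _ - X = _]raddf_sum.
rewrite -mpolyC1 mderivC sub0r (bigD1 j) //= mderivXi eqxx big1 ?addr0 ?mpolyCN //.
by move=> i ij; rewrite mderivXi eq_sym (negPf ij) mpolyC0.
Qed.

Lemma Xi_neq0 i : ('X_i : poly) != 0.
Proof. by rewrite -(mmeasure_poly_eq0 mdeg) msizeXi. Qed.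

Lemma Ztr_extd w : Ztr w -> Ztr (extd w).
Proof.
move=> [hX [z h0]]; split=> [i|].
  have [zi e] := hX i.
  have [|z' e'] := @wedge1_extd _ _ w zi (Xi_neq0 i) (mderivXi i).
    by rewrite wedge1_delta.
  by exists z'; rewrite -wedge1_delta.
have [|z' e'] := @wedge1_extd _ _ w (- z) x0_neq0 mderiv_x0; first by rewrite wedge1_N1 h0 linearN.
by exists (- z'); rewrite linearN /= -e' wedge1_N1 opprK.
Qed.

Definition proxy w (i : 'I_n) : poly := ew i w setT.

Lemma proxy_extd w : extd w setT = \sum_i mderiv i (proxy w i).
Proof.
rewrite extdE sum_ffunE; apply: eq_bigr => i _.
by rewrite -pd_ew ffunE.
Qed.

Lemma Ztr_proxy w : Ztr w -> (forall i, exists r, proxy w i = 'X_i * r) /\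
  exists c, \sum_i proxy w i = x0 R n * c.
Proof.
move=> [hX [z h0]]; split=> [i|].
  by have [zi e] := hX i; exists (zi setT); rewrite /proxy e ffunE.
by exists (z setT); have := congr1 (fun w : form => w setT) h0; rewrite sum_ffunE ffunE.
Qed.

Lemma stokes w : Ztr w -> intD (extd w setT) = 0.
Proof.
by move=> /Ztr_proxy [hX [c h0]]; rewrite proxy_extd (intD_div_tangent hX h0).
Qed.

Lemma pure0E w : pure 0 w -> w = fdelta set0 (w set0).
Proof.
move=> w0; apply/ffunP => I; rewrite ffunE; case: eqP => [->//|/eqP I0].
by rewrite w0 // cards_eq0.
Qed.

Lemma sgn_set0 (i : 'I_n) : sgn R set0 i = 1.
Proof.
rewrite /sgn (_ : #|_| = 0%N) //; apply/eqP; rewrite cards_eq0.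
by apply/eqP/setP => k; rewrite !inE.
Qed.

Lemma ew_fdelta0 (i : 'I_n) (f : poly) j : ew i (fdelta set0 f) [set j] = if i == j then f else 0.
Proof.
rewrite !ffunE inE; case: eqP => [->|_] //.
by rewrite setDv eqxx sgn_set0 scale1r.
Qed.

Lemma mf_fdelta0 (f g : poly) : mf f (fdelta set0 g) = fdelta set0 (f * g) :> form.
Proof. by apply/ffunP => I; rewrite !ffunE; case: eqP => _; rewrite ?mulr0. Qed.

Lemma Ztr_fdelta0 (f : poly) : (0 < n)%N -> Ztr (fdelta set0 f) <->
  (forall i : 'I_n, exists g, f = 'X_i * g) /\ exists g, f = x0 R n * g.
Proof.
move=> n0; split=> [[hX [z h0]]|[hX [g h0]]]; split.
- move=> i; have [zi e] := hX i; exists (zi [set i]).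
  by have := congr1 (fun w : form => w [set i]) e; rewrite /= ew_fdelta0 eqxx ffunE.
- pose i := Ordinal n0; exists (z [set i]).
  have := congr1 (fun w : form => w [set i]) h0.
  rewrite /= sum_ffunE (bigD1 i) //= ew_fdelta0 eqxx.
  by rewrite big1 ?addr0 ?ffunE // => j ji; rewrite ew_fdelta0 (negPf ji).
- move=> i; have [gi ->] := hX i; exists (ew i (fdelta set0 gi)).
  by rewrite mf_ew mf_fdelta0.
- exists (\sum_i ew i (fdelta set0 g)).
  by rewrite linear_sum; apply: eq_bigr => i _; rewrite /= mf_ew mf_fdelta0 h0.
Qed.

Lemma extd_fdelta0 (f : poly) i : extd (fdelta set0 f : form) [set i] = mderiv i f.
Proof.
rewrite extdE sum_ffunE (bigD1 i) //= big1 ?addr0 => [|j ji].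
  rewrite (_ : pd i _ = fdelta set0 (mderiv i f)) ?ew_fdelta0 ?eqxx //.
  by apply/ffunP => I; rewrite !ffunE; case: eqP => _; rewrite ?linear0.
rewrite (_ : pd j _ = fdelta set0 (mderiv j f)) ?ew_fdelta0 ?(negPf ji) //.
by apply/ffunP => I; rewrite !ffunE; case: eqP => _; rewrite ?linear0.
Qed.

(** Only the slanted face enters: [f] vanishes there, so [div (x f^2)] has zero integral and
    [n |f|^2 = - 2 (f, euler f)]. The constant 4 comes from expanding [|f + 2 euler f|^2 >= 0] and
    from [|euler f| <= |grad f|] on the simplex. *)
Lemma friedrichs w : (0 < n)%N -> pure 0 w -> Ztr w -> n2 w <= 4 * n2 (extd w).
Proof.
move=> n0 /pure0E ->; set f := w set0; move=> /(Ztr_fdelta0 _ n0) [_ [g fE]].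
have -> : n2 (fdelta set0 f) = intD (f * f).
  rewrite /n2 (bigD1 set0) //= ffunE eqxx big1 ?addr0 // => I I0.
  by rewrite ffunE (negPf I0) mulr0 linear0.
have df : \sum_i intD (mderiv i f * mderiv i f) <= n2 (extd (fdelta set0 f : form)).
  under eq_bigr do rewrite -extd_fdelta0.
  apply: (sum_set1_le (F := fun I => intD (extd (fdelta set0 f : form) I * extd (fdelta set0 f : form) I))) => I.
  exact: intD_sq_ge0.
apply: le_trans (ler_wpM2l _ df) => //; rewrite -intD_sum -intD_scale.
have h : intD (n%:R *: (f * f) + (f * euler f) *+ 2) = 0.
  have : intD (n%:R *: (f * f) + euler (f * f)) = bd (f * f) by rewrite /bd addrC.
  by rewrite eulerM [euler f * f]mulrC -mulr2n => ->; rewrite {1}fE -mulrA bd_x0.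
have h1 : intD (f * f) <= intD (n%:R *: (f * f)).
  rewrite intD_scale ler_peMl ?intD_sq_ge0 // ler1n //.
have h2 : 0 <= intD ((f + euler f *+ 2) * (f + euler f *+ 2)) by apply: intD_sq_ge0.
have h3 : intD (euler f * euler f) <= intD (\sum_i mderiv i f * mderiv i f).
  apply: intD_le => x xs; rewrite mevalM -expr2 /euler !raddf_sum /=.
  under eq_bigr do rewrite mevalM mevalXU.
  apply: le_trans (simplex_jensen _ xs) _; apply: ler_sum => i _.
  by rewrite mevalM -expr2 ler_piMl ?sqr_ge0 ?simplex_le1.
move: h; rewrite intD_add -[_ *+ 2]scaler_nat 2!intD_scale => h.
move: h2; have -> : (f + euler f *+ 2) * (f + euler f *+ 2) =
   f * f + 4%:R *: (f * euler f) + 4%:R *: (euler f * euler f).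
  by rewrite !scaler_nat; ring.
rewrite 2!intD_add !intD_scale.
move: h h1 h3; rewrite !intD_scale; set A := intD (f * f); set B := intD _; set D := intD _.
set E := intD _; set F := _ * A.
lra.
Qed.
End Boundary.

(** * Zero-trace potentials of closed 1-forms *)

Section Closed1.
Variables (R : realType) (n : nat).
Local Notation form := (dform R n).
Local Notation poly := {mpoly R[n]}.

Lemma deriv0_const (f : poly) : (forall i, mderiv i f = 0) -> f = (f.@[fun=> 0])%:MP.
Proof.
move=> df; have e : f = (f@_0%MM)%:MP.
  apply/mpolyP => m; rewrite mcoeffC; case: eqP => [->|m0]; rewrite ?mulr1 // mulr0.
  have : euler f = 0 by rewrite /euler big1 // => i _; rewrite df mulr0.
  move/(congr1 (mcoeff m)); rewrite mcoeff_euler mcoeff0 => /eqP.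
  by rewrite mulf_eq0 pnatr_eq0 mdeg_eq0 => /orP [/eqP //|/eqP].
by rewrite {2}e mevalC.
Qed.

Lemma pure_fdelta0 (f : poly) : pure 0 (fdelta set0 f : form).
Proof. by move=> I I0; rewrite ffunE; case: eqP => // e; rewrite e cards0 in I0. Qed.

Lemma ew_pure1 (b : form) i j : i != j -> pure 1 b ->
  ew i b [set i; j] = sgn R [set j] i *: b [set j].
Proof.
move=> ij b1; rewrite ffunE set21 (_ : [set i; j] :\ i = [set j]) //.
by rewrite setU1K // inE.
Qed.

Lemma ew_pure1_out (b : form) i j k : i != j -> k != i -> k != j -> ew k b [set i; j] = 0.
Proof. by move=> ij ki kj; rewrite ffunE !inE (negPf ki) (negPf kj). Qed.

Lemma sgn_set1 (i j : 'I_n) : sgn R [set j] i = (-1) ^+ (j < i)%N.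
Proof.
by rewrite -[[set j]]setU0 sgnU ?inE // sgn_set0 mulr1.
Qed.

(** Zero tangential trace of the gradient makes [f] constant on each face. Coordinate faces contain
    the origin, where [f] vanishes; for [n > 1] the slanted face meets a coordinate face, so its
    constant is zero too. *)
Lemma Ztr_closed1 (f : poly) : (1 < n)%N -> f.@[fun=> 0] = 0 ->
  Ztr (extd (fdelta set0 f : form)) -> Ztr (fdelta set0 f : form).
Proof.
move=> n1 f0 [hX [z h0]].
have n0 : (0 < n)%N by apply: ltnW.
have b1 : pure 1 (extd (fdelta set0 f : form)).
  exact/pure_extd/pure_fdelta0.
have dX i j : i != j -> exists g, mderiv i f = 'X_j * g.
  move=> ij; have [zj e] := hX j; exists (sgn R [set i] j *: zj [set j; i]).
  rewrite -extd_fdelta0 -scalerAr -[in RHS](ffunE (fun I : {set 'I_n} => 'X_j * zj I)) -/(mf 'X_j zj) -e.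
  by rewrite ew_pure1 1?eq_sym // scalerA sgn_sq scale1r.
have d0 i j : exists g, mderiv i f - mderiv j f = x0 R n * g.
  wlog ij : i j / (i < j)%N.
    move=> H; case: (ltngtP i j) => [ij|ji|/val_inj ->].
    - exact: H.
    - by have [g e] := H _ _ ji; exists (- g); rewrite mulrN -e opprB.
    - by exists 0; rewrite subrr mulr0.
  have nij : i != j by rewrite -val_eqE /= ltn_eqF.
  have := congr1 (fun w : form => w [set i; j]) h0; rewrite /= sum_ffunE ffunE.
  rewrite (bigD1 i) //= (bigD1 j) 1?eq_sym //= big1 => [|k /andP [ki kj]]; last first.
    by rewrite ew_pure1_out.
  rewrite addr0 ew_pure1 // setUC ew_pure1 1?eq_sym // !sgn_set1 ij ltnNge ltnW // expr0 scale1r.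
  rewrite expr1 scaleN1r !extd_fdelta0 => e.
  by exists (- z [set j; i]); rewrite mulrN -e opprB.
have XE j : exists g, f = 'X_j * g.
  have [g e] : ideq 'X_j (f \mPo affp 0 1%:M) (f \mPo affp 0 (face R (Some j))).
    apply: comp_ideq => l; exists (l == j)%:R.
    rewrite !tnth_affp opprD addrACA subrr add0r -sumrB (bigD1 l) //= big1 => [|k kl].
      rewrite addr0 /face !mxE eqxx -scalerBl andbb; case: eqP => [->|_].
        by rewrite subKr scale1r mulr1.
      by rewrite subr0 subrr scale0r mulr0.
    have lkj : (l == j) && (k == j) = false.
      by apply/negP => /andP [/eqP lj /eqP kj]; rewrite lj kj eqxx in kl.
    by rewrite /face !mxE lkj [l == k]eq_sym (negPf kl) subr0 subrr.
  have f'0 : f \mPo affp 0 (face R (Some j)) = 0.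
    rewrite [LHS]deriv0_const => [|l].
      rewrite comp_mpoly_meval (meval_eq _ (v2 := fun=> 0)) ?f0 ?mpolyC0 // => i.
      rewrite tnth_affp mxE mpolyC0 add0r raddf_sum big1 // => k _ /=.
      by rewrite mevalZ mevalXU mulr0.
    rewrite mderiv_affp big1 // => k _; rewrite /face !mxE.
    have [<-|kj] := eqVneq k j; last first.
      have [g' ->] := dX k j kj; rewrite rmorphM /= comp_mpolyXU -tnth_nth tnth_affp mxE mpolyC0 add0r.
      rewrite [X in X * _]big1 ?mul0r ?scaler0 // => q _; rewrite /face !mxE eqxx /= [q == j]eq_sym.
      by rewrite subrr scale0r.
    by rewrite andTb [l == k]eq_sym subrr scale0r.
  by exists g; rewrite -e f'0 subr0 affp_id.
apply/Ztr_fdelta0 => //; split=> //.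
pose i0 := Ordinal n0.
(* [affp v A] adds [x0] to the coordinate [i0]: the projection onto the slanted face along that
   axis. *)
pose A : 'M[R]_n := \matrix_(k, l) ((k == l)%:R - (k == i0)%:R).
pose v : 'cV[R]_n := \col_k (k == i0)%:R.
have tA l : tnth (affp v A) l = 'X_l + (l == i0)%:R *: x0 R n.
  rewrite tnth_affp mxE /x0 scalerBr scaler_sumr addrCA; congr (_ + _).
    by rewrite -mul_mpolyC mulr1.
  rewrite -[X in _ = X - _](_ : \sum_(j < n) (l == j)%:R *: 'X_j = _).
    by rewrite -sumrB; apply: eq_bigr => j _; rewrite mxE scalerBl.
  rewrite (bigD1 l) //= eqxx scale1r big1 ?addr0 // => j jl.
  by rewrite eq_sym (negPf jl) scale0r.
have [g e] : ideq (x0 R n) (f \mPo affp 0 1%:M) (f \mPo affp v A).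
  apply: comp_ideq => l; exists (- (l == i0)%:R%:MP).
  have -> : tnth (affp 0 1%:M) l = 'X_l :> poly.
    by have := affp_id ('X_l : poly); rewrite comp_mpolyXU -tnth_nth.
  by rewrite tA opprD addrA subrr sub0r mulrN -mul_mpolyC mulrC.
have f'0 : f \mPo affp v A = 0.
  rewrite [LHS]deriv0_const => [|l].
    (* The constant is read off at the image of the origin, the vertex on axis [i0], which lies on
       the face where the coordinate of index 1 vanishes. *)
    have [g' ->] := XE (Ordinal n1); rewrite rmorphM /= mevalM comp_mpolyXU -tnth_nth tA.
    by rewrite scale0r addr0 mevalXU mul0r mpolyC0.
  rewrite mderiv_affp; under eq_bigr do rewrite mxE scalerBl.
  rewrite sumrB (bigD1 l) //= eqxx scale1r big1 ?addr0 => [|k kl]; last first.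
    by rewrite (negPf kl) scale0r.
  rewrite (bigD1 i0) //= scale1r [X in _ - (_ + X)]big1 ?addr0 => [|k /negPf ->]; last first.
    by rewrite scale0r.
  have [h e2] := d0 l i0; rewrite -rmorphB e2 rmorphM /=.
  suff -> : x0 R n \mPo affp v A = 0 by rewrite mul0r.
  rewrite {1}/x0 rmorphB rmorph1 rmorph_sum /=.
  under eq_bigr do rewrite comp_mpolyXU -tnth_nth tA.
  rewrite big_split /= [X in _ - (_ + X)](bigD1 i0) //= scale1r [X in _ - (_ + (_ + X))]big1.
    by rewrite addr0 opprD addrA -/(x0 R n) subrr.
  by move=> k /negPf ->; rewrite scale0r.
by exists g; rewrite -e f'0 subr0 affp_id.
Qed.

Lemma closed1_solve r (b : form) : (1 < n)%N -> Pfull r 1 b -> extd b = 0 -> Ztr b ->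
  exists q, [/\ Pminus r 0 q, Ztr q & extd q = b].
Proof.
move=> n1 hb db Zb; have [G hG eb] := poincare hb db.
have q0 : pure 0 (koszul G) by apply: pure_koszul; case: hG.
exists (koszul G); split=> //; last first.
  rewrite (pure0E q0); apply: Ztr_closed1 => //; last by rewrite -pure0E // -eb.
  rewrite koszulE sum_ffunE raddf_sum big1 // => i _ /=.
  by rewrite ffunE mevalM mevalXU mul0r.
by exists 0, G; split=> //; [apply: Pfull0|rewrite add0r].
Qed.
End Closed1.

(** * Zero-trace potentials of top-degree forms *)

Section Top.
Variables (R : realType) (k : nat).
Local Notation n := k.+1.
Local Notation form := (dform R n).
Local Notation poly := {mpoly R[n]}.
Local Notation vol := (one_top n : form).

Lemma vol_pure : pure n vol.
Proof.
move=> I cI; rewrite ffunE; case: eqP => // e.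
by rewrite e cardsT card_ord eqxx in cI.
Qed.

Lemma pure_topE (a : form) : pure n a -> a = mf (a setT) vol.
Proof.
move=> ap; apply/ffunP => I; rewrite !ffunE; case: eqP => [->|IT]; first by rewrite mulr1.
rewrite mulr0 ap //; apply/negP => /eqP cI; apply: IT; apply/eqP.
by rewrite eqEcard subsetT cardsT card_ord cI leqnn.
Qed.

Lemma ew_vol i (f : poly) : ew i (mf f vol) = 0.
Proof.
apply/ffunP => I; rewrite !ffunE; case: ifP => // iI; case: eqP => [e|]; last by rewrite mulr0 scaler0.
by have := in_setT i; rewrite -e !inE eqxx.
Qed.

Lemma ew_io_vol i j (f : poly) : ew j (io i (mf f vol)) = if i == j then mf f vol else 0.
Proof.
have := io_ew i j (mf f vol); rewrite ew_vol linear0 => /esym/eqP.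
by rewrite subr_eq0 => /eqP.
Qed.

Definition tform (V : 'I_n -> poly) : form := \sum_i io i (mf (V i) vol).

Lemma ew_tform V j : ew j (tform V) = mf (V j) vol.
Proof.
rewrite linear_sum (bigD1 j) //= ew_io_vol eqxx big1 ?addr0 // => i ij.
by rewrite ew_io_vol (negPf ij).
Qed.

Lemma pd_vol j (f : poly) : pd j (mf f vol) = mf (mderiv j f) vol.
Proof.
rewrite pd_mf (_ : pd j vol = 0) ?linear0 ?addr0 //.
by apply/ffunP => I; rewrite !ffunE; case: ifP => _; rewrite ?linear0 // -mpolyC1 mderivC.
Qed.

Lemma extd_tform V : extd (tform V) = mf (\sum_i mderiv i (V i)) vol.
Proof.
rewrite extdE mf_suml; apply: eq_bigr => j _.
by rewrite -pd_ew ew_tform pd_vol.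
Qed.

Lemma Ztr_tform V c : (forall i, exists g, V i = 'X_i * g) -> \sum_i V i = x0 R n * c ->
  Ztr (tform V).
Proof.
move=> hV h0; split=> [i|].
  by have [g e] := hV i; exists (mf g vol); rewrite ew_tform e mfM.
exists (mf c vol); rewrite mfM -h0 mf_suml; apply: eq_bigr => i _; exact: ew_tform.
Qed.

Lemma n2_vol (f : poly) : n2 (mf f vol) = intD (f * f).
Proof.
rewrite /n2 (bigD1 setT) //= !ffunE eqxx mulr1 big1 ?addr0 // => I IT.
by rewrite !ffunE (negPf IT) !mulr0 linear0.
Qed.

Lemma n2_tform V : n2 (tform V) <= n%:R * #|{set 'I_n}|%:R * \sum_i intD (V i * V i).
Proof.
apply: le_trans (n2_sum _) _; rewrite card_ord -mulrA ler_wpM2l // mulr_sumr.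
by apply: ler_sum => i _; rewrite -n2_vol n2_io.
Qed.

Lemma Pfull_vol s (f : poly) : (msize f <= s)%N -> Pfull s n (mf f vol).
Proof.
move=> fs; split; first exact/pure_mf/vol_pure.
by move=> I; rewrite !ffunE; case: ifP => _; rewrite ?mulr1 ?mulr0 ?mmeasure0.
Qed.

Lemma msize_euler r (f : poly) : (msize f <= r)%N -> (msize (euler f) <= r)%N.
Proof.
move=> /msize_leP h; apply/msize_leP => m rm; by rewrite mcoeff_euler h // mulr0.
Qed.

Lemma msize_XD r (f : poly) i : (msize f <= r)%N -> (msize ('X_i * mderiv i f)%R <= r)%N.
Proof.
case: r => [|r] fr; last exact: msize_XM (msize_deriv _ fr).
by rewrite (msize_le0 fr) linear0 mulr0 mmeasure0.
Qed.

(** In [x_i d_i f - x_i (euler f)] only the second part can exceed the degree of [f]; it is radial,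
    hence the Koszul image of a top form. *)
Lemma Pminus_jfield r (f : poly) : (msize f <= r)%N -> Pminus r k (tform (jfield f)).
Proof.
move=> fr; exists (tform (fun i => 'X_i * mderiv i f)), (- mf (euler f) vol); split.
- apply: (big_ind (@Pfull R n r k)); [exact: Pfull0|exact: PfullD|move=> i _].
  have [p1 p2] := Pfull_vol (msize_XD i fr).
  by split; [apply: pure_io|apply: Pdeg_io].
- by rewrite -scaleN1r; apply/PfullZ/Pfull_vol/msize_euler.
rewrite [koszul _]linearN /= koszulE -sumrB; apply: eq_bigr => i _ /=.
by rewrite /jfield mulrBr mfDl mfNl linearB /= mf_io mfM.
Qed.

Lemma top_solve r (a : form) : Pfull r n a -> intD (a setT) = 0 ->
  exists q, [/\ Pminus r k q, Ztr q, extd q = a & n2 q <= n%:R * #|{set 'I_n}|%:R * n2 a].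
Proof.
move=> [ap ar] a0; have [f [fr jf nf]] := jacobi_field (ar setT) a0.
exists (tform (jfield f)); split.
- exact: Pminus_jfield.
- apply: Ztr_tform (jfield_sum f) => i; by exists (mderiv i f - euler f).
- by rewrite extd_tform -/(jacobi f) jf -pure_topE.
- apply: le_trans (n2_tform _) _; rewrite ler_wpM2l ?mulr_ge0 //.
  by rewrite (pure_topE ap) n2_vol.
Qed.
End Top.

(** * Potentials with zero trace: 2-forms in dimension three *)

Section Vec3.
Variable R : realType.
Local Notation poly := {mpoly R[3]}.
Local Notation vec := {ffun 'I_3 -> {mpoly R[3]}}.
Implicit Types (f g : poly) (u v W al be : vec).

Definition i0 : 'I_3 := Ordinal (isT : (0 < 3)%N).
Definition i1 : 'I_3 := Ordinal (isT : (1 < 3)%N).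
Definition i2 : 'I_3 := Ordinal (isT : (2 < 3)%N).

Lemma sum3 (V : zmodType) (F : 'I_3 -> V) : \sum_i F i = F i0 + F i1 + F i2.
Proof.
rewrite !big_ord_recl big_ord0 addr0 addrA; congr (_ + _ + _); congr F; exact: val_inj.
Qed.

Lemma ord3P (P : 'I_3 -> Prop) : P i0 -> P i1 -> P i2 -> forall i, P i.
Proof.
move=> h0 h1 h2 [[|[|[|//]]] h]; by rewrite (bool_irrelevance h isT).
Qed.

Definition mk f0 f1 f2 : vec := [ffun i => if i == i0 then f0 else if i == i1 then f1 else f2].
Lemma mk0 f0 f1 f2 : mk f0 f1 f2 i0 = f0. Proof. by rewrite ffunE. Qed.
Lemma mk1 f0 f1 f2 : mk f0 f1 f2 i1 = f1. Proof. by rewrite ffunE. Qed.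
Lemma mk2 f0 f1 f2 : mk f0 f1 f2 i2 = f2. Proof. by rewrite ffunE. Qed.
Definition mkE := (mk0, mk1, mk2).

Lemma vec3P u v : u i0 = v i0 -> u i1 = v i1 -> u i2 = v i2 -> u = v.
Proof. by move=> h0 h1 h2; apply/ffunP; apply: ord3P. Qed.

Definition dot u v : poly := \sum_i u i * v i.
Definition vdiv u : poly := \sum_i mderiv i (u i).
Definition curl u : vec :=
  mk (mderiv i1 (u i2) - mderiv i2 (u i1)) (mderiv i2 (u i0) - mderiv i0 (u i2))
     (mderiv i0 (u i1) - mderiv i1 (u i0)).
Definition cross u v : vec :=
  mk (u i1 * v i2 - u i2 * v i1) (u i2 * v i0 - u i0 * v i2) (u i0 * v i1 - u i1 * v i0).
Definition vgrad f : vec := [ffun i => mderiv i f].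
Definition vcomp (a : 'cV[R]_3) u : vec := [ffun i => u i \mPo affp a 1%:M].

Local Notation X0 := ('X_i0 : poly).
Local Notation X1 := ('X_i1 : poly).
Local Notation X2 := ('X_i2 : poly).
Local Notation xx := (x0 R 3).

(* The cofactor matrix of [diag x - x x^T], acting on proxies of 2-forms. *)
Definition Bh v : vec :=
  mk (xx * X1 * X2 * v i0 + X0 * X1 * X2 * (v i0 + v i1 + v i2))
     (xx * X0 * X2 * v i1 + X0 * X1 * X2 * (v i0 + v i1 + v i2))
     (xx * X0 * X1 * v i2 + X0 * X1 * X2 * (v i0 + v i1 + v i2)).

Lemma xxE : xx = 1 - (X0 + X1 + X2).
Proof. by rewrite /x0 sum3. Qed.

Lemma curl_is_linear : linear curl.
Proof.
move=> c u v; apply: vec3P; rewrite !ffunE /= !(mderivD, mderivZ) -!mul_mpolyC; ring.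
Qed.
HB.instance Definition _ := GRing.isLinear.Build R vec vec _ curl curl_is_linear.

Lemma Bh_is_linear : linear Bh.
Proof.
move=> c u v; apply: vec3P; rewrite !ffunE /= -!mul_mpolyC; ring.
Qed.
HB.instance Definition _ := GRing.isLinear.Build R vec vec _ Bh Bh_is_linear.

Lemma dot_linl c u v w : dot (c *: u + v) w = c *: dot u w + dot v w.
Proof.
rewrite /dot scaler_sumr -big_split; apply: eq_bigr => i _ /=.
by rewrite !ffunE mulrDl scalerAl.
Qed.

Lemma dotC u v : dot u v = dot v u.
Proof. by apply: eq_bigr => i _; rewrite mulrC. Qed.

Lemma dot_Bh_sym u v : dot u (Bh v) = dot v (Bh u).
Proof. rewrite /dot !sum3 /Bh !mkE; ring. Qed.

Lemma vdiv_curl u : vdiv (curl u) = 0.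
Proof.
rewrite /vdiv sum3 /curl !mkE !mderivB.
rewrite [mderiv i1 (mderiv i0 _)]mderiv_comm [mderiv i2 (mderiv i0 _)]mderiv_comm.
rewrite [mderiv i2 (mderiv i1 _)]mderiv_comm; ring.
Qed.

Lemma mderiv_euler i f : mderiv i (euler f) = euler (mderiv i f) + mderiv i f.
Proof.
rewrite /euler sum3 sum3 !mderivD !mderivM !mderivXi ![mderiv i (mderiv _ f)]mderiv_comm.
move: i; apply: ord3P; rewrite /= !mpolyC0 !mpolyC1; ring.
Qed.

Lemma curl_eq0 u : curl u = 0 <-> forall i j, mderiv i (u j) = mderiv j (u i).
Proof.
split=> [/ffunP h|h]; last by apply: vec3P; rewrite /curl ?mkE [RHS]ffunE h subrr.
have [c0 [c1 c2]] : mderiv i1 (u i2) = mderiv i2 (u i1) /\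
    (mderiv i2 (u i0) = mderiv i0 (u i2) /\ mderiv i0 (u i1) = mderiv i1 (u i0)).
  split; [|split]; apply/eqP; rewrite -subr_eq0; apply/eqP.
  - by have := h i0; rewrite /curl mkE [RHS]ffunE.
  - by have := h i1; rewrite /curl mkE [RHS]ffunE.
  - by have := h i2; rewrite /curl mkE [RHS]ffunE.
by apply: ord3P; apply: ord3P.
Qed.

(** The potential is [x . g], with [g] the average of [u] along the segment from the origin; [g] is
    curl-free because [euler + 2] is injective. *)
Lemma curl0_vgrad u : curl u = 0 -> exists f, u = vgrad f.
Proof.
move=> cu; pose g : vec := [ffun i => einv 1 (u i)].
have ug i : u i = euler (g i) + g i by rewrite ffunE -{1}(@einvK _ _ 1 (u i)) // scale1r.
have cgE i k : mderiv i (g k) = mderiv k (g i).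
  have e a b : mderiv a (u b) = euler (mderiv a (g b)) + 2 *: mderiv a (g b).
    by rewrite ug mderivD mderiv_euler -addrA -mulr2n scaler_nat.
  apply/eqP; rewrite -subr_eq0; apply/eqP; apply: (@euler_inj _ _ 2) => //.
  have := iffLR (curl_eq0 u) cu i k; rewrite !e => /eqP; rewrite -subr_eq0 => /eqP <-.
  by rewrite [euler _]linearB /= scalerBr opprD addrACA.
exists (\sum_i 'X_i * g i); apply/ffunP => j.
rewrite [RHS]ffunE ug linear_sum /=; under [RHS]eq_bigr do rewrite mderivM cgE mderivXi.
rewrite big_split /= [RHS]addrC; congr (_ + _).
rewrite (bigD1 j) //= eqxx mpolyC1 mul1r big1 ?addr0 // => i ij.
by rewrite eq_sym (negPf ij) mpolyC0 mul0r.
Qed.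

Definition tangent W := (forall i, exists r, W i = 'X_i * r) /\ exists c, \sum_i W i = xx * c.

Lemma tangent_div W : tangent W -> intD (vdiv W) = 0.
Proof. by move=> [h [c e]]; apply: intD_div_tangent h e. Qed.

Lemma intD_tangent_grad W f : tangent W -> vdiv W = 0 -> intD (dot W (vgrad f)) = 0.
Proof.
move=> [h [c e]] dW; rewrite -[RHS](@tangent_div [ffun i => f * W i]); last first.
  split=> [i|]; first by have [r er] := h i; exists (f * r); rewrite ffunE er mulrCA.
  by exists (f * c); rewrite mulrCA -e mulr_sumr; apply: eq_bigr => i _; rewrite ffunE.
congr intD; rewrite -[LHS]addr0 -[X in _ + X](mulr0 f) -dW mulr_sumr -big_split.
by apply: eq_bigr => i _ /=; rewrite !ffunE mderivM; ring.
Qed.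

(** The two fields differ by a gradient, to which a tangent divergence-free field is orthogonal. *)
Lemma intD_tangent_curl W al be : tangent W -> vdiv W = 0 -> curl al = curl be ->
  intD (dot W al) = intD (dot W be).
Proof.
move=> tW dW e; have [|f ef] := @curl0_vgrad (-1 *: be + al).
  by rewrite linearP /= e scaleN1r addNr.
have := intD_tangent_grad f tW dW; rewrite -ef dotC dot_linl intD_add intD_scale.
by rewrite mulN1r addrC ![dot _ W]dotC => /eqP; rewrite subr_eq0 => /eqP.
Qed.

(** [Bh v] is normal to every face, so its cross product with any field is tangent; the witnesses
    are the quotients by the barycentric coordinates. This is why test fields need no boundary
    condition. *)
Lemma tangent_cross_Bh be v : tangent (cross be (Bh v)).
Proof.
split.
  apply: ord3P; rewrite /cross /Bh !mkE.
  - exists (be i1 * (xx * X1 * v i2 + X1 * X2 * (v i0 + v i1 + v i2)) -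
      be i2 * (xx * X2 * v i1 + X1 * X2 * (v i0 + v i1 + v i2))); ring.
  - exists (be i2 * (xx * X2 * v i0 + X0 * X2 * (v i0 + v i1 + v i2)) -
      be i0 * (xx * X0 * v i2 + X0 * X2 * (v i0 + v i1 + v i2))); ring.
  - exists (be i0 * (xx * X0 * v i1 + X0 * X1 * (v i0 + v i1 + v i2)) -
      be i1 * (xx * X1 * v i0 + X0 * X1 * (v i0 + v i1 + v i2))); ring.
exists (be i0 * (X0 * X2 * v i1 - X0 * X1 * v i2) + be i1 * (X0 * X1 * v i2 - X1 * X2 * v i0)
   + be i2 * (X1 * X2 * v i0 - X0 * X2 * v i1)).
rewrite sum3 /cross /Bh !mkE; ring.
Qed.

Lemma intD_curl_parts be v : intD (dot (curl be) (Bh v)) = intD (dot be (curl (Bh v))).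
Proof.
apply/eqP; rewrite -subr_eq0 -intD_sub; apply/eqP.
rewrite -[RHS](tangent_div (tangent_cross_Bh be v)); congr intD.
move: (Bh v) => q; rewrite /vdiv /dot !sum3 /cross /curl !mkE !mderivB !mderivM; ring.
Qed.

(** On a face, the normal component of a curl sees only the tangential part of the field, and that
    of [Bh v] vanishes. *)
Lemma tangent_curl_Bh v : tangent (curl (Bh v)).
Proof.
have dX i j : mderiv i ('X_j : poly) = ((i == j)%:R)%:MP by exact: mderivXi.
have dxx i : mderiv i xx = - 1 by rewrite mderiv_x0 mpolyCN.
split.
  apply: ord3P; rewrite /curl /Bh !mkE; set s := (v i0 + v i1 + v i2).
  - exists (mderiv i1 (xx * X1 * v i2 + X1 * X2 * s) - mderiv i2 (xx * X2 * v i1 + X1 * X2 * s)).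
    rewrite !(mderivD, mderivM, dX, dxx) /= !mpolyC0 !mpolyC1; ring.
  - exists (mderiv i2 (xx * X2 * v i0 + X0 * X2 * s) - mderiv i0 (xx * X0 * v i2 + X0 * X2 * s)).
    rewrite !(mderivD, mderivM, dX, dxx) /= !mpolyC0 !mpolyC1; ring.
  - exists (mderiv i0 (xx * X0 * v i1 + X0 * X1 * s) - mderiv i1 (xx * X1 * v i0 + X0 * X1 * s)).
    rewrite !(mderivD, mderivM, dX, dxx) /= !mpolyC0 !mpolyC1; ring.
exists (mderiv i0 (X0 * X2 * v i1 - X0 * X1 * v i2) + mderiv i1 (X0 * X1 * v i2 - X1 * X2 * v i0)
   + mderiv i2 (X1 * X2 * v i0 - X0 * X2 * v i1)).
rewrite sum3 /curl /Bh !mkE; set s := (v i0 + v i1 + v i2).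
rewrite !(mderivB, mderivD, mderivM, dX, dxx) /= !mpolyC0 !mpolyC1; ring.
Qed.

End Vec3.

(** * Pointwise bounds for the degenerate weight *)

Section Pointwise.
Variable R : realType.
Implicit Types (a b c x y z w : R).

Lemma sqr_sum3 a b c : (a + b + c) ^+ 2 <= 3 * (a ^+ 2 + b ^+ 2 + c ^+ 2).
Proof. have := sqr_ge0 (a - b); have := sqr_ge0 (a - c); have := sqr_ge0 (b - c); nra. Qed.

Lemma min_prod3 (m a b c : R) : 0 <= m -> m <= a -> m <= b -> m <= c ->
  m ^+ 2 * (a + b + c) <= 3 * (a * b * c).
Proof.
move=> m0 ma mb mc.
have h x y z : m <= x -> m <= y -> m <= z -> m ^+ 2 * x <= x * y * z.
  move=> mx my mz; have x0 : 0 <= x := le_trans m0 mx.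
  rewrite mulrC -mulrA ler_wpM2l // expr2 ler_pM //.
have h1 := h a b c ma mb mc; have h2 := h b a c mb ma mc; have h3 := h c a b mc ma mb.
have e2 : b * a * c = a * b * c by ring.
have e3 : c * a * b = a * b * c by ring.
rewrite e2 in h2; rewrite e3 in h3; lra.
Qed.

(** Each of [v1], [v2], [v3] and their sum is a signed sum of the other three, so dropping one of
    the four squares costs a factor 4; averaging with weights [l0], ..., [l3] of sum one keeps it.
    The remaining factor 3 is that of [min_prod3]. *)
Lemma weight_lower (m l0 l1 l2 l3 v1 v2 v3 : R) : 0 <= m -> m <= l0 -> m <= l1 -> m <= l2 -> m <= l3 ->
  l0 + l1 + l2 + l3 = 1 ->
  m ^+ 2 * (v1 ^+ 2 + v2 ^+ 2 + v3 ^+ 2) <= 12 *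
  (l0 * l2 * l3 * v1 ^+ 2 + l0 * l1 * l3 * v2 ^+ 2 + l0 * l1 * l2 * v3 ^+ 2 +
   l1 * l2 * l3 * (v1 + v2 + v3) ^+ 2).
Proof.
move=> m0 h0 h1 h2 h3 e.
have p1 := min_prod3 m0 h0 h2 h3; have p2 := min_prod3 m0 h0 h1 h3.
have p3 := min_prod3 m0 h0 h1 h2; have p0 := min_prod3 m0 h1 h2 h3.
set s := v1 + v2 + v3.
have q1 := ler_wpM2r (sqr_ge0 v1) p1; have q2 := ler_wpM2r (sqr_ge0 v2) p2.
have q3 := ler_wpM2r (sqr_ge0 v3) p3; have q0 := ler_wpM2r (sqr_ge0 s) p0.
have m2 := sqr_ge0 m.
have t0 : s ^+ 2 <= 3 * (v1 ^+ 2 + v2 ^+ 2 + v3 ^+ 2) by exact: sqr_sum3.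
have t1 : v1 ^+ 2 <= 3 * (s ^+ 2 + v2 ^+ 2 + v3 ^+ 2).
  by have := sqr_sum3 s (- v2) (- v3); rewrite !sqrrN (_ : s - v2 - v3 = v1) // /s; ring.
have t2 : v2 ^+ 2 <= 3 * (s ^+ 2 + v1 ^+ 2 + v3 ^+ 2).
  by have := sqr_sum3 s (- v1) (- v3); rewrite !sqrrN (_ : s - v1 - v3 = v2) // /s; ring.
have t3 : v3 ^+ 2 <= 3 * (s ^+ 2 + v1 ^+ 2 + v2 ^+ 2).
  by have := sqr_sum3 s (- v1) (- v2); rewrite !sqrrN (_ : s - v1 - v2 = v3) // /s; ring.
have k0 : 0 <= l0 := le_trans m0 h0; have k1 : 0 <= l1 := le_trans m0 h1.
have k2 : 0 <= l2 := le_trans m0 h2; have k3 : 0 <= l3 := le_trans m0 h3.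
have main : v1 ^+ 2 + v2 ^+ 2 + v3 ^+ 2 <= 4 * ((l0 + l2 + l3) * v1 ^+ 2 +
   (l0 + l1 + l3) * v2 ^+ 2 + (l0 + l1 + l2) * v3 ^+ 2 + (l1 + l2 + l3) * s ^+ 2).
  move: (s ^+ 2) (v1 ^+ 2) (v2 ^+ 2) (v3 ^+ 2) (sqr_ge0 s) t0 t1 t2 t3 => S A B C S0 t0 t1 t2 t3.
  have -> : l0 = 1 - l1 - l2 - l3 by lra.
  nra.
have := ler_wpM2l m2 main.
move: q0 q1 q2 q3; set P1 := l0 * l2 * l3; set P2 := l0 * l1 * l3; set P3 := l0 * l1 * l2.
set P0 := l1 * l2 * l3.
move: (s ^+ 2) (v1 ^+ 2) (v2 ^+ 2) (v3 ^+ 2) (m ^+ 2) => S A B C M.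
lra.
Qed.

(** A factor 2 for squaring a two-term sum with coefficients at most one, and a factor 3 because the
    [s] term enters all three squares. *)
Lemma weight_upper (l0 l1 l2 l3 v1 v2 v3 s : R) : 0 <= l0 -> 0 <= l1 -> 0 <= l2 -> 0 <= l3 ->
  l0 + l1 + l2 + l3 = 1 ->
  (l0 * l2 * l3 * v1 + l1 * l2 * l3 * s) ^+ 2 + (l0 * l1 * l3 * v2 + l1 * l2 * l3 * s) ^+ 2 +
  (l0 * l1 * l2 * v3 + l1 * l2 * l3 * s) ^+ 2 <= 6 *
  (l0 * l2 * l3 * v1 ^+ 2 + l0 * l1 * l3 * v2 ^+ 2 + l0 * l1 * l2 * v3 ^+ 2 +
   l1 * l2 * l3 * s ^+ 2).
Proof.
move=> k0 k1 k2 k3 e.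
have prod1 a b c : 0 <= a -> a <= 1 -> 0 <= b -> b <= 1 -> 0 <= c -> c <= 1 -> 0 <= a * b * c <= 1.
  move=> *; rewrite !mulr_ge0 //= !mulr_ile1 ?mulr_ge0 //.
have /andP [a1 b1] : 0 <= l0 * l2 * l3 <= 1 by apply: prod1; lra.
have /andP [a2 b2] : 0 <= l0 * l1 * l3 <= 1 by apply: prod1; lra.
have /andP [a3 b3] : 0 <= l0 * l1 * l2 <= 1 by apply: prod1; lra.
have /andP [a0 b0] : 0 <= l1 * l2 * l3 <= 1 by apply: prod1; lra.
have h P Q x y : 0 <= P -> P <= 1 -> 0 <= Q -> Q <= 1 ->
   (P * x + Q * y) ^+ 2 <= 2 * (P * x ^+ 2 + Q * y ^+ 2).
  move=> P0 P1 Q0 Q1; have := sqr_ge0 (P * x - Q * y).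
  have : P * (P * x ^+ 2) <= P * x ^+ 2 by rewrite ler_piMl // mulr_ge0 ?sqr_ge0.
  have : Q * (Q * y ^+ 2) <= Q * y ^+ 2 by rewrite ler_piMl // mulr_ge0 ?sqr_ge0.
  nra.
have h1 := h _ _ v1 s a1 b1 a0 b0; have h2 := h _ _ v2 s a2 b2 a0 b0.
have h3 := h _ _ v3 s a3 b3 a0 b0.
have g1 := mulr_ge0 a1 (sqr_ge0 v1); have g2 := mulr_ge0 a2 (sqr_ge0 v2).
have g3 := mulr_ge0 a3 (sqr_ge0 v3).
lra.
Qed.
End Pointwise.

(** * Gauge-fixed vector potentials and the Hardy inequality *)

Section Gauge.
Variable R : realType.
Local Notation poly := {mpoly R[3]}.
Local Notation vec := {ffun 'I_3 -> {mpoly R[3]}}.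
Implicit Types (f g : poly) (u v W al be : vec).
Local Notation xx := (x0 R 3).

Lemma meval_dot_Bh v (x : 'I_3 -> R) : (dot v (Bh v)).@[x] =
  (1 - \sum_i x i) * x i1 * x i2 * (v i0).@[x] ^+ 2 + (1 - \sum_i x i) * x i0 * x i2 * (v i1).@[x] ^+ 2 +
  (1 - \sum_i x i) * x i0 * x i1 * (v i2).@[x] ^+ 2 +
  x i0 * x i1 * x i2 * ((v i0).@[x] + (v i1).@[x] + (v i2).@[x]) ^+ 2.
Proof.
rewrite /dot sum3 /Bh !mkE !(meval_x0, mevalM, mevalXU, mevalD); ring.
Qed.

Lemma Bh_bound v x : simplex x -> (dot (Bh v) (Bh v)).@[x] <= 6 * (dot v (Bh v)).@[x].
Proof.
move=> [xp x1]; rewrite meval_dot_Bh /dot !sum3 /Bh !mkE !(meval_x0, mevalM, mevalXU, mevalD).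
have := xp i0; have := xp i1; have := xp i2; move: x1; rewrite !sum3.
move: (x i0) (x i1) (x i2) (v i0).@[x] (v i1).@[x] (v i2).@[x] => a b c p q r s1 c0 b0 a0.
have := @weight_upper _ (1 - (a + b + c)) a b c p q r (p + q + r); rewrite subr_ge0 => /(_ s1 a0 b0 c0).
have -> : 1 - (a + b + c) + a + b + c = 1 by ring.
move=> /(_ erefl); rewrite !expr2; lra.
Qed.

Lemma intD_dot_ge0 u : 0 <= intD (dot u u).
Proof. by rewrite /dot intD_sum; apply: sumr_ge0 => i _; apply: intD_sq_ge0. Qed.

Lemma intD_dot_eq0 u : intD (dot u u) = 0 -> u = 0.
Proof.
rewrite /dot intD_sum => /eqP; rewrite psumr_eq0 => [|i _]; last exact: intD_sq_ge0.
move=> /allP h; apply/ffunP => i; rewrite ffunE; apply: intD_sq_eq0; apply/eqP/h.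
by rewrite mem_index_enum.
Qed.

Lemma Bh_eq0 v : Bh v = 0 -> v = 0.
Proof.
move=> /ffunP h; have := h i0; have := h i1; have := h i2.
rewrite /Bh !mkE !ffunE; set s := v i0 + v i1 + v i2.
have xn0 := x0_neq0 R 3; have X0n := Xi_neq0 R i0; have X1n := Xi_neq0 R i1.
have X2n := Xi_neq0 R i2 => e2 e1 e0.
have canc (a b c : poly) : a != 0 -> b != 0 -> a * b * c = 0 -> c = 0.
  by move=> an bn /eqP; rewrite !mulf_eq0 (negPf an) (negPf bn) => /eqP.
have f0 : xx * v i0 + 'X_i0 * s = 0 by apply: (canc _ _ _ X1n X2n); rewrite -e0; ring.
have f1 : xx * v i1 + 'X_i1 * s = 0 by apply: (canc _ _ _ X0n X2n); rewrite -e1; ring.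
have f2 : xx * v i2 + 'X_i2 * s = 0 by apply: (canc _ _ _ X0n X1n); rewrite -e2; ring.
(* Adding the three equations gives [s] times the sum of all barycentric coordinates, which is
   one. *)
have s0 : s = 0.
  have : (xx * v i0 + 'X_i0 * s) + (xx * v i1 + 'X_i1 * s) + (xx * v i2 + 'X_i2 * s) = 0.
    by rewrite f0 f1 f2 !addr0.
  by move=> <-; rewrite /s xxE; ring.
move: f0 f1 f2; rewrite s0 !mulr0 !addr0.
move=> /eqP; rewrite mulf_eq0 (negPf xn0) => /eqP v0.
move=> /eqP; rewrite mulf_eq0 (negPf xn0) => /eqP v1.
move=> /eqP; rewrite mulf_eq0 (negPf xn0) => /eqP v2.
by apply: vec3P; rewrite ffunE.
Qed.

Lemma Bh_form_eq0 v : intD (dot v (Bh v)) = 0 -> v = 0.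
Proof.
move=> h; apply: Bh_eq0; apply: intD_dot_eq0; apply/eqP; rewrite eq_le intD_dot_ge0 andbT.
rewrite -(mulr0 6) -h -intD_scale; apply: intD_le => x xs.
by rewrite mevalZ Bh_bound.
Qed.

Definition ctr : 'cV[R]_3 := \col_i 4^-1.

Lemma curl_vcomp a u : curl (vcomp a u) = vcomp a (curl u).
Proof.
have d i j : mderiv i (vcomp a u j) = mderiv i (u j) \mPo affp a 1%:M.
  rewrite ffunE mderiv_affp (bigD1 i) //= mxE eqxx scale1r big1 ?addr0 // => l li.
  by rewrite mxE (negPf li) scale0r.
by apply: vec3P; rewrite /curl [RHS]ffunE !mkE !d rmorphB.
Qed.

Lemma vdiv_vcomp a u : vdiv (vcomp a u) = vdiv u \mPo affp a 1%:M.
Proof.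
rewrite /vdiv rmorph_sum; apply: eq_bigr => i _ /=.
rewrite ffunE mderiv_affp (bigD1 i) //= mxE eqxx scale1r big1 ?addr0 // => l li.
by rewrite mxE (negPf li) scale0r.
Qed.

Lemma vcompK a u : vcomp (- a) (vcomp a u) = u.
Proof.
by apply/ffunP => i; rewrite !ffunE affp_comp mul1mx subrr mulmx1 affp_id.
Qed.

Lemma curl_cross_X (g : vec) i :
  curl (cross g [ffun j => 'X_j]) i = euler (g i) + 2 *: g i - 'X_i * vdiv g.
Proof.
have dX k j : mderiv k ('X_j : poly) = ((k == j)%:R)%:MP by exact: mderivXi.
rewrite scaler_nat /euler /vdiv !sum3; move: i; apply: ord3P;
  rewrite /curl /cross !mkE !ffunE !(mderivB, mderivM) !dX /= !mpolyC0 !mpolyC1; ring.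
Qed.

(** The curl of [cross g x] is [(euler + 2) g - x (vdiv g)]. [einv 2] inverts the first term and
    keeps the field divergence-free, since [euler + 3] is injective. *)
Lemma curl_radial (h : vec) : vdiv h = 0 ->
  curl (cross [ffun i => einv 2 (h i)] [ffun i => 'X_i]) = h.
Proof.
move=> dh; set g : vec := [ffun i => einv 2 (h i)].
have hE i : euler (g i) + 2 *: g i = h i by rewrite ffunE einvK.
have dg : vdiv g = 0.
  apply: (@euler_inj _ _ 3) => //; rewrite -dh /vdiv [euler _]linear_sum scaler_sumr -big_split.
  apply: eq_bigr => i _ /=; rewrite -hE mderivD mderivZ mderiv_euler -addrA; congr (_ + _).
  by rewrite !scaler_nat -mulrS.
by apply/ffunP => i; rewrite curl_cross_X dg mulr0 subr0 hE.
Qed.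

Lemma baryE o : bary ctr o = 4^-1.
Proof.
by case: o => [i|] /=; rewrite ?mxE // sum3 !mxE; field.
Qed.

(** A point of a cone combines the centroid, with weight [1 - \sum_i y i], and points of the base
    face; the centroid contributes a quarter of that weight to every barycentric coordinate. *)
Lemma affp_cone_simplex o (y : 'I_3 -> R) : simplex y ->
  let x := fun i => (tnth (affp ctr (cone ctr o)) i).@[y] in
  let m := (1 - \sum_i y i) / 4 in
  [/\ 0 <= m, m <= 1 - \sum_i x i & forall i, m <= x i].
Proof.
move=> [y0 y1] x m; have s0 : 0 <= 1 - \sum_i y i by rewrite subr_ge0.
have m0 : 0 <= m by rewrite divr_ge0.
pose z i := if o is Some j then if i == j then 0 else y i else y i.
have z0 i : 0 <= z i by rewrite /z; case: (o) => [j|] //; case: eqP.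
have zy i : z i <= y i by rewrite /z; case: (o) => [j|] //; case: eqP.
have xE i : x i = z i + m.
  rewrite /x tnth_cone mevalD mevalZ meval_x0 mxE [4^-1 * _]mulrC; congr (_ + _).
  have -> : tnth (affp 0 (face R o)) i = ('X_i : poly) \mPo affp 0 (face R o).
    by rewrite comp_mpolyXU -tnth_nth.
  rewrite /z; case: (o) => [j|].
    rewrite comp_face mevalZ mevalXU mnm1E; case: (i == j); by rewrite /= ?mul0r ?mul1r.
  by rewrite /face subr0 affp_id mevalXU.
split=> // [|i]; last by rewrite xE lerDr.
have : \sum_i z i <= \sum_i y i by apply: ler_sum => i _; exact: zy.
rewrite [X in _ <= 1 - X](eq_bigr (fun i => z i + m)) => [|i _]; last exact: xE.
rewrite big_split /= [\sum_(i < 3) m]sum3 /m; lra.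
Qed.

Lemma Bh_lower v (x : 'I_3 -> R) t : 0 <= t / 4 -> t / 4 <= 1 - \sum_i x i ->
  (forall i, t / 4 <= x i) -> t ^+ 2 * \sum_i (v i).@[x] ^+ 2 <= 192 * (dot v (Bh v)).@[x].
Proof.
rewrite meval_dot_Bh !sum3 => m0 mx m_le.
have e1 : 1 - (x i0 + x i1 + x i2) + x i0 + x i1 + x i2 = 1 by ring.
have := weight_lower (v i0).@[x] (v i1).@[x] (v i2).@[x] m0 mx (m_le i0) (m_le i1) (m_le i2) e1.
rewrite expr_div_n; have -> : (4 : R) ^+ 2 = 16 by ring.
lra.
Qed.

(** For [n = 3] and [c = 2] the factor [n + 1 - 2 c] of [intD_hardy_id] vanishes, leaving
    [|F|^2 = 2 (F, x0 f)]; the square [|F - 2 x0 f|^2 >= 0] then gives the constant 4. *)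
Lemma hardy3 (F f : poly) : euler F + 2 *: F = f ->
  intD (F * F) <= 4 * intD ((xx * f) * (xx * f)).
Proof.
move=> /intD_hardy_id; have -> : ((3%:R + 1 - 2 *+ 2)%:MP * xx - 1 : poly) = -1.
  have -> : 3%:R + 1 - 2 *+ 2 = 0 :> R by ring.
  by rewrite mpolyC0 mul0r sub0r.
rewrite mulN1r intD_add => h.
have := intD_sq_ge0 (F - (xx * f) *+ 2).
have -> : (F - (xx * f) *+ 2) * (F - (xx * f) *+ 2) =
   F * F - (xx * (F * f)) *+ 4 + 4 *: (xx * f * (xx * f)) by rewrite scaler_nat; ring.
rewrite intD_add intD_sub intD_scale.
have e4 : intD (xx * (F * f) *+ 4) = 2 * intD (xx * (F * f) *+ 2).
  rewrite -!scaler_nat !intD_scale; ring.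
have e1 : intD (- (F * F)) = - intD (F * F) by rewrite linearN.
rewrite e1 in h; rewrite e4; lra.
Qed.

Lemma meval_cross_le u v (x : 'I_3 -> R) : (forall i, (v i).@[x] ^+ 2 <= 1) ->
  (dot (cross u v) (cross u v)).@[x] <= 4 * (dot u u).@[x].
Proof.
move=> vb; rewrite /dot !sum3 /cross !mkE !mevalD !mevalM !mevalB !mevalM.
have := vb i0; have := vb i1; have := vb i2.
move: (v i0).@[x] (v i1).@[x] (v i2).@[x] (u i0).@[x] (u i1).@[x] (u i2).@[x] => a b c p q r c1 b1 a1.
have k (s t y w : R) : y ^+ 2 <= 1 -> w ^+ 2 <= 1 ->
   (s * y - t * w) * (s * y - t * w) <= 2 * (s * s + t * t).
  move=> y1 w1; have := sqr_ge0 (s * w + t * y).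
  have := ler_wpM2l (sqr_ge0 s) y1; have := ler_wpM2l (sqr_ge0 t) y1.
  have := ler_wpM2l (sqr_ge0 s) w1; have := ler_wpM2l (sqr_ge0 t) w1.
  have := sqr_ge0 (s * y + t * w).
  rewrite !expr2; nra.
have := k q r c b c1 b1; have := k r p a c a1 c1; have := k p q b a b1 a1; lra.
Qed.

(** A factor 4 for the cross product with a bounded field, 4 for Hardy's inequality, and 192, which
    is 12 times 16, for [Bh_lower]. *)
Definition hardyC : R := 3072.

Lemma hardyC_gt0 : 0 < hardyC.
Proof. by rewrite /hardyC ltr0n. Qed.

(* Gauge-fixed potential of a solenoidal field: Poincare's operator with base point the centroid, whose [L^2] norm is bounded by the degenerate weighted norm through Hardy's inequality on the four cones over the faces. *)
Lemma gauge v : vdiv v = 0 -> exists2 be, curl be = v &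
  intD (dot be be) <= hardyC * intD (dot v (Bh v)).
Proof.
move=> dv; pose h := vcomp ctr v.
have dh : vdiv h = 0 by rewrite vdiv_vcomp dv linear0.
pose g : vec := [ffun i => einv 2 (h i)].
pose G := vcomp (- ctr) g.
pose be := vcomp (- ctr) (cross g [ffun i => 'X_i]).
exists be; first by rewrite curl_vcomp curl_radial // vcompK.
pose Y (i : 'I_3) : poly := 'X_i - (4^-1)%:MP.
have XY i : ('X_i : poly) \mPo affp (- ctr) 1%:M = Y i.
  rewrite comp_mpolyXU -tnth_nth tnth_affp !mxE mpolyCN addrC; congr (_ - _).
  rewrite (bigD1 i) //= mxE eqxx scale1r big1 ?addr0 // => j ji.
  by rewrite mxE eq_sym (negPf ji) scale0r.
have beE : be = cross G [ffun i => Y i].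
  apply: vec3P; rewrite /cross [LHS]ffunE !mkE ?ffunE rmorphB !rmorphM /= !XY //.
have b1 : intD (dot be be) <= 4 * intD (dot G G).
  rewrite -intD_scale; apply: intD_le => x xs; rewrite mevalZ beE; apply: meval_cross_le => i.
  rewrite ffunE /Y mevalB mevalXU mevalC; have := simplex_le1 i xs; have := xs.1 i.
  by move: (x i) => t t0 t1; rewrite expr2; nra.
have b2 o : intD (dot G G \mPo affp ctr (cone ctr o)) <=
    768 * intD (dot v (Bh v) \mPo affp ctr (cone ctr o)).
  (* In cone coordinates the radial derivative centred at the centroid becomes [euler], so [hardy3]
     applies to each component of [G]. *)
  have step i : intD ((G i \mPo affp ctr (cone ctr o)) * (G i \mPo affp ctr (cone ctr o))) <=
    4 * intD ((xx * (v i \mPo affp ctr (cone ctr o))) * (xx * (v i \mPo affp ctr (cone ctr o)))).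
    apply: hardy3; rewrite euler_affp -comp_mpolyZ -comp_mpolyD; congr (_ \mPo _).
    have -> : v i = euler (g i) + 2 *: g i \mPo affp (- ctr) 1%:M.
      have -> : euler (g i) + 2 *: g i = h i by rewrite ffunE einvK.
      by rewrite ffunE affp_comp mul1mx subrr mulmx1 affp_id.
    rewrite comp_mpolyD comp_mpolyZ [G i]ffunE; congr (_ + _).
    rewrite [in RHS]/euler [RHS]rmorph_sum; apply: eq_bigr => l _ /=.
    rewrite rmorphM /= XY [ctr l 0]mxE mderiv_affp (bigD1 l) //= mxE eqxx scale1r big1 ?addr0; last first.
      by move=> j jl; rewrite mxE (negPf jl) scale0r.
    by [].
  have -> : dot G G \mPo affp ctr (cone ctr o) =
     \sum_i (G i \mPo affp ctr (cone ctr o)) * (G i \mPo affp ctr (cone ctr o)).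
    by rewrite /dot rmorph_sum; apply: eq_bigr => i _; rewrite rmorphM.
  rewrite intD_sum; apply: (@le_trans _ _ (\sum_i 4 * intD ((xx * (v i \mPo affp ctr (cone ctr o))) *
     (xx * (v i \mPo affp ctr (cone ctr o)))))); first by apply: ler_sum => i _; apply: step.
  rewrite -mulr_sumr -intD_sum -!intD_scale; apply: intD_le => y ys.
  have [m0 mx m_le] := affp_cone_simplex o ys; have := Bh_lower v m0 mx m_le.
  rewrite !mevalZ comp_mpoly_meval; set Q := (dot v _).@[_].
  have -> : (\sum_i xx * (v i \mPo affp ctr (cone ctr o)) * (xx * (v i \mPo affp ctr (cone ctr o)))).@[y]
     = (1 - \sum_i y i) ^+ 2 * \sum_i (v i).@[fun i => (tnth (affp ctr (cone ctr o)) i).@[y]] ^+ 2.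
    rewrite raddf_sum mulr_sumr; apply: eq_bigr => i _ /=.
    rewrite mevalM mevalM meval_x0 comp_mpoly_meval; ring.
  set P := _ * _; lra.
apply: le_trans b1 _.
rewrite (intD_subdiv ctr (dot G G)) // (intD_subdiv ctr (dot v (Bh v))) // !mulr_sumr.
apply: ler_sum => o _; rewrite baryE /hardyC; have := b2 o; lra.
Qed.

End Gauge.

(** * Variational solution of the weighted curl-curl problem *)

Section CurlSolve.
Variable R : realType.
Local Notation poly := {mpoly R[3]}.
Local Notation vec := {ffun 'I_3 -> {mpoly R[3]}}.
Implicit Types (f g : poly) (u v W al be : vec).
Local Notation xx := (x0 R 3).

Lemma vecPE (c : R) u v i : (c *: u + v) i = c *: u i + v i.
Proof. by rewrite !ffunE. Qed.

Definition vsize r u := forall i, (msize (u i) <= r)%N.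

Lemma vsize_curl r u : vsize r u -> vsize r.-1 (curl u).
Proof. by move=> h; apply: ord3P; rewrite /curl mkE; apply: msizeB; apply: msize_deriv; apply: h. Qed.

Lemma msize_xx : (msize xx <= 2)%N.
Proof.
apply: msizeB; first by rewrite msize1.
by apply: msize_sumk => i _; rewrite msizeXi.
Qed.

Lemma vsize_Bh r u : vsize r u -> vsize (r + 3) (Bh u).
Proof.
case: r => [|r] h.
  have -> : u = 0 by apply/ffunP => i; rewrite ffunE; apply/msize_le0/h.
  by move=> i; rewrite linear0 ffunE mmeasure0.
have m4 (a b c f : poly) : (msize a <= 2)%N -> (msize b <= 2)%N -> (msize c <= 2)%N ->
    (msize f <= r.+1)%N -> (msize (a * b * c * f) <= r.+1 + 3)%N.
  move=> ha hb hc hf; apply: leq_trans (msizeMk (msizeMk (msizeMk ha hb) hc) hf) _.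
  by rewrite addn3.
have hX i : (msize ('X_i : poly) <= 2)%N by rewrite msizeXi.
have hs : (msize (u i0 + u i1 + u i2) <= r.+1)%N by rewrite !msizeD.
by apply: ord3P; rewrite /Bh mkE; apply: msizeD; apply: m4; rewrite ?msize_xx.
Qed.

Lemma msize_XMinv r (f : poly) i : (msize ('X_i * f)%R <= r)%N -> (msize f <= r.-1)%N.
Proof.
have [->|f0] := eqVneq f 0; first by rewrite mmeasure0.
by rewrite msizeM ?Xi_neq0 // msizeXi; case: r.
Qed.

Lemma msize_x0Minv r (f : poly) : (msize (xx * f)%R <= r)%N -> (msize f <= r.-1)%N.
Proof.
have [->|f0] := eqVneq f 0; first by rewrite mmeasure0.
have s2 : (2 <= msize xx)%N.
  rewrite ltnNge; apply/negP => /msize1_polyC e.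
  have := congr1 (fun p : poly => mderiv i0 p) e; rewrite /= mderiv_x0 mderivC => /eqP.
  by rewrite mpolyC_eq0 oppr_eq0 oner_eq0.
rewrite msizeM ?x0_neq0 //; move: s2; case: (mmeasure _ xx) => [|[|s]] // _.
by case: r => [|r]; rewrite addSn /= ?addSn // ltnS => h; apply: leq_trans h; rewrite leq_addl.
Qed.

(* A residual orthogonal to all test fields vanishes: it equals [B zeta] for a test field [zeta]. *)
Lemma tangent_orth_eq0 r W : vsize r W -> tangent W ->
  (forall be, vsize r.-1 be -> intD (dot W be) = 0) -> W = 0.
Proof.
move=> Wr [hX [c e]] ort.
have [rho hr] : exists rho : vec, forall i, W i = 'X_i * rho i.
  have [r0 e0] := hX i0; have [r1 e1] := hX i1; have [r2 e2] := hX i2.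
  by exists (mk r0 r1 r2); apply: ord3P; rewrite mkE.
(* With this choice [W_i = x_i (ze_i - \sum_j x_j ze_j)], that is [W = B ze], and [ze] has one
   degree less than [W]. *)
pose ze : vec := [ffun i => rho i + c].
have zs : vsize r.-1 ze.
  move=> i; rewrite ffunE; apply: msizeD; first by apply: (@msize_XMinv _ _ i); rewrite -hr.
  apply: msize_x0Minv; rewrite -e; by apply: msize_sumk => j _; exact: Wr.
have ce : c = \sum_i 'X_i * ze i.
  under eq_bigr do rewrite ffunE mulrDr -hr.
  by rewrite big_split /= e -mulr_suml /x0 mulrBl mul1r subrK.
have We i : W i = 'X_i * (ze i - c) by rewrite hr ffunE addrK.
(* Pointwise [|B ze|^2 <= ze . B ze], as in [jform_ge], and the right side integrates to zero by
   orthogonality. *)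
apply: intD_dot_eq0; apply/eqP; rewrite eq_le intD_dot_ge0 andbT -(ort ze zs).
apply: intD_le => x xs; pose p i := (ze i).@[x].
have cE : c.@[x] = \sum_j x j * p j.
  by rewrite ce raddf_sum; apply: eq_bigr => j _ /=; rewrite mevalM mevalXU.
have -> : (dot W ze).@[x] = \sum_i x i * p i ^+ 2 - (\sum_j x j * p j) ^+ 2.
  rewrite /dot raddf_sum /= (eq_bigr (fun i => x i * p i ^+ 2 - c.@[x] * (x i * p i))).
    by rewrite sumrB -mulr_sumr -cE expr2.
  by move=> i _; rewrite We mevalM mevalM mevalB mevalXU -/(p i); ring.
apply: le_trans (simplex_var p xs); rewrite /dot raddf_sum; apply: ler_sum => i _ /=.
rewrite We !mevalM mevalXU mevalB cE -/(p i) -expr2 exprMn expr2 -mulrA.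
have xi0 : 0 <= x i by case: xs.
by rewrite ler_wpM2l // ler_piMl ?sqr_ge0 //; apply: simplex_le1.
Qed.

Lemma dot0l u : dot 0 u = 0.
Proof. by rewrite /dot big1 // => i _; rewrite ffunE mul0r. Qed.

(** The null vectors of the energy are the curl-free fields, and pairing with the tangent solenoidal
    [W] vanishes on them: this is the compatibility that [riesz] asks for. *)
Lemma curl_energy r W : tangent W -> vdiv W = 0 ->
  exists2 al, vsize r al & forall be, vsize r be ->
    intD (dot (curl al) (Bh (curl be))) = intD (dot W be).
Proof.
move=> tW dW; pose b u v := intD (dot (curl u) (Bh (curl v))).
have bl c u v w : b (c *: u + v) w = c * b u w + b v w.
  by rewrite /b linearP dot_linl intD_add intD_scale.
have bC u v : b u v = b v u by rewrite /b dot_Bh_sym.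
apply: (@riesz _ _ b bl bC _ (vsize r) (fun u => intD (dot W u)) _ (@inspan_form R 3 'I_3 r)).
- split=> [i|c u v ur vr i]; first by rewrite ffunE mmeasure0.
  by rewrite !ffunE; apply: msizeD => //; apply: msizeZk.
- by move=> c u v; rewrite ![dot W _]dotC dot_linl intD_add intD_scale.
- move=> k _ /Bh_form_eq0 ck; split=> [|k' _].
    rewrite (@intD_tangent_curl _ W k 0) ?linear0 // dotC dot0l linear0 //.
  by rewrite /b ck dot0l linear0.
Qed.

Lemma intD_dot_young (c : R) u v : 0 < c ->
  intD (dot u v) *+ 2 <= c * intD (dot u u) + c^-1 * intD (dot v v).
Proof.
move=> c0; rewrite /dot -!intD_scale -intD_add -mulr_natl -intD_scale.
apply: intD_le => x _; rewrite mevalD !mevalZ !raddf_sum !mulr_sumr -big_split.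
apply: ler_sum => i _ /=; rewrite !mevalM; set a := (u i).@[x]; set b := (v i).@[x].
have := mulr_ge0 (ltW c0) (sqr_ge0 (a - c^-1 * b)).
have -> : c * (a - c^-1 * b) ^+ 2 = c * (a * a) + c^-1 * (b * b) - 2 * (a * b).
  by field; rewrite gt_eqF.
by rewrite subr_ge0.
Qed.

(** The energy [Q] is the pairing of [W] with [al], and [al] may be replaced by the gauged potential
    [be] of the same curl. Young's inequality with weight [hardyC] absorbs [|be|^2 <= hardyC Q] and
    leaves [Q <= hardyC |W|^2]; the factor 6 is that of [Bh_bound]. *)
Lemma curl_solve r W : vsize r W -> tangent W -> vdiv W = 0 -> exists v,
  [/\ vsize r.-2 v, curl (Bh v) = W & intD (dot (Bh v) (Bh v)) <= 6 * hardyC R * intD (dot W W)].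
Proof.
move=> Wr tW dW; have [al alr hal] := curl_energy r.-1 tW dW.
have vs : vsize r.-2 (curl al) by apply: vsize_curl.
exists (curl al); split=> //.
  have qs : vsize r (curl (Bh (curl al))).
    (* Size bounds 0 and 1 force [al = 0]. Otherwise curl, [Bh], curl change the bound by -1, +3,
       -1, from [r - 1] back to [r]. *)
    case: r => [|[|r]] in Wr alr hal vs *.
    - have -> : al = 0 by apply/ffunP => i; rewrite ffunE; apply/msize_le0/alr.
      by move=> i; rewrite !linear0 ffunE mmeasure0.
    - have -> : al = 0 by apply/ffunP => i; rewrite ffunE; apply/msize_le0/alr.
      by move=> i; rewrite !linear0 ffunE mmeasure0.
    have := vsize_curl (vsize_Bh vs); by rewrite addn3.
  apply/eqP; rewrite -subr_eq0; apply/eqP; rewrite -scaleN1r addrC.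
  apply: (@tangent_orth_eq0 r) => [i||be ber].
  - by rewrite vecPE; apply: msizeD => //; apply: msizeZk.
  - have [hX [c e]] := tW; have [hX' [c' e']] := tangent_curl_Bh (curl al); split=> [i|].
      have [g eg] := hX i; have [g' eg'] := hX' i; exists (-1 *: g + g').
      by rewrite vecPE eg eg' mulrDr scalerAr.
    exists (-1 *: c + c'); rewrite mulrDr -scalerAr -e -e' scaler_sumr -big_split.
    by apply: eq_bigr => i _ /=; rewrite vecPE.
  rewrite dot_linl intD_add intD_scale mulN1r -hal // -dot_Bh_sym intD_curl_parts.
  by rewrite dotC addNr.
have [be cbe nbe] := gauge (vdiv_curl al).
have Q1 : intD (dot (curl al) (Bh (curl al))) = intD (dot W be).
  by rewrite hal // (intD_tangent_curl tW dW (esym cbe)).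
have c0 := hardyC_gt0 R.
have := intD_dot_young W be c0; rewrite -Q1.
have : intD (dot (Bh (curl al)) (Bh (curl al))) <= 6 * intD (dot (curl al) (Bh (curl al))).
  by rewrite -intD_scale; apply: intD_le => x xs; rewrite mevalZ Bh_bound.
have : (hardyC R)^-1 * intD (dot be be) <= intD (dot (curl al) (Bh (curl al))).
  by rewrite mulrC ler_pdivrMr // mulrC.
rewrite mulr2n; lra.
Qed.
End CurlSolve.

(** * From vector fields back to differential forms *)

Section Forms3.
Variable R : realType.
Local Notation poly := {mpoly R[3]}.
Local Notation vec := {ffun 'I_3 -> {mpoly R[3]}}.
Local Notation form := (dform R 3).
Local Notation xx := (x0 R 3).
Local Notation d0 f := (fdelta set0 f : form).

Definition oneform (q : vec) : form := \sum_i ew i (d0 (q i)).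

Lemma ew012 (f : poly) : (ew i0 (ew i1 (ew i2 (d0 f)))) setT = f.
Proof.
have sT : [set: 'I_3] :\ i0 :\ i1 :\ i2 = set0 by apply/setP; apply: ord3P; rewrite !inE.
have sT2 : [set: 'I_3] :\ i0 :\ i1 = [set i2] by apply/setP; apply: ord3P; rewrite !inE.
rewrite ffunE inE ffunE !inE /= ffunE !inE /= sT ffunE eqxx sgn_set0 scale1r.
have -> : sgn R ([set: 'I_3] :\ i0 :\ i1) i1 = 1 by rewrite sT2 sgn_set1 expr0.
rewrite scale1r (_ : sgn R ([set: 'I_3] :\ i0) i0 = 1) ?scale1r //.
rewrite /sgn (_ : #|_| = 0%N) //; apply/eqP; rewrite cards_eq0; apply/eqP/setP.
by apply: ord3P; rewrite !inE.
Qed.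

(** The Levi-Civita symbol times [f], locked so that signs come from the table [e3E] alone. *)
Let e3 a b c (f : poly) : poly := locked ((ew a (ew b (ew c (d0 f)))) setT).

Let e3N1 a b c f : e3 a b c f = - e3 b a c f.
Proof. by rewrite /e3 -!lock ewC ffunE. Qed.
Let e3N2 a b c f : e3 a b c f = - e3 a c b f.
Proof. by rewrite /e3 -!lock [ew b _]ewC linearN ffunE. Qed.
Let e3E1 a c f : e3 a a c f = 0.
Proof. by rewrite /e3 -lock ew2 ffunE. Qed.
Let e3E2 a b f : e3 a b b f = 0.
Proof. by rewrite /e3 -lock ew2 linear0 ffunE. Qed.
Let e3E3 a b f : e3 a b a f = 0.
Proof. by rewrite e3N2 e3E1 oppr0. Qed.
Let e012 f : e3 i0 i1 i2 f = f. Proof. by rewrite /e3 -lock ew012. Qed.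
Let e021 f : e3 i0 i2 i1 f = - f. Proof. by rewrite e3N2 e012. Qed.
Let e102 f : e3 i1 i0 i2 f = - f. Proof. by rewrite e3N1 e012. Qed.
Let e120 f : e3 i1 i2 i0 f = f. Proof. by rewrite e3N2 e102 opprK. Qed.
Let e201 f : e3 i2 i0 i1 f = f. Proof. by rewrite e3N1 e021 opprK. Qed.
Let e210 f : e3 i2 i1 i0 f = - f. Proof. by rewrite e3N1 e120. Qed.
Let e3E := (e012, e021, e102, e120, e201, e210, e3E1, e3E2, e3E3).

Lemma proxy_extd_oneform q i : proxy (extd (oneform q)) i = curl q i.
Proof.
have pd0 j f : pd j (d0 f) = d0 (mderiv j f).
  by apply/ffunP => I; rewrite !ffunE; case: eqP => _; rewrite ?linear0.
have -> : proxy (extd (oneform q)) i = \sum_j \sum_l e3 i j l (mderiv j (q l)).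
  rewrite /proxy extdE linear_sum sum_ffunE; apply: eq_bigr => j _ /=.
  rewrite /oneform linear_sum /= linear_sum /= linear_sum /= sum_ffunE; apply: eq_bigr => l _.
  by rewrite /e3 -lock pd_ew pd0.
by move: i; apply: ord3P; rewrite !sum3 !e3E /curl mkE !(add0r, addr0) // addrC.
Qed.

Lemma pure2_proxyP (w w' : form) : pure 2 w -> pure 2 w' -> (forall i, proxy w i = proxy w' i) -> w = w'.
Proof.
move=> wp wp' h; apply/ffunP => I; have [cI|cI] := eqVneq #|I| 2%N; last by rewrite wp // wp'.
have /eqP/cards1P [i Ii] : #|~: I| = 1%N by have := cardsC I; rewrite card_ord cI; lia.
have IE : I = setT :\ i by rewrite -[I]setCK Ii; apply/setP => j; rewrite !inE andbT.
have := h i; rewrite /proxy !ffunE inE -IE => /(congr1 (fun p => sgn R I i *: p)).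
by rewrite !scalerA !sgn_sq !scale1r.
Qed.

Lemma proxy_sq_le (w : form) i : intD (proxy w i * proxy w i) <= n2 w.
Proof.
rewrite /proxy ffunE inE -scalerAl -scalerAr scalerA sgn_sq scale1r; exact: n2_mem.
Qed.

Lemma n2_ew n (i : 'I_n) (w : dform R n) : n2 (ew i w) <= #|{set 'I_n}|%:R * n2 w.
Proof.
rewrite mulr_natl -sumr_const; apply: ler_sum => I _; rewrite ffunE.
case: ifP => _; last by rewrite mulr0 linear0 n2_ge0.
rewrite -scalerAl -scalerAr scalerA sgn_sq scale1r; exact: n2_mem.
Qed.

Lemma n2_oneform q : n2 (oneform q) <= 24 * intD (dot q q).
Proof.
apply: le_trans (n2_sum _) _; rewrite card_ord /dot intD_sum.
have -> : 24 = 3 * 8 :> R by rewrite -natrM.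
rewrite -mulrA ler_wpM2l // mulr_sumr.
apply: ler_sum => i _; apply: le_trans (n2_ew _ _) _.
have -> : #|{set 'I_3}| = 8%N by rewrite -cardsT -powersetT card_powerset cardsT card_ord.
rewrite ler_wpM2l // /n2 (bigD1 set0) //= ffunE eqxx big1 ?addr0 // => I I0.
by rewrite ffunE (negPf I0) mulr0 linear0.
Qed.

(** On [x_i = 0] the trace retains the components other than [i]; tangent vectors of the slanted
    face are spanned by differences of coordinate vectors, whence the differences of components. *)
Lemma Ztr_oneform (q : vec) : (forall i l, l != i -> exists g, q l = 'X_i * g) ->
  (forall i l, exists g, q i - q l = xx * g) -> Ztr (oneform q).
Proof.
move=> hX h0.
have D (f : poly) (F : 'I_3 -> form) : (forall l, exists z, F l = mf f z) -> exists z, \sum_l F l = mf f z.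
  move=> h; apply: (big_ind (fun w : form => exists z, w = mf f z)) => [|u w [z1 ->] [z2 ->]|l _] //.
    by exists 0; rewrite linear0.
  by exists (z1 + z2); rewrite linearD.
split=> [i|].
  rewrite /oneform linear_sum /=; apply: D => l; have [->|li] := eqVneq l i.
    by exists 0; rewrite ew2 linear0.
  have [g ->] := hX i l li; exists (ew i (ew l (d0 g))).
  by rewrite !mf_ew mf_fdelta0.
(* Subtracting [q i0] from every component changes the sum by an antisymmetric double sum, which is
   zero. *)
have -> : \sum_i ew i (oneform q) = \sum_i \sum_l ew i (ew l (d0 (q l - q i0))).
  have az := @anti_sum0 R 3 (fun i j => ew i (ew j (d0 (q i0)))) (fun i j => ewC i j _).
  rewrite -[RHS]addr0 -[X in _ = _ + X]az.
  rewrite -big_split; apply: eq_bigr => i _; rewrite /oneform linear_sum -big_split.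
  apply: eq_bigr => l _ /=; rewrite -linearD /= -linearD /=; congr (ew _ (ew _ _)).
  by apply/ffunP => I; rewrite !ffunE; case: eqP => _; rewrite ?subrK ?addr0.
apply: (D) => i; apply: (D) => l; have [g ->] := h0 l i0; exists (ew i (ew l (d0 g))).
by rewrite !mf_ew mf_fdelta0.
Qed.

Lemma Ztr_oneform_Bh v : Ztr (oneform (Bh v)).
Proof.
set s := v i0 + v i1 + v i2.
apply: Ztr_oneform.
  apply: ord3P; apply: ord3P => //; rewrite /Bh !mkE -/s => _.
  - exists (xx * 'X_i2 * v i1 + 'X_i1 * 'X_i2 * s); ring.
  - exists (xx * 'X_i1 * v i2 + 'X_i1 * 'X_i2 * s); ring.
  - exists (xx * 'X_i2 * v i0 + 'X_i0 * 'X_i2 * s); ring.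
  - exists (xx * 'X_i0 * v i2 + 'X_i0 * 'X_i2 * s); ring.
  - exists (xx * 'X_i1 * v i0 + 'X_i0 * 'X_i1 * s); ring.
  - exists (xx * 'X_i0 * v i1 + 'X_i0 * 'X_i1 * s); ring.
pose g i := (mk ('X_i1 * 'X_i2 * v i0) ('X_i0 * 'X_i2 * v i1) ('X_i0 * 'X_i1 * v i2)) i.
have gE i : Bh v i = xx * g i + 'X_i0 * 'X_i1 * 'X_i2 * s.
  by move: i; apply: ord3P; rewrite /g /Bh !mkE -/s; ring.
move=> i l; exists (g i - g l); rewrite !gE; ring.
Qed.

Lemma koszul_ew2 j l (f : poly) :
  koszul (ew j (ew l (d0 f))) = mf 'X_j (ew l (d0 f)) - mf 'X_l (ew j (d0 f)).
Proof.
have e i : mf 'X_i (io i (ew j (ew l (d0 f)))) =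
    (if i == j then mf 'X_i (ew l (d0 f)) else 0) - (if i == l then mf 'X_i (ew j (d0 f)) else 0).
  rewrite io_ew io_ew io_fdelta0 linear0 subr0 linearB /=.
  by case: eqP => _; case: eqP => _; rewrite ?linear0.
rewrite koszulE; under eq_bigr do rewrite e.
by rewrite sumrB -!big_mkcond !big_pred1_eq.
Qed.

Lemma pure_d0 (f : poly) : pure 0 (d0 f).
Proof. exact: pure_fdelta0. Qed.

Lemma Pdeg_d0 r (f : poly) : (msize f <= r)%N -> Pdeg r (d0 f).
Proof. by move=> h I; rewrite ffunE; case: eqP => _; rewrite ?mmeasure0. Qed.

Lemma Pfull_oneform r q : vsize r q -> Pfull r 1 (oneform q).
Proof.
move=> h; split; first by apply: pure_sum => i; apply/pure_ew/pure_d0.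
by apply: Pdeg_sum => i _; apply/Pdeg_ew/Pdeg_d0.
Qed.

Lemma Pfull_ew2 r j l (f : poly) : (msize f <= r)%N -> Pfull r 2 (ew j (ew l (d0 f))).
Proof.
by move=> h; split; [apply/pure_ew/pure_ew/pure_d0|apply/Pdeg_ew/Pdeg_ew/Pdeg_d0].
Qed.

(** Expanding [xx], the part of [Bh v] cubic in the weights is annihilated by contraction with [x],
    so it is a Koszul image, with explicit coefficients [h01], [h02], [h12]. The quadratic part [lo]
    has size within [r]. *)
Lemma Pminus_oneform_Bh r v : vsize r.-2 v -> Pminus r 1 (oneform (Bh v)).
Proof.
move=> vs.
pose lo : vec := mk ('X_i1 * 'X_i2 * v i0) ('X_i0 * 'X_i2 * v i1) ('X_i0 * 'X_i1 * v i2).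
pose h01 := 'X_i2 * ('X_i1 * v i0 - 'X_i0 * v i1).
pose h02 := 'X_i1 * ('X_i2 * v i0 - 'X_i0 * v i2).
pose h12 := 'X_i0 * ('X_i2 * v i1 - 'X_i1 * v i2).
have m2 i j (f : poly) : (msize f <= r.-2)%N -> (msize ('X_i * 'X_j * f)%R <= r)%N.
  case: r vs => [|[|r]] _ /= fr.
  - by rewrite (msize_le0 fr) mulr0 mmeasure0.
  - by rewrite (msize_le0 fr) mulr0 mmeasure0.
  by rewrite -mulrA; do 2!apply: msize_XM.
exists (oneform lo), (ew i0 (ew i1 (d0 h01)) + ew i0 (ew i2 (d0 h02)) + ew i1 (ew i2 (d0 h12))).
split.
- by apply: Pfull_oneform; apply: ord3P; rewrite /lo mkE; apply: m2.
- have mh i j l (a b : poly) : (msize a <= r.-2)%N -> (msize b <= r.-2)%N ->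
     (msize ('X_i * ('X_j * a - 'X_l * b))%R <= r)%N.
    by move=> ha hb; rewrite mulrBr !mulrA; apply: msizeB; apply: m2.
  by apply: PfullD; [apply: PfullD|]; apply: Pfull_ew2; apply: mh.
rewrite !linearD /= !koszul_ew2 !mf_ew !mf_fdelta0 /oneform !sum3.
have ddD (i : 'I_3) (f g : poly) : ew i (d0 (f + g)) = ew i (d0 f) + ew i (d0 g).
  by rewrite -linearD; congr ew; apply/ffunP => I; rewrite !ffunE; case: eqP => _; rewrite ?addr0.
have ddN (i : 'I_3) (f : poly) : ew i (d0 (- f)) = - ew i (d0 f).
  by rewrite -linearN; congr ew; apply/ffunP => I; rewrite !ffunE; case: eqP => _; rewrite ?oppr0.
have -> : Bh v i0 = lo i0 - ('X_i1 * h01) - ('X_i2 * h02).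
  rewrite /Bh /lo /h01 /h02 !mkE xxE; ring.
have -> : Bh v i1 = lo i1 + ('X_i0 * h01) - ('X_i2 * h12).
  rewrite /Bh /lo /h01 /h12 !mkE xxE; ring.
have -> : Bh v i2 = lo i2 + ('X_i0 * h02) + ('X_i1 * h12).
  rewrite /Bh /lo /h02 /h12 !mkE xxE; ring.
rewrite !ddD !ddN.
move: (ew i0 (d0 (lo i0))) (ew i1 (d0 (lo i1))) (ew i2 (d0 (lo i2))) (ew i0 (d0 ('X_i1 * h01)))
  (ew i0 (d0 ('X_i2 * h02))) (ew i1 (d0 ('X_i0 * h01))) (ew i1 (d0 ('X_i2 * h12)))
  (ew i2 (d0 ('X_i0 * h02))) (ew i2 (d0 ('X_i1 * h12))) => a b c p1 p2 p3 p4 p5 p6.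
apply/ffunP => I; rewrite !ffunE; ring.
Qed.

Lemma closed2_solve r (w : form) : Pfull r 2 w -> extd w = 0 -> Ztr w ->
  exists q, [/\ Pminus r 1 q, Ztr q, extd q = w & n2 q <= 24 * (6 * hardyC R * (3 * n2 w))].
Proof.
move=> [wp wr] dw Zw; pose W : vec := [ffun i => proxy w i].
have WE i : W i = proxy w i by rewrite ffunE.
have Wr : vsize r W by move=> i; rewrite WE; apply: Pdeg_ew.
have tW : tangent W.
  have [hX [c e]] := Ztr_proxy Zw; split=> [i|]; first by rewrite WE.
  by exists c; rewrite -e; apply: eq_bigr => i _; rewrite WE.
have dW : vdiv W = 0.
  have := proxy_extd w; rewrite dw ffunE => e; rewrite [RHS]e.
  by apply: eq_bigr => i _; rewrite WE.
have [v [vs cv nv]] := curl_solve Wr tW dW.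
exists (oneform (Bh v)); split.
- exact: Pminus_oneform_Bh.
- exact: Ztr_oneform_Bh.
- apply: pure2_proxyP => // [|i]; last by rewrite proxy_extd_oneform cv WE.
  by apply: pure_extd; apply: pure_sum => i; apply/pure_ew/pure_d0.
have h : intD (dot W W) <= 3 * n2 w.
  rewrite /dot sum3 !intD_add !WE.
  have := proxy_sq_le w i0; have := proxy_sq_le w i1; have := proxy_sq_le w i2; lra.
have c0 := ltW (hardyC_gt0 R); have := ler_wpM2l c0 h.
have := n2_oneform (Bh v); lra.
Qed.
End Forms3.

(** * The polynomial complexes with zero trace *)

Section SimplexSolve.
Variable R : realType.

Lemma n2_eq0 n (w : dform R n) : n2 w = 0 -> w = 0.
Proof.
move=> /eqP; rewrite psumr_eq0 => [|I _]; last exact: intD_sq_ge0.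
move=> /allP h; apply/ffunP => I; rewrite ffunE; apply: intD_sq_eq0; apply/eqP/h.
by rewrite mem_index_enum.
Qed.

Lemma n2_0 n : n2 (0 : dform R n) = 0.
Proof. by rewrite /n2 big1 // => I _; rewrite ffunE mulr0 linear0. Qed.

Lemma Pminus_pure n r k (w : dform R n) : Pminus r k w -> pure k w.
Proof. by move=> /PminusE []. Qed.

Lemma closed0_Ztr n (w : dform R n) : (0 < n)%N -> pure 0 w -> Ztr w -> extd w = 0 -> w = 0.
Proof.
move=> n0 wp Zw dw; apply: n2_eq0; apply/eqP; rewrite eq_le n2_ge0 andbT.
by have := friedrichs n0 wp Zw; rewrite dw n2_0 mulr0.
Qed.

(** The common interface of the three solvers: the constant is fixed before the degree bound [r],
    and zero mean is asked only in top degree. *)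
Lemma simplex_solve m k : (k < m <= 3)%N -> exists2 C : R, 0 <= C &
  forall r (b : dform R m), Pfull r k.+1 b -> extd b = 0 -> Ztr b ->
  (k.+1 = m -> intD (b setT) = 0) ->
  exists q, [/\ Pminus r k q, Ztr q, extd q = b & n2 q <= C * n2 b].
Proof.
have top j : exists2 C : R, 0 <= C &
  forall r (b : dform R j.+1), Pfull r j.+1 b -> extd b = 0 -> Ztr b ->
  (j.+1 = j.+1 -> intD (b setT) = 0) ->
  exists q, [/\ Pminus r j q, Ztr q, extd q = b & n2 q <= C * n2 b].
  exists (j.+1%:R * #|{set 'I_j.+1}|%:R); first by rewrite mulr_ge0.
  by move=> r b hb _ _ b0; apply: top_solve => //; apply: b0.
have low j : (1 < j)%N -> exists2 C : R, 0 <= C &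
  forall r (b : dform R j), Pfull r 1 b -> extd b = 0 -> Ztr b ->
  (1%N = j -> intD (b setT) = 0) ->
  exists q, [/\ Pminus r 0 q, Ztr q, extd q = b & n2 q <= C * n2 b].
  move=> j1; exists 4 => // r b hb db Zb _.
  have [q [q1 q2 q3]] := closed1_solve j1 hb db Zb; exists q; split=> //.
  by rewrite -q3; apply: friedrichs => //; [apply: ltnW|apply: Pminus_pure q1].
case: m => [|[|[|[|m]]]]; case: k => [|[|[|k]]]; rewrite ?andbF //= => _.
- exact: (low 2%N).
- exact: (low 3%N).
- exists (24 * (6 * hardyC R * 3)); first by have := hardyC_gt0 R; lra.
  move=> r b hb db Zb _; have [q [q1 q2 q3 q4]] := closed2_solve hb db Zb.
  exists q; split=> //; lra.
Qed.

Lemma Pminus0 n k (w : dform R n) : Pminus 0 k w -> w = 0.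
Proof.
by move=> [a [b [[_ /Pdeg0 ->] [_ /Pdeg0 ->] ->]]]; rewrite [koszul 0]linear0 addr0.
Qed.

Section Xcx.
Variables (n : nat) (c : nat -> bool) (p : nat).
Implicit Types w u : dform R n.
Local Notation X := (@Xcx R n c p).

Lemma nfull0 : nfull c 0 = 0%N.
Proof. by rewrite /nfull big_geq. Qed.
Lemma nfullS k : nfull c k.+1 = (nfull c k + c k.+1)%N.
Proof. by rewrite /nfull big_nat_recr. Qed.

Lemma XcxP k a u w : X k u -> X k w -> X k (a *: u + w).
Proof.
rewrite /Xcx; case: ifP => _; first by move=> *; apply: PfullD => //; apply: PfullZ.
case: ifP => _; first by move=> *; apply: PfullD => //; apply: PfullZ.
by move=> *; apply: PminusD => //; apply: PminusZ.
Qed.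

Lemma Xcx0 k : X k 0.
Proof.
rewrite /Xcx; case: ifP => _; first exact: Pfull0.
by case: ifP => _; [|apply: Pfull_minus]; apply: Pfull0.
Qed.

(** The first-kind space is the smaller of the two choices for a step, so a potential found in it
    fits every complex. *)
Lemma Pminus_Xcx k w : Pminus (p - nfull c k) k w -> X k w.
Proof.
rewrite /Xcx; case: eqP => [->|_]; first by rewrite nfull0 subn0; apply: PminusE.
case: ifP => // _; have [pN|pN] := leqP (nfull c k) p.
  by rewrite subSn //; apply: PminusE.
(* Beyond [p] the truncated bounds [p.+1 - nfull c k] and [(p - nfull c k).+1] no longer agree, but
   the first-kind space is then zero. *)
have -> : (p - nfull c k = 0)%N by apply/eqP; rewrite subn_eq0 ltnW.
by move=> /Pminus0 ->; apply: Pfull0.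
Qed.

Lemma Xcx_pure k w : X k w -> pure k w.
Proof.
rewrite /Xcx; case: eqP => [->|_]; first by case.
by case: ifP => _; [case|apply: Pminus_pure].
Qed.

Lemma Xcx_Pdeg k w : X k w -> Pdeg (p - nfull c k).+1 w.
Proof.
rewrite /Xcx; case: eqP => [->|_]; first by rewrite nfull0 subn0; case.
case: ifP => _; last by move=> /PminusE [].
by case=> _; apply: Pdeg_le; lia.
Qed.

Lemma Xcx_extd k w : X k w -> Pfull (p - nfull c k) k.+1 (extd w).
Proof.
move=> h; split; first exact/pure_extd/Xcx_pure.
exact: (Pdeg_extd (Xcx_Pdeg h)).
Qed.

(** At a full step [nfull] grows by one and cancels the extra size; at a first-kind step
    [Pminus_closed] removes it. Either way the datum has the size that the solver expects. *)
Lemma Xcx_closed k w : X k.+1 w -> extd w = 0 -> Pfull (p - nfull c k) k.+1 w.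
Proof.
rewrite /Xcx /= nfullS; case: (c k.+1); first by rewrite addn1 subSS.
by rewrite addn0 => h; apply: Pminus_closed.
Qed.

Lemma Xcx_exact k w : (k < n <= 3)%N -> X k.+1 w -> extd w = 0 -> Ztr w ->
  (k.+1 = n -> intD (w setT) = 0) -> exists q, [/\ X k q, Ztr q & extd q = w].
Proof.
move=> kn Xw dw Zw w0; have [C _ hC] := simplex_solve kn.
have [q [q1 q2 q3 _]] := hC _ _ (Xcx_closed Xw dw) dw Zw w0.
by exists q; split=> //; apply: Pminus_Xcx.
Qed.

End Xcx.

Lemma Xcx_potential n k : (k < n <= 3)%N -> exists2 C : R, 0 <= C &
  forall c p (w : dform R n), Xcx c p k w -> Ztr w ->
  exists q, [/\ Xcx c p k q, Ztr q, extd q = extd w & n2 q <= C * n2 (extd w)].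
Proof.
move=> kn; have [C C0 hC] := simplex_solve kn; exists C => // c p w Xw Zw.
have [|q [q1 q2 q3 q4]] := hC _ _ (Xcx_extd Xw) (extd2 w) (Ztr_extd Zw).
  by move=> _; apply: stokes.
by exists q; split=> //; apply: Pminus_Xcx.
Qed.

End SimplexSolve.

(** * Traces on faces *)

Section Facet.
Variables (R : realType) (m m' : nat).
Local Notation form := (dform R m).
Variables (b : 'cV[R]_m) (Z : 'M[R]_(m, m')) (br : 'cV[R]_m') (Ar : 'M[R]_(m', m)).
Variables (l : {mpoly R[m]}) (c : 'I_m -> R) (n : 'I_m -> R).
Hypothesis lf : l \mPo affp b Z = 0.
Hypothesis dl : forall i, mderiv i l = (c i)%:MP.
Hypothesis proj : forall i, tnth (affp (b + Z *m br) (Z *m Ar)) i = 'X_i - n i *: l.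
Hypothesis cn : \sum_i c i * n i = 1.

Let cZ i : \sum_(k < m) Z k i * c k = 0.
Proof.
have := mderiv_affp l b Z i; rewrite lf linear0.
under eq_bigr do rewrite dl comp_mpolyC -mul_mpolyC -mpolyCM.
by rewrite -rmorph_sum /= => /eqP; rewrite eq_sym mpolyC_eq0 => /eqP.
Qed.

Let ZAr i j : (Z *m Ar) i j = (i == j)%:R - n i * c j.
Proof.
have := congr1 (mderiv j) (proj i); rewrite mderivB mderivZ dl mderivXi.
have -> : tnth (affp (b + Z *m br) (Z *m Ar)) i = 'X_i \mPo affp (b + Z *m br) (Z *m Ar).
  by rewrite comp_mpolyXU -tnth_nth.
rewrite mderiv_affp (bigD1 i) //= mderivXi eqxx comp_mpolyC mpolyC1 big1 ?addr0; last first.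
  by move=> k ki; rewrite mderivXi (negPf ki) mpolyC0 linear0 scaler0.
rewrite -mul_mpolyC -mul_mpolyC mulr1 -mpolyCM -mpolyCB => /eqP.
by rewrite mpolyC_eq eq_sym [j == i]eq_sym => /eqP.
Qed.

Let wedge1_ew i (a : form) : wedge1 c (ew i a) = - ew i (wedge1 c a).
Proof.
rewrite /wedge1 linear_sum -sumrN; apply: eq_bigr => j _ /=.
by rewrite ewC linearZ scalerN.
Qed.

(** The projection has matrix [1 - n dl], so it changes [dx_i] by a multiple of [dl], which wedging
    with [dl] kills. *)
Let wedge1_Lam (u : form) : wedge1 c (Lam (Z *m Ar) u) = wedge1 c u.
Proof.
elim/gform_ind: u => [v|i u IH|u w IHu IHw|a w IHw].
- by rewrite Lam_fdelta0.
- rewrite Lam_ew; under eq_bigr do rewrite ZAr scalerBl -scalerA.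
  rewrite sumrB (bigD1 i) //= eqxx scale1r big1 ?addr0; last first.
    by move=> j ji; rewrite eq_sym (negPf ji) scale0r.
  rewrite -scaler_sumr -/(wedge1 c _) -scaleN1r addrC scalerA.
  by rewrite linearP /= wedge1_sq scaler0 add0r !wedge1_ew IH.
- by rewrite !linearD /= IHu IHw.
- by rewrite !linearZ /= IHw.
Qed.

(** Contraction with [n] is a homotopy for wedging with [dl], since [dl(n) = 1]. *)
Let split_id (a : form) :
  a = \sum_i n i *: io i (wedge1 c a) + wedge1 c (\sum_i n i *: io i a).
Proof.
have -> : wedge1 c (\sum_i n i *: io i a) = \sum_i \sum_j (n i * c j) *: ew j (io i a).
  rewrite linear_sum; apply: eq_bigr => i _; rewrite linearZ /= scaler_sumr.
  by apply: eq_bigr => j _; rewrite scalerA.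
rewrite -big_split /= -[LHS]scale1r -cn scaler_suml; apply: eq_bigr => i _.
rewrite linear_sum scaler_sumr -big_split (bigD1 i) //= big1 => [|j ji].
  by rewrite linearZ /= io_ew eqxx scalerA -scalerDr subrK mulrC addr0.
by rewrite linearZ /= io_ew eq_sym (negPf ji) scalerA -scalerDr sub0r addNr scaler0.
Qed.

(* The forward direction transports [a] by the projection along [n] onto the hyperplane [l = 0]. *)
Lemma pull_facet (a : form) : pull b Z a = 0 <-> exists z, wedge1 c a = mf l z.
Proof.
split=> [h|[z e]]; last first.
  rewrite (split_id a) linearD /= [X in X + _]linear_sum big1 ?add0r => [|i _]; last first.
    by rewrite e linearZ /= -mf_io pull_mf lf mf0l scaler0.
  set u := \sum_i n i *: io i a; rewrite /wedge1 linear_sum /=.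
  under eq_bigr do rewrite linearZ /= pull_ew scaler_sumr.
  rewrite exchange_big big1 // => i _ /=; under eq_bigr do rewrite scalerA mulrC.
  by rewrite -scaler_suml cZ scale0r.
have h2 : pull (b + Z *m br) (Z *m Ar) a = 0 by rewrite -pullM h linear0.
pose a' : form := [ffun J => a J \mPo affp (b + Z *m br) (Z *m Ar)].
have wa' : wedge1 c a' = 0 by rewrite -wedge1_Lam -/(pull _ _ a) h2 linear0.
(* The projection fixes the hyperplane pointwise, so composing a coefficient with it changes it by a
   multiple of [l]. *)
have /fin_all_exists [g hg] : forall J, exists g, a J - a' J = l * g.
  move=> J; rewrite ffunE -[X in X - _]affp_id; apply: comp_ideq => i; exists (n i)%:MP.
  have -> : tnth (affp 0 1%:M) i = 'X_i :> {mpoly R[m]}.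
    by have := affp_id ('X_i : {mpoly R[m]}); rewrite comp_mpolyXU -tnth_nth.
  by rewrite proj opprB addrC subrK -mul_mpolyC mulrC.
exists (wedge1 c [ffun J => g J]); rewrite mf_wedge1.
have -> : a = a' + mf l [ffun J => g J].
  by apply/ffunP => J; rewrite ffunE [X in _ + X]ffunE [X in l * X]ffunE -hg addrC subrK.
by rewrite linearD /= wa' add0r.
Qed.

End Facet.

Section StdFaces.
Variable R : realType.

(* The vertices of the unit simplex of [R^m] are numbered [0, e_1, ..., e_m]. *)
Definition ucol m (j : nat) : 'cV[R]_m := \col_q ((q.+1)%N == j)%:R.
(** [bump i] lists the vertices other than [i] in increasing order, the order in which [parA] takes
    those of [S :\ x]. *)
Definition face_Z m m' (i : nat) : 'M[R]_(m, m') :=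
  \matrix_(q, r) (ucol m (bump i r.+1) q 0 - ucol m (bump i 0) q 0).
Definition face_b m (i : nat) : 'cV[R]_m := ucol m (bump i 0).

Lemma tnth_affpX m m' (b : 'cV[R]_m) (Z : 'M[R]_(m, m')) i :
  'X_i \mPo affp b Z = tnth (affp b Z) i.
Proof. by rewrite comp_mpolyXU -tnth_nth. Qed.

Lemma pull_faceS m (j : 'I_m.+1) (a : dform R m.+1) :
  pull (face_b m.+1 j.+1) (face_Z m.+1 m j.+1) a = 0 <-> exists z, ew j a = mf 'X_j z.
Proof.
rewrite -wedge1_delta.
have bE : face_b m.+1 j.+1 = 0.
  by apply/matrixP => q r; rewrite !mxE /bump ltn0 add0n.
have ZE q r : face_Z m.+1 m j.+1 q r = (q == lift j r)%:R.
  rewrite !mxE /bump ltn0 add0n subr0 -val_eqE /= /bump ltnS.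
  by rewrite addnS eqSS.
apply: (@pull_facet _ _ _ _ _ 0 (\matrix_(r, q) (q == lift j r)%:R) _ _ (fun q => (q == j)%:R)).
- rewrite tnth_affpX tnth_affp bE mxE mpolyC0 add0r big1 // => r _.
  by rewrite ZE (negPf (neq_lift _ _)) scale0r.
- exact: mderivXi.
- move=> q; rewrite mulmx0 addr0 bE tnth_affp mxE mpolyC0 add0r.
  have zz k : (face_Z m.+1 m j.+1 *m \matrix_(r, q) (q == lift j r)%:R) q k = ((q == k) && (q != j))%:R.
    rewrite mxE; under eq_bigr do rewrite ZE mxE -natrM mulnb.
    case: (unliftP j q) => [r ->|->].
      rewrite (bigD1 r) //= eqxx eq_sym [lift j r == j]eq_sym neq_lift andbT andTb big1 ?addr0 // => s sr.
      by rewrite (inj_eq lift_inj) eq_sym (negPf sr).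
    by rewrite eqxx andbF big1 // => r _; rewrite (negPf (neq_lift _ _)).
  under eq_bigr do rewrite zz.
  rewrite (bigD1 q) //= eqxx andTb big1 ?addr0 => [|k kq]; last by rewrite eq_sym (negPf kq) scale0r.
  by case: eqP => [->|_]; rewrite ?scale0r ?scale1r ?subrr ?subr0.
- rewrite (bigD1 j) //= eqxx mulr1 big1 ?addr0 // => q /negPf ->; exact: mulr0.
Qed.

Lemma pull_face0 m (a : dform R m.+1) :
  pull (face_b m.+1 0) (face_Z m.+1 m 0) a = 0 <-> exists z, \sum_i ew i a = mf (x0 R m.+1) z.
Proof.
have -> : (exists z, \sum_i ew i a = mf (x0 R m.+1) z) <->
   exists z, wedge1 (fun=> -1) a = mf (x0 R m.+1) z.
  rewrite wedge1_N1; split=> [[z ->]|[z e]]; first by exists (- z); rewrite linearN.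
  by exists (- z); rewrite linearN /= -e opprK.
have bE q : face_b m.+1 0 q 0 = (q == ord0)%:R.
  by rewrite mxE /bump leqnn eqSS.
have ZE q r : face_Z m.+1 m 0 q r = (q == lift ord0 r)%:R - (q == ord0)%:R.
  by rewrite !mxE /bump !leq0n !add1n !eqSS.
have s0 : \sum_(q < m.+1) tnth (affp (face_b m.+1 0) (face_Z m.+1 m 0)) q = 1.
  under eq_bigr do rewrite tnth_affp bE.
  rewrite big_split /= [X in _ + X]exchange_big (bigD1 ord0) //= ?eqxx mpolyC1.
  rewrite big1 ?addr0 => [|q /negPf ->]; last exact: mpolyC0.
  rewrite big1 ?addr0 // => r _; rewrite -scaler_suml.
  under eq_bigr do rewrite ZE.
  rewrite sumrB (bigD1 (lift ord0 r)) //= eqxx big1 => [|q /negPf ->//].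
  by rewrite (bigD1 ord0) //= ?eqxx big1 => [|q /negPf ->//]; rewrite subrr scale0r.
apply: (@pull_facet _ _ _ _ _ 0 (\matrix_(r, q) (q == lift ord0 r)%:R) _ _ (fun q => - (q == ord0)%:R)).
- rewrite /x0 rmorphB rmorph1 rmorph_sum /=; under eq_bigr do rewrite tnth_affpX.
  by rewrite s0 subrr.
- exact: mderiv_x0.
- move=> q; rewrite mulmx0 addr0 tnth_affp bE.
  have zz k : (face_Z m.+1 m 0 *m \matrix_(r, q) (q == lift ord0 r)%:R) q k =
      ((q == k) && (k != ord0))%:R - ((q == ord0) && (k != ord0))%:R.
    rewrite mxE; under eq_bigr do rewrite ZE mxE.
    case: (unliftP ord0 k) => [r ->|->].
      rewrite (bigD1 r) //= eqxx mulr1 !andbT big1 ?addr0 // => s sr.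
      have /negPf -> : lift ord0 r != lift ord0 s by rewrite (inj_eq lift_inj) eq_sym.
      exact: mulr0.
    rewrite eqxx !andbF subrr big1 // => r _.
    by rewrite (negPf (neq_lift _ _)) mulr0.
  under eq_bigr do rewrite zz scalerBl.
  rewrite sumrB.
  have e1 : \sum_(k < m.+1) ((q == k) && (k != ord0))%:R *: 'X_k = (q != ord0)%:R *: 'X_q :> {mpoly R[m.+1]}.
    rewrite (bigD1 q) //= eqxx big1 ?addr0 // => k kq.
    by rewrite eq_sym (negPf kq) scale0r.
  have e2 : \sum_(k < m.+1) ((q == ord0) && (k != ord0))%:R *: 'X_k =
     (q == ord0)%:R *: (\sum_k 'X_k - 'X_ord0) :> {mpoly R[m.+1]}.
    case: eqP => _ /=; last by rewrite big1 ?scale0r // => k _; rewrite scale0r.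
    rewrite scale1r (bigD1 ord0) //= scale0r add0r [in RHS](bigD1 ord0) //= addrC addrK.
    by apply: eq_bigr => k ->; rewrite scale1r.
  rewrite e1 e2 /x0 scaleNr opprK.
  case: eqP => [->|_]; rewrite /= ?mpolyC0 ?scale0r ?mpolyC1 ?scale1r ?subr0 ?addr0 ?add0r //.
  by rewrite opprB addrCA.
- rewrite (bigD1 ord0) //= ?eqxx mulrNN mulr1 big1 ?addr0 // => q /negPf ->.
  by rewrite oppr0 mulr0.
Qed.

Lemma Ztr_faces m (a : dform R m.+1) :
  Ztr a <-> forall i, (i <= m.+1)%N -> pull (face_b m.+1 i) (face_Z m.+1 m i) a = 0.
Proof.
split=> [[hX h0] [|i] im|h]; first exact: (proj2 (pull_face0 a)).
  exact: (proj2 (pull_faceS (Ordinal im) a) (hX _)).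
split=> [i|]; first by apply: (proj1 (pull_faceS i a)); apply: h; exact: ltn_ord.
by apply: (proj1 (pull_face0 a)); apply: h.
Qed.

End StdFaces.

(** * Equilateral simplices *)

Section Geometry.
Variables (R : realType) (d : nat) (vt : 'I_d.+1 -> 'rV[R]_d).
Implicit Types (S F : {set 'I_d.+1}) (w : dform R d).

Definition parb S : 'cV[R]_d := \col_i (nth 0 (svert vt S) 0) 0 i.

Definition tr m S w : dform R m := pull (parb S) (parA vt S m) w.

Lemma traceE S w : trace vt S w = tr (dimS S) S w.
Proof.
have e m : paraff vt S m = affp (parb S) (parA vt S m).
  by apply: eq_from_tnth => i; rewrite tnth_affp tnth_mktuple mxE.
apply/ffunP => I; rewrite [LHS]ffunE [RHS]ffunE; apply: eq_bigr => J _.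
by rewrite ffunE e.
Qed.

Lemma vertex_col m S j : (j <= m)%N -> parb S + parA vt S m *m ucol R m j = \col_i (nth 0 (svert vt S) j) 0 i.
Proof.
case: j => [_|j jm].
  rewrite (_ : ucol R m 0 = 0) ?mulmx0 ?addr0 //.
  by apply/matrixP => q r; rewrite !mxE.
apply/matrixP => i r; rewrite !mxE (bigD1 (Ordinal jm)) //= big1 => [|q qj].
  by rewrite !mxE /= eqxx mulr1 addr0 addrC subrK.
by rewrite !mxE eqSS -[j]/(val (Ordinal jm)) val_eqE (negPf qj) mulr0.
Qed.

Lemma svert_setD1 S x j : x \in S ->
  nth 0 (svert vt (S :\ x)) j = nth 0 (svert vt S) (bump (index x (enum S)) j).
Proof.
move=> xS; have xs : (index x (enum S) < size (enum S))%N by rewrite index_mem mem_enum.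
rewrite /svert enum_setD1 // -nth_delnth ?size_map //; congr nth.
by rewrite /delnth map_cat map_take map_drop.
Qed.

Lemma tr_setD1 m S x w : x \in S -> #|S| = m.+2 ->
  tr m (S :\ x) w =
  pull (face_b R m.+1 (index x (enum S))) (face_Z R m.+1 m (index x (enum S))) (tr m.+1 S w).
Proof.
move=> xS cS; set i := index _ _.
have im : (i < m.+2)%N by rewrite -cS cardE index_mem mem_enum.
have eb : parb S + parA vt S m.+1 *m face_b R m.+1 i = parb (S :\ x).
  rewrite /face_b vertex_col; last by rewrite /bump; case: (i).
  by apply/matrixP => q r; rewrite !mxE svert_setD1.
suff eA : parA vt S m.+1 *m face_Z R m.+1 m i = parA vt (S :\ x) m by rewrite /tr pullM eb eA.
apply/esym/matrixP => q r; rewrite [LHS]mxE !svert_setD1 // -/i.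
have v j : (j <= m.+1)%N -> nth 0 (svert vt S) j 0 q = (parb S + parA vt S m.+1 *m ucol R m.+1 j) q 0.
  by move=> jm; rewrite vertex_col // mxE.
have b1 : (bump i r.+1 <= m.+1)%N by rewrite /bump; have := ltn_ord r; case: leqP => /=; lia.
have b0 : (bump i 0 <= m.+1)%N by rewrite /bump; case: (i).
rewrite !v // !mxE opprD addrACA subrr add0r -sumrB.
by apply: eq_bigr => k _; rewrite !mxE mulrBr.
Qed.

Lemma subset_pred_card S F : F \subset S -> (0 < #|S|)%N -> #|F| = #|S|.-1 ->
  exists2 x, x \in S & F = S :\ x.
Proof.
move=> FS S0 cF; have /cards1P [x ex] : #|S :\: F| == 1%N.
  by rewrite cardsD (setIidPr FS) cF; apply/eqP; lia.
have xD : x \in S :\: F by rewrite ex set11.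
exists x; first by move: xD; rewrite inE => /andP [].
by rewrite -ex setDDr setDv set0U (setIidPr FS).
Qed.

Lemma trace0_dim m S w : dimS S = m -> trace vt S w = 0 <-> tr m S w = 0.
Proof. by move=> <-; rewrite traceE. Qed.

Lemma bdry_trace0_Ztr m S w : #|S| = m.+2 -> bdry_trace0 vt S w <-> Ztr (tr m.+1 S w).
Proof.
move=> cS; split=> [h|/Ztr_faces h F FS cF F0].
  apply/Ztr_faces => i im; have iS : (i < size (enum S))%N by rewrite -cardE cS.
  have [y _] : exists y, y \in S by apply/card_gt0P; rewrite cS.
  pose x := nth y (enum S) i.
  have xS : x \in S by rewrite -mem_enum mem_nth.
  have cx : #|S :\ x| = m.+1 by move: cS; rewrite (cardsD1 x) xS => -[].
  have ix : index x (enum S) = i by rewrite index_uniq ?enum_uniq.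
  rewrite -ix -tr_setD1 //; apply/trace0_dim; first by rewrite /dimS cx.
  by apply: h; rewrite ?subsetDl // cx ?cS.
have [|x xS eF] := subset_pred_card FS _ cF; first by rewrite cS.
subst F; apply/(@trace0_dim m); first by rewrite /dimS cF cS.
rewrite (tr_setD1 _ xS cS); apply: h.
have : (index x (enum S) < #|S|)%N by rewrite cardE index_mem mem_enum.
by rewrite cS.
Qed.

Hypothesis heq : equilateral vt.

Definition gram S m : 'M[R]_m := (parA vt S m)^T *m parA vt S m.

(** All squared edge lengths equal some [L]; polarization at the first vertex gives [L] on the
    diagonal and [L / 2] off it, so the witness is [L / 2]. *)
Lemma gram_equilateral : exists2 h : R, 0 < h &
  forall S m, #|S| = m.+1 -> gram S m = h *: (1%:M + const_mx 1).
Proof.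
have [h [h0 hv]] := heq; exists (h / 2) => [|S m cS]; first by rewrite divr_gt0.
apply/matrixP => a b; rewrite !mxE.
have [y _] : exists y, y \in S by apply/card_gt0P; rewrite cS.
pose e j := nth y (enum S) j.
have ve j : (j <= m)%N -> nth 0 (svert vt S) j = vt (e j).
  by move=> jm; rewrite (nth_map y) // -cardE cS.
have ee i j : (i <= m)%N -> (j <= m)%N -> i != j -> e i != e j.
  by move=> im jm ij; rewrite nth_uniq ?enum_uniq // -cardE cS.
under eq_bigr do rewrite !mxE !ve //.
have := ltn_ord a; have := ltn_ord b => bm am.
have ha := hv _ _ (ee a.+1 0%N am (leq0n _) isT).
have hb := hv _ _ (ee b.+1 0%N bm (leq0n _) isT).
case: (eqVneq a b) => [ab|ab].
  rewrite mulr1n; rewrite -{1}ab mulrDr mulr1 -splitr -[RHS]ha; apply: eq_bigr => l _.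
  by rewrite !mxE expr2 ab.
have hab := hv _ _ (ee a.+1 b.+1 am bm ab).
rewrite mulr0n add0r mulr1.
have -> : h / 2 = (h + h - h) / 2 by rewrite addrK.
rewrite -{1}ha -{1}hb -hab -big_split -sumrB /= mulr_suml; apply: eq_bigr => l _.
by rewrite !mxE; field.
Qed.

Let J m : 'M[R]_m := const_mx 1.
Let JJ m : J m *m J m = m%:R *: J m.
Proof.
apply/matrixP => i j; rewrite !mxE; under eq_bigr do rewrite !mxE mulr1.
by rewrite sumr_const card_ord mulr1.
Qed.

(** Sherman-Morrison: the inverse of [1 + J] is [1 - J / (m + 1)]. *)
Lemma gram_unit S m : #|S| = m.+1 -> gram S m \in unitmx.
Proof.
have [h h0 hG] := gram_equilateral; move=> /hG ->.
suff /mulmx1_unit [] : (h *: (1%:M + J m)) *m (h^-1 *: (1%:M - m.+1%:R^-1 *: J m)) = 1%:M by [].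
rewrite -scalemxAl -scalemxAr scalerA divff ?gt_eqF // scale1r.
rewrite mulmxDl mul1mx mulmxBr mulmx1 -scalemxAr JJ scalerA.
have : m.+1%:R != 0 :> R by rewrite pnatr_eq0.
rewrite -natr1 => m1; apply/matrixP => i j; rewrite !mxE; set e := 1 *+ _.
by field.
Qed.

Lemma gram_sym S m : (gram S m)^T = gram S m.
Proof. by rewrite /gram trmx_mul trmxK. Qed.

(* A square root of [1 + J] is [1 + t J] with [m t^2 + 2 t = 1]. *)
Lemma gram_det_gt0 S m : #|S| = m.+1 -> 0 < \det (gram S m).
Proof.
move=> cS; have gu := gram_unit cS.
have [h h0 hG] := gram_equilateral.
rewrite lt0r; move: gu; rewrite unitmxE unitfE => -> /=; rewrite (hG _ _ cS).
pose r : R := Num.sqrt m.+1%:R; pose t : R := (1 + r)^-1.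
have r0 : 0 <= r by exact: sqrtr_ge0.
have r2 : r ^+ 2 = m%:R + 1 by rewrite sqr_sqrtr // natr1.
have tE : m%:R * t ^+ 2 + 2 * t = 1.
  have -> : m%:R = r ^+ 2 - 1 by rewrite r2 addrK.
  by rewrite /t; field; rewrite gt_eqF // ltr_pwDl.
pose N := Num.sqrt h *: (1%:M + t *: J m).
have -> : h *: (1%:M + const_mx 1) = N *m N; last by rewrite det_mulmx -expr2 sqr_ge0.
rewrite -scalemxAl -scalemxAr scalerA -expr2 sqr_sqrtr ?(ltW h0) //; congr (_ *: _).
rewrite mulmxDl mul1mx mulmxDr mulmx1 -scalemxAl -scalemxAr JJ !scalerA -addrA -!scalerDl.
by rewrite (_ : t + (t + t * t * m%:R) = 1) ?scale1r //; rewrite -[RHS]tE; ring.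
Qed.

(** A left inverse of the parametrization whose product with its transpose is the inverse Gram
    matrix; that identity turns the weighted inner product into a Euclidean one. *)
Definition linv S m : 'M[R]_(m, d) := invmx (gram S m) *m (parA vt S m)^T.

Lemma linvK S m : #|S| = m.+1 -> linv S m *m parA vt S m = 1%:M.
Proof. by move=> cS; rewrite -mulmxA mulVmx ?gram_unit. Qed.

Lemma linv_tr S m : #|S| = m.+1 -> linv S m *m (linv S m)^T = invmx (gram S m).
Proof.
move=> cS; rewrite /linv trmx_mul trmxK trmx_inv gram_sym mulmxA -[X in X *m _]mulmxA.
by rewrite mulVmx ?gram_unit // mul1mx.
Qed.

(** Extension from the plane of [S] by an affine projection. Being a pullback, it preserves the
    polynomial spaces, so traces are onto. *)
Definition ext m S (a : dform R m) : dform R d := pull (- (linv S m *m parb S)) (linv S m) a.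

Lemma extK m S (a : dform R m) : #|S| = m.+1 -> tr m S (ext S a) = a.
Proof. by move=> cS; rewrite /tr /ext pullM linvK // addNr pull1. Qed.

End Geometry.

(** * Cauchy-Binet and the equivalence of inner products *)

Section Minor.
Variable R : realType.

Lemma minor_tr a b (A : 'M[R]_(a, b)) (I : {set 'I_b}) (J : {set 'I_a}) :
  #|I| = #|J| -> minor A^T I J = minor A J I.
Proof.
move=> IJ; have [I0|[i0 iI]] := set_0Vmem I.
  have J0 : J = set0 by apply/eqP; rewrite -cards_eq0 -IJ I0 cards0.
  have d0 n (M : 'M[R]_n) : n = 0%N -> \det M = 1 by move=> n0; subst n; exact: det_mx00.
  by rewrite /minor !d0 // ?I0 ?J0 cards0.
have [j0 jJ] : exists j, j \in J by apply/card_gt0P; rewrite -IJ; apply/card_gt0P; exists i0.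
rewrite (@minor_nth _ _ _ _ i0 j0 _ _ #|J|) // (@minor_nth _ _ _ _ j0 i0 _ _ #|J|) //.
by rewrite -det_tr; congr (\det _); apply/matrixP => x y; rewrite !mxE.
Qed.

Lemma Lam_fdelta a b (V : lmodType R) (A : 'M[R]_(a, b)) (I : {set 'I_a}) (J : {set 'I_b}) (v : V) :
  #|I| = #|J| -> Lam A (fdelta I v) J = minor A I J *: v.
Proof.
move=> IJ; rewrite ffunE (bigD1 I) ?IJ //= ffunE eqxx big1 ?addr0 // => L /andP [_ LI].
by rewrite ffunE (negPf LI) scaler0.
Qed.

Lemma cauchy_binet a b c (A : 'M[R]_(a, b)) (B : 'M[R]_(b, c)) (I : {set 'I_a}) (J : {set 'I_c}) :
  #|I| = #|J| ->
  minor (A *m B) I J = \sum_(K : {set 'I_b} | #|K| == #|J|) minor A I K * minor B K J.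
Proof.
move=> IJ; rewrite -[LHS]mulr1 -[LHS]/(_ *: (1 : R^o)) -Lam_fdelta // -LamM ffunE.
apply: eq_bigr => K /eqP KJ; rewrite Lam_fdelta ?KJ //.
by rewrite [_ *: 1]mulr1 [_ *: _]mulrC.
Qed.

Lemma Lam_bound a b m (A : 'M[R]_(a, b)) : exists2 C : R, 0 <= C &
  forall w : {ffun {set 'I_a} -> {mpoly R[m]}},
  \sum_I intD (Lam A w I * Lam A w I) <= C * \sum_J intD (w J * w J).
Proof.
exists (\sum_(I : {set 'I_b}) (#|{set 'I_a}|%:R * \sum_(J : {set 'I_a}) (minor A J I) ^+ 2)).
  by apply: sumr_ge0 => I _; apply: mulr_ge0 => //; apply: sumr_ge0 => J _; apply: sqr_ge0.
move=> w; rewrite mulr_suml; apply: ler_sum => I _.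
rewrite ffunE big_mkcond /=; apply: le_trans (intD_sqr_sum_le _) _.
rewrite -mulrA ler_wpM2l // mulr_suml; apply: ler_sum => J _.
have wJ : intD (w J * w J) <= \sum_K intD (w K * w K).
  by rewrite (bigD1 J) //= lerDl; apply: sumr_ge0 => K _; apply: intD_sq_ge0.
case: ifP => _; last first.
  by rewrite mul0r linear0 mulr_ge0 ?sqr_ge0 //; apply: sumr_ge0 => K _; apply: intD_sq_ge0.
by rewrite -scalerAl -scalerAr scalerA intD_scale -expr2 ler_wpM2l ?sqr_ge0.
Qed.

End Minor.

Section InnerProduct.
Variables (R : realType) (d m : nat) (G : 'M[R]_m) (M : 'M[R]_(m, d)) (A : 'M[R]_(d, m)).
Hypothesis MM : M *m M^T = invmx G.
Implicit Types u v w : dform R m.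

(** Cauchy-Binet for [M *m M^T] writes the minors of the inverse Gram matrix as sums over [K];
    symmetry and positivity of the inner product then become visible. *)
Lemma ipG_Lam k u v :
  ipG G k u v = Num.sqrt (\det G) *
    \sum_(K : {set 'I_d} | #|K| == k) intD (Lam M u K * Lam M v K).
Proof.
rewrite /ipG -intD_sum; congr (_ * intD _).
have e (K : {set 'I_d}) : #|K| == k -> Lam M u K * Lam M v K =
    \sum_(I : {set 'I_m} | #|I| == k) \sum_(J : {set 'I_m} | #|J| == k)
      minor M I K *: u I * (minor M J K *: v J).
  move=> /eqP Kk; rewrite !ffunE Kk mulr_suml; apply: eq_bigr => I _.
  exact: mulr_sumr.
rewrite [RHS](eq_bigr _ e) [RHS]exchange_big /=; apply: eq_bigr => I /eqP Ik.
rewrite [RHS]exchange_big /=; apply: eq_bigr => J /eqP Jk.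
rewrite -MM cauchy_binet ?Ik ?Jk // scaler_suml; apply: eq_bigr => K /eqP Kk.
by rewrite minor_tr ?Kk ?Jk // -scalerAl -scalerAr scalerA.
Qed.

Lemma ipGP k c u v w : ipG G k (c *: u + v) w = c * ipG G k u w + ipG G k v w.
Proof.
rewrite !ipG_Lam mulrCA -mulrDr; congr (_ * _).
rewrite mulr_sumr -big_split /=; apply: eq_bigr => K _.
by rewrite linearP /= ffunE [X in (X + _) * _]ffunE mulrDl -scalerAl intD_add intD_scale.
Qed.

Lemma ipGC k u v : ipG G k u v = ipG G k v u.
Proof. by rewrite !ipG_Lam; congr (_ * _); apply: eq_bigr => K _; rewrite mulrC. Qed.

Lemma ipG_ge0 k u : 0 <= ipG G k u u.
Proof.
rewrite ipG_Lam mulr_ge0 ?sqrtr_ge0 //.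
by apply: sumr_ge0 => K _; apply: intD_sq_ge0.
Qed.

Hypothesis G0 : 0 < \det G.
Hypothesis MA : M *m A = 1%:M.

Lemma ipG_pure k u : pure k u -> ipG G k u u = Num.sqrt (\det G) *
   \sum_(K : {set 'I_d}) intD (Lam M u K * Lam M u K).
Proof.
move=> uk; rewrite ipG_Lam [in RHS](bigID (fun K : {set 'I_d} => #|K| == k)) /=.
rewrite [X in _ + X]big1 ?addr0 // => K Kk; rewrite ffunE big1 ?mulr0 ?linear0 // => J /eqP JK.
by rewrite uk ?scaler0 // JK.
Qed.

(** Pullback by [M] is bounded, and so is pullback by [A], which undoes it because
    [M *m A = 1%:M]. *)
Lemma ipG_n2 : exists2 C : R, 0 <= C & forall k u, pure k u ->
  ipG G k u u <= C * n2 u /\ n2 u <= C * ipG G k u u.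
Proof.
have [C1 C10 h1] := Lam_bound m M; have [C2 C20 h2] := Lam_bound m A.
have s0 : 0 < Num.sqrt (\det G) by rewrite sqrtr_gt0.
set s := Num.sqrt _ in s0 *.
have c1 : 0 <= s * C1 by rewrite mulr_ge0 // ltW.
have c2 : 0 <= C2 / s by rewrite divr_ge0 // ltW.
exists (s * C1 + C2 / s) => [|k u uk]; first exact: addr_ge0.
have n0 := n2_ge0 u; have i0 := ipG_ge0 k u; split.
  apply: le_trans (_ : s * C1 * n2 u <= _); last by rewrite ler_wpM2r // lerDl.
  by rewrite ipG_pure // -mulrA ler_wpM2l ?h1 // ltW.
apply: le_trans (_ : C2 / s * ipG G k u u <= _); last by rewrite ler_wpM2r // lerDr.
rewrite ipG_pure // -/s mulrA divfK ?gt_eqF //.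
by have := h2 (Lam M u); rewrite LamM MA Lam1.
Qed.

Lemma ipG_eq0 k u : pure k u -> ipG G k u u = 0 -> u = 0.
Proof.
move=> uk e; have [C _ h] := ipG_n2; have [_] := h _ _ uk.
by rewrite e mulr0 => h0; apply: n2_eq0; apply/eqP; rewrite eq_le h0 n2_ge0.
Qed.

End InnerProduct.

(** * Unisolvence and stability *)

Section Unisolvence.
Variables (R : realType) (d : nat) (vt : 'I_d.+1 -> 'rV[R]_d).
Hypothesis heq : equilateral vt.
Implicit Types (S F : {set 'I_d.+1}).

Lemma card_set_ord n (I : {set 'I_n}) : (#|I| <= n)%N.
Proof. by have := max_card (mem I); rewrite card_ord. Qed.

Lemma dimS_succ S : (0 < #|S|)%N -> #|S| = (dimS S).+1.
Proof. by move=> S0; rewrite /dimS prednK. Qed.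

Section Ip.
Variables (S : {set 'I_d.+1}) (S0 : (0 < #|S|)%N).
Local Notation form := (dform R (dimS S)).
Implicit Types a b u v w : form.
Let MM := linv_tr heq (dimS_succ S0).

Lemma ipSP k c u v w : ipS vt S k (c *: u + v) w = c * ipS vt S k u w + ipS vt S k v w.
Proof. exact: (ipGP MM). Qed.
Lemma ipSC k u v : ipS vt S k u v = ipS vt S k v u.
Proof. exact: (ipGC MM). Qed.
Lemma ipS_ge0 k u : 0 <= ipS vt S k u u.
Proof. exact: (ipG_ge0 MM). Qed.
Lemma ipS_eq0 k u : pure k u -> ipS vt S k u u = 0 -> u = 0.
Proof.
exact: (ipG_eq0 MM (gram_det_gt0 heq (dimS_succ S0)) (linvK heq (dimS_succ S0))).
Qed.
Lemma ipS_n2 : exists2 C : R, 0 <= C & forall k u, pure k u ->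
  ipS vt S k u u <= C * n2 u /\ n2 u <= C * ipS vt S k u u.
Proof.
exact: (ipG_n2 MM (gram_det_gt0 heq (dimS_succ S0)) (linvK heq (dimS_succ S0))).
Qed.

Lemma ipSD k u v w : ipS vt S k (u + v) w = ipS vt S k u w + ipS vt S k v w.
Proof. by rewrite -[u]scale1r ipSP mul1r scale1r. Qed.
Lemma ipSB k u v w : ipS vt S k (u - v) w = ipS vt S k u w - ipS vt S k v w.
Proof. by rewrite addrC -scaleN1r ipSP mulN1r addrC. Qed.
Lemma ipS0 k w : ipS vt S k 0 w = 0.
Proof. by have := ipSP k (-1) 0 0 w; rewrite scaler0 addr0 mulN1r addNr. Qed.

Lemma ipS_sqrD k u v :
  ipS vt S k (u + v) (u + v) = ipS vt S k u u + 2 * ipS vt S k u v + ipS vt S k v v.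
Proof. by rewrite ipSD !(ipSC _ _ (u + v)) !ipSD (ipSC k v u); ring. Qed.
Lemma ipS_sqrB k u v :
  ipS vt S k (u - v) (u - v) = ipS vt S k u u - 2 * ipS vt S k u v + ipS vt S k v v.
Proof. by rewrite ipSB !(ipSC _ _ (u - v)) !ipSB (ipSC k v u); ring. Qed.

(** In top degree the inner product is a constant times the integral, and the constant is nonzero,
    for otherwise the volume form would have norm zero. *)
Lemma ip_one_top a : ipS vt S (dimS S) (one_top (dimS S)) a = 0 -> intD (a setT) = 0.
Proof.
have e b c : ipS vt S (dimS S) b c = Num.sqrt (\det (Gram vt S)) *
    (minor (invmx (Gram vt S)) setT setT * intD (b setT * c setT)).
  have cT (I : {set 'I_(dimS S)}) : (#|I| == dimS S) = (I == setT).
    by rewrite eqEcard subsetT cardsT card_ord eqn_leq card_set_ord.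
  rewrite /ipS /ipG (big_pred1 setT) // (big_pred1 setT) //.
  by rewrite intD_scale.
rewrite e ffunE eqxx mul1r => /eqP; rewrite mulf_eq0 => /orP [|].
  by rewrite gt_eqF // sqrtr_gt0; apply: gram_det_gt0 => //; apply: dimS_succ.
rewrite mulf_eq0 => /orP [/eqP m0|/eqP //].
have o : one_top (dimS S) = 0 :> form.
  apply: (@ipS_eq0 (dimS S)); last by rewrite e m0 mul0r mulr0.
  move=> I; rewrite ffunE; case: (eqVneq I setT) => // ->.
  by rewrite cardsT card_ord eqxx.
have := congr1 (fun w : form => w setT) o; rewrite !ffunE eqxx => /eqP.
by rewrite oner_eq0.
Qed.

End Ip.

Lemma trace_extd S w : trace vt S (extd w) = extd (trace vt S w).
Proof. by rewrite !traceE /tr pull_extd. Qed.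

Lemma traceD S u w : trace vt S (u + w) = trace vt S u + trace vt S w.
Proof. by rewrite !traceE /tr linearD. Qed.

Lemma traceB S u w : trace vt S (u - w) = trace vt S u - trace vt S w.
Proof. by rewrite !traceE /tr linearB. Qed.

Variables (c : nat -> bool) (p : nat).
Local Notation X n := (@Xcx R n c p).

Lemma trace_Xcx S k w : X d k w -> X (dimS S) k (trace vt S w).
Proof. by rewrite traceE; apply: pull_Xcx. Qed.

Lemma bdry_trace0P S w : (0 < dimS S)%N -> bdry_trace0 vt S w <-> Ztr (trace vt S w).
Proof.
move=> S1; have cS : #|S| = (dimS S).-1.+2 by move: S1; rewrite /dimS; lia.
rewrite (bdry_trace0_Ztr vt w cS) traceE.
have e : dimS S = (dimS S).-1.+1 by rewrite prednK.
by move: ((dimS S).-1) e => n ->.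
Qed.

(** Extension by [ext] shows that nothing is lost in passing through forms on the whole space, so
    the traced spaces are intrinsic to [S]. *)
Lemma XringP S k a : (0 < dimS S)%N -> Xring vt (X d) k S a <-> X (dimS S) k a /\ Ztr a.
Proof.
move=> S1; split=> [[w [Xw bw ->]]|[Xa Za]].
  by split; [apply: trace_Xcx|apply/bdry_trace0P].
have aE : trace vt S (ext vt S a) = a.
  by rewrite traceE extK //; move: S1; rewrite /dimS; lia.
exists (ext vt S a); split=> //; first exact: pull_Xcx.
by apply/bdry_trace0P => //; rewrite aE.
Qed.

Lemma Xring_split S k a : (0 < dimS S)%N -> Xring vt (X d) k S a ->
  exists f z, [/\ XringI vt (X d) k S f, Xring vt (X d) k S z, extd z = 0 & a = f + z].
Proof.
move=> S1 /XringP [] // Xa Za; have S0 : (0 < #|S|)%N by move: S1; rewrite /dimS; lia.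
pose K (z : dform R (dimS S)) := [/\ X (dimS S) k z, Ztr z & extd z = 0].
have sK : subspace K.
  split=> [|e u v [u1 u2 u3] [v1 v2 v3]]; first by split; [exact: Xcx0|exact: Ztr0|exact: linear0].
  split; [exact: XcxP|exact: ZtrP|].
  by rewrite linearP /= u3 v3 scaler0 addr0.
have [e u v|z [z1 z2 z3] z0|z [z1 z2 z3] hz] := @riesz _ _ _ (ipSP S0 k) (ipSC S0 k) _ K
    (fun z => ipS vt S k z a) sK (fun z => fun hz : K z => inspan_form (Xcx_Pdeg (let: And3 h _ _ := hz in h))).
- by rewrite ipSP.
- have -> : z = 0 by apply: (ipS_eq0 S0) z0; apply: Xcx_pure z1.
  by rewrite ipS0 //; split=> // w _; rewrite ipS0.
exists (a - z), z; rewrite subrK; split=> //; last exact/XringP.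
split=> [|w /XringP [] // Xw Zw dw].
  apply/XringP => //; rewrite addrC -scaleN1r; split; [exact: XcxP|exact: ZtrP].
by rewrite ipSB // hz // ipSC // subrr.
Qed.

(** For [k > 0] exactness gives [z = d q], and only the part of [q] in [XringI] contributes to
    [d q], so the type-II functionals see all of [z]. For [k = 0] a closed zero-trace form
    vanishes. *)
Lemma closed_orthogonal S k a z : (dimS S <= 3)%N -> (k <= dimS S)%N -> (0 < dimS S)%N ->
  ((0 < k <= dimS S)%N -> forall psi, XringI vt (X d) k.-1 S psi -> ipS vt S k (extd psi) a = 0) ->
  X (dimS S) k z -> Ztr z -> extd z = 0 -> (k = dimS S -> intD (z setT) = 0) ->
  ipS vt S k z a = 0.
Proof.
move=> S3 kS S1 h Xz Zz dz z0; have S0 : (0 < #|S|)%N by move: S1; rewrite /dimS; lia.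
case: k kS h Xz z0 => [|k] kS h Xz z0.
  have -> : z = 0 by apply: closed0_Ztr => //; apply: Xcx_pure Xz.
  by rewrite ipS0.
have [|q [Xq Zq dq]] := Xcx_exact _ Xz dz Zz z0; first by rewrite kS.
have [|f [y [If /XringP [] // _ _ dy qE]]] := @Xring_split S k q S1; first exact/XringP.
by rewrite -dq qE linearD /= dy addr0 h.
Qed.

Lemma pure_top_extd n k (a : dform R n) : (n <= k)%N -> pure k a -> extd a = 0.
Proof.
move=> nk ap; apply/ffunP => I; rewrite [RHS]ffunE; apply: (pure_extd ap).
by rewrite neq_ltn ltnS (leq_trans (card_set_ord I)).
Qed.

Lemma mpoly0C (q : {mpoly R[0]}) : q = (q@_0)%:MP.
Proof.
apply/mpolyP => m; have -> : m = 0%MM by apply/mnmP => -[].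
by rewrite mcoeffC eqxx mulr1.
Qed.

Lemma pure_point n (a : dform R n) : n = 0%N -> pure 0 a -> intD (a setT) = 0 -> a = 0.
Proof.
move=> n0; subst n => ap; rewrite (mpoly0C (a setT)) intDC => /eqP.
rewrite mulf_eq0 invr_eq0 pnatr_eq0 orbF => /eqP a0.
apply/ffunP => I; rewrite ffunE; have -> : I = setT by apply/setP => -[].
by rewrite (mpoly0C (a setT)) a0 mpolyC0.
Qed.

(** Type-I functionals make the trace closed; type-II functionals make it orthogonal to the closed
    forms, hence to itself. In top degree exactness needs zero mean, supplied by the functional
    [(1, .)]. *)
Lemma dofs0_trace0 S k v : (0 < #|S|)%N -> (dimS S <= 3)%N -> X d k v -> bdry_trace0 vt S v ->
  dofs0 vt (X d) k S v -> trace vt S v = 0.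
Proof.
move=> S0 S3 Xv bv [h1 h2 h3]; have Xa := trace_Xcx S Xv; have ap := Xcx_pure Xa.
have Za : (0 < dimS S)%N -> Ztr (trace vt S v) by move=> S1; apply/bdry_trace0P.
move: (trace vt S v) h1 h2 h3 Xa ap Za => a h1 h2 h3 Xa ap Za.
have [kS|kS] := ltnP (dimS S) k.
  by apply/ffunP => I; rewrite ffunE ap // neq_ltn (leq_ltn_trans (card_set_ord I) kS).
have a0 : k = dimS S -> intD (a setT) = 0.
  by move=> e; apply: ip_one_top => //; have := h1 (esym e); rewrite {1}e.
have [S1|S1] := posnP (dimS S).
  have k0 : k = 0%N by apply/eqP; rewrite -leqn0 -S1.
  apply: (pure_point S1); first by move: ap; rewrite k0.
  by apply: a0; apply/eqP; rewrite eqn_leq kS S1.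
have {}Za := Za S1.
apply: (ipS_eq0 S0 ap); apply: closed_orthogonal => //.
have [kS'|kS'] := ltnP k (dimS S); last exact: pure_top_extd ap.
have [|f [z [If _ dz aE]]] := @Xring_split S k a S1; first exact/XringP.
apply: (@ipS_eq0 _ S0 k.+1); first exact: pure_extd.
have da : extd a = extd f by rewrite aE linearD /= dz addr0.
by have := h2 kS' _ If; rewrite -da.
Qed.

Lemma unisolvence k v : (d <= 3)%N -> X d k v ->
  (forall S, (0 < #|S|)%N -> S != setT -> dofs0 vt (X d) k S v) -> bdry_trace0 vt setT v.
Proof.
move=> d3 Xv hv.
suff h n S : #|S| = n -> (0 < #|S|)%N -> S != setT -> trace vt S v = 0.
  move=> F FT cF F0; apply: (h _ _ erefl) => //; apply/eqP => FE.
  by move: cF; rewrite FE cardsT card_ord; lia.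
elim/ltn_ind: n S => n IH S cS S0 ST; apply: (@dofs0_trace0 _ k) => //.
- by apply: leq_trans d3; rewrite /dimS -subn1 leq_subLR card_set_ord.
- move=> F FS cF F0; apply: (IH #|F|) => //; first by rewrite cF -cS; case: #|S| S0.
  by apply: contraNneq ST => FE; rewrite -subTset -FE.
- exact: hv.
Qed.

Local Notation T := [set: 'I_d.+1].
Let T0 : (0 < #|T|)%N. Proof. by rewrite cardsT card_ord. Qed.

Lemma nrm2D_le j u w : nrm2 vt j (u + w) <= 2 * nrm2 vt j u + 2 * nrm2 vt j w.
Proof.
rewrite /nrm2 traceD; move: (trace _ _ u) (trace _ _ w) => a b.
have := ipS_ge0 T0 j (a - b); rewrite ipS_sqrB // ipS_sqrD //; lra.
Qed.

Lemma nrm2B_le j u w : nrm2 vt j (u - w) <= 2 * nrm2 vt j u + 2 * nrm2 vt j w.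
Proof.
rewrite /nrm2 traceB; move: (trace _ _ u) (trace _ _ w) => a b.
have := ipS_ge0 T0 j (a + b); rewrite ipS_sqrB // ipS_sqrD //; lra.
Qed.

(** * Stability of the splitting *)

Section Stability.
Hypothesis d3 : (0 < d <= 3)%N.
Variables (k : nat) (kd : (k < d)%N).
Local Notation nr j a := (ipS vt T j a a).

Lemma dimS_setT : dimS T = d.
Proof. by rewrite /dimS cardsT card_ord. Qed.

Let T1 : (0 < dimS T)%N. Proof. by rewrite dimS_setT; case/andP: d3. Qed.
Let kT : (k < dimS T)%N. Proof. by rewrite dimS_setT. Qed.
Let T3 : (dimS T <= 3)%N. Proof. by rewrite dimS_setT; case/andP: d3. Qed.

Lemma orthogonal_split K u uG uI :
  (forall f, XringI vt (X d) k T f -> nr k f <= K * nr k.+1 (extd f)) ->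
  XG vt (X d) k uG -> XI vt (X d) k uI -> u = uG + uI ->
  nrm2 vt k.+1 (extd u) = nrm2 vt k.+1 (extd uG) + nrm2 vt k.+1 (extd uI) /\
  nrm2 vt k uI <= K * nrm2 vt k.+1 (extd uI) + nrm2 vt k u.
Proof.
move=> hK [XuG [_ h2 h3]] [XuI hI] ->; rewrite /nrm2 !trace_extd !traceD.
have Zb : Ztr (trace vt T uI).
  by apply/bdry_trace0P => //; apply: unisolvence hI => //; case/andP: d3.
have Xb : X (dimS T) k (trace vt T uI) := trace_Xcx _ XuI.
move: (trace vt T uG) (trace vt T uI) h2 h3 Xb Zb => a b h2 h3 Xb Zb.
have [|f [z [If /XringP [] // Xz Zz dz bE]]] := @Xring_split T k b T1; first exact/XringP.
have db : extd b = extd f by rewrite bE linearD /= dz addr0.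
have oba : ipS vt T k.+1 (extd a) (extd b) = 0.
  by rewrite ipSC // db; apply: (h2 kT).
have oza : ipS vt T k z a = 0.
  by apply: (closed_orthogonal T3 (ltnW kT)) => // e; move: kT; rewrite e ltnn.
have ofz : ipS vt T k f z = 0 by apply: If.2 => //; apply/XringP.
split; first by rewrite linearD /= ipS_sqrD // oba mulr0 addr0.
have fK := hK _ If; rewrite -db in fK.
have e1 : nr k b = nr k f + nr k z by rewrite bE ipS_sqrD // ofz mulr0 addr0.
have e2 : ipS vt T k z (a + b) = nr k z.
  by rewrite ipSC // ipSD // [ipS _ _ _ a z]ipSC // oza add0r bE ipSD // ofz add0r.
(* As [(z, u) = |z|^2], expanding [|u - z|^2 >= 0] gives [|z|^2 <= |u|^2], to be added to the bound
   on [f]. *)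
have := ipS_ge0 T0 k ((a + b) - z); rewrite ipS_sqrB // [ipS _ _ _ _ z]ipSC // e2 e1; lra.
Qed.

End Stability.

End Unisolvence.

Lemma XringI_poincare (R : realType) d (vt : 'I_d.+1 -> 'rV[R]_d) k (S : {set 'I_d.+1}) :
  equilateral vt -> (k < dimS S <= 3)%N ->
  exists2 K : R, 0 <= K & forall c p f, XringI vt (@Xcx R d c p) k S f ->
  ipS vt S k f f <= K * ipS vt S k.+1 (extd f) (extd f).
Proof.
move=> heq kS; have [C C0 hC] := Xcx_potential R kS.
have S1 : (0 < dimS S)%N by case/andP: kS => /(leq_ltn_trans (leq0n _)).
have S0 : (0 < #|S|)%N by move: S1; rewrite /dimS; lia.
have [N N0 hN] := ipS_n2 heq S0.
(* [N] enters twice: passing to the Euclidean norm of the unit simplex and back. *)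
exists (N * (C * N)) => [|c p f [Xf orth]]; first by rewrite !mulr_ge0.
have /XringP [] // := Xf => Xcf Zf; have [q [Xq Zq dq qC]] := hC _ _ _ Xcf Zf.
have fp := Xcx_pure Xcf.
have o : ipS vt S k f (f - q) = 0.
  apply: orth; last by rewrite linearB /= dq subrr.
  apply/XringP => //; rewrite addrC -scaleN1r; split; [exact: XcxP|exact: ZtrP].
have fq : ipS vt S k f f <= ipS vt S k q q.
  have := ipS_ge0 heq S0 k (q - f); move: o; rewrite ipS_sqrB // ipSC // ipSB // [ipS _ _ _ q f]ipSC //; lra.
apply: le_trans fq _; rewrite -!mulrA; apply: le_trans (proj1 (hN _ _ (Xcx_pure Xq))) _.
rewrite ler_wpM2l //; apply: le_trans qC _; rewrite ler_wpM2l //.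
by apply: (proj2 (hN _ _ (pure_extd fp))).
Qed.

Lemma half_le_of_double (R : realFieldType) (x y z : R) : x <= 2 * y + 2 * z -> x / 2 <= y + z.
Proof. lra. Qed.

(** Here [x], [y], [z] are the squared norms of [u], [uG], [uI], and [v], [w] those of the
    derivatives of [uI] and [u]. The sum is at most [2 x + 3 z], and [z <= x + s w]. *)
Lemma stability_arith (R : realFieldType) (x y z v w t s : R) :
  y <= 2 * x + 2 * z -> z <= t * v + x -> t * v <= s * w -> 0 <= s * x -> 0 <= x -> 0 <= w ->
  y + z <= (5 + 3 * s) * (x + w).
Proof. nra. Qed.

Theorem mainTheorem10 (R : realType) (d : nat) (hd : d = 2%N \/ d = 3%N)
  (vt : 'I_d.+1 -> 'rV[R]_d) (heq : equilateral vt) :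
  exists C : R,
    forall (c : nat -> bool) (p k : nat), (1 <= p)%N -> (k < d)%N ->
    forall u uG uI : dform R d,
      Xcx c p k u ->
      XG vt (Xcx c p) k uG -> XI vt (Xcx c p) k uI -> u = uG + uI ->
      [/\ nrm2 vt k u / 2 <= nrm2 vt k uG + nrm2 vt k uI,
          nrm2 vt k uG + nrm2 vt k uI
            <= C * (nrm2 vt k u + nrm2 vt k.+1 (extd u)) &
          nrm2 vt k.+1 (extd u) = nrm2 vt k.+1 (extd uG) + nrm2 vt k.+1 (extd uI)].
Proof.
have d3 : (0 < d <= 3)%N by case: hd => ->.
have T0 : (0 < #|[set: 'I_d.+1]|)%N by rewrite cardsT card_ord.
(* There are finitely many form degrees, so summing their constants makes [C] independent of [k] as
   well as of [c] and [p]. *)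
have /fin_all_exists2 [K K0 hK] : forall k : 'I_d, exists2 K : R, 0 <= K &
    forall c p f, XringI vt (@Xcx R d c p) k setT f ->
    ipS vt setT k f f <= K * ipS vt setT k.+1 (extd f) (extd f).
  by move=> k; apply: XringI_poincare => //; rewrite dimS_setT ltn_ord; case/andP: d3.
exists (5 + 3 * \sum_k K k) => c p k _ kd u uG uI _ hG hI uE.
have [e3 e2] := orthogonal_split heq d3 kd (hK (Ordinal kd) c p) hG hI uE.
have n0 j w : 0 <= nrm2 vt j w by apply: ipS_ge0.
have KS : K (Ordinal kd) <= \sum_k K k.
  by rewrite (bigD1 (Ordinal kd)) //= lerDl; apply: sumr_ge0 => i _; apply: K0.
have dK : K (Ordinal kd) * nrm2 vt k.+1 (extd uI) <= (\sum_k K k) * nrm2 vt k.+1 (extd u).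
  apply: ler_pM; [exact: K0|exact: n0|exact: KS|].
  by rewrite e3 lerDr; exact: n0.
have SK : 0 <= (\sum_k K k) * nrm2 vt k u by apply: mulr_ge0; [exact: le_trans (K0 _) KS|exact: n0].
have le1 : nrm2 vt k u <= 2 * nrm2 vt k uG + 2 * nrm2 vt k uI by rewrite uE; exact: nrm2D_le.
have le2 : nrm2 vt k uG <= 2 * nrm2 vt k u + 2 * nrm2 vt k uI.
  by rewrite -{1}[uG](addrK uI) -uE; exact: nrm2B_le.
split; [exact: half_le_of_double le1| |exact: e3].
exact: (stability_arith le2 e2 dK SK (n0 _ _) (n0 _ _)).
Qed.
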